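(* Assume $\mathcal V\equiv\mathcal V^m$. (i) If $\mathcal V$ is continuous in $Dom(\mathcal V)$ and satisfies the boundary condition $\lim_{x\to\bar x}\mathcal V(x)=+\infty$ for all $\bar x\in\partial Dom(\mathcal V)$, then $\mathcal V$ (with $\Omega=Dom(\mathcal V)$) is the unique nonnegative viscosity solution to (BVP) among the pairs $(u,\Omega)$, $\Omega=Dom(u)$, such that $u$ is continuous in $\Omega$ and $\lim_{x\to\bar x}u(x)=+\infty$ for all $\bar x\in\partial Dom(u)$. (ii) If for each $x\in\mathbb R^n$ the set $\{(\mu,\gamma)\in\mathbb R^{n+1}:\ \exists a\in A \text{ such that } \mu=f(x,a),\ l(x,a)\le\gamma\}$ is convex and $\mathcal V$ is continuous on $\partial\mathcal T$, then $(\mathcal V,Dom(\mathcal V))$ is the unique nonnegative viscosity solution to (BVP) among the pairs $(u,\Omega)$, $\Omega=Dom(u)$, such that $\lim_{x\to\bar x}u(x)=+\infty$ for all $\bar x\in\partial Dom(u)$. Moreover, $\mathcal V$ is continuous.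
   Context: Standing setting. $A\subset\mathbb R^m$ is compact; the target $\mathcal T\subset\mathbb R^n$ is closed with compact boundary; $\mathcal T^c=\mathbb R^n\setminus\mathcal T$, $\overset{\circ}{\mathcal T}$ is the interior of $\mathcal T$, $\mathbb R_+=[0,+\infty[$. The functions $f:\mathbb R^n\times A\to\mathbb R^n$ and $l:\mathbb R^n\times A\to\mathbb R_+$ are continuous; there is $M>0$ with $|f(x,a)|\le M(1+|x|)$ for all $(x,a)$, and for every $R>0$ there is $L_R>0$ with $|f(x_1,a)-f(x_2,a)|\le L_R|x_1-x_2|$ and $|l(x_1,a)-l(x_2,a)|\le L_R|x_1-x_2|$ whenever $|x_1|,|x_2|\le R$, $a\in A$. $\mathcal A$ is the set of measurable controls $\alpha:\mathbb R_+\to A$, and $y_x(\cdot,\alpha)$ is the solution on $\mathbb R_+$ of $\dot y(t)=f(y(t),\alpha(t))$, $y(0)=x$. Put $t_x(\alpha)=\inf\{t\ge0: y_x(t,\alpha)\in\mathcal T\}\le+\infty$, $\mathcal J(t,x,\alpha)=\int_0^t l(y_x(s,\alpha),\alpha(s))\,ds$, and $\mathcal A(x)=\{\alpha\in\mathcal A:\ \liminf_{t\to t_x(\alpha)^-}\mathrm{dist}(y_x(t,\alpha),\mathcal T)=0\}$. For $x\in\mathcal T^c$: $\mathcal V(x)=\inf_{\alpha\in\mathcal A(x)}\mathcal J(t_x(\alpha),x,\alpha)$ and $\mathcal V^m(x)=\inf_{\alpha\in\mathcal A}\mathcal J(t_x(\alpha),x,\alpha)$ (with $\inf\emptyset=+\infty$);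 both functions are $0$ on $\mathcal T$. ''Continuous on $\partial\mathcal T$'' means continuous at each point of $\partial\mathcal T$ as a function on $\mathbb R^n\setminus\overset{\circ}{\mathcal T}$. For $u:\mathbb R^n\setminus\overset{\circ}{\mathcal T}\to\mathbb R\cup\{+\infty\}$, $Dom(u)=\{x\in\mathbb R^n\setminus\overset{\circ}{\mathcal T}: u(x)<+\infty\}$; when $Dom(u)$ is used as an open set $\Omega\supset\mathcal T$, it is identified with $Dom(u)\cup\mathcal T$, and $\partial Dom(u)$ is the boundary relative to $\mathbb R^n\setminus\overset{\circ}{\mathcal T}$. (BVP). Let $\mathcal H(x,p)=\sup_{a\in A}\{-\langle p,f(x,a)\rangle-l(x,a)\}$; $u_*$, $u^*$ denote the lower and upper semicontinuous envelopes of $u$. A function $u:\mathbb R^n\setminus\overset{\circ}{\mathcal T}\to\mathbb R\cup\{+\infty\}$ is a supersolution to (BVP) if $u_*\ge0$ on $\partial\mathcal T$ and $u_*$ is a viscosity supersolution of $\mathcal H(x,Du(x))=0$ in $\mathbb R^n\setminus\mathcal T$. A pair $(u,\Omega)$, with $\Omega\supset\mathcal T$ open and $u:\Omega\setminus\overset{\circ}{\mathcal T}\to\mathbb R$ locally bounded, is a subsolution to (BVP) (in $\Omega$) if $u^*\le0$ on $\partial\mathcal T$ and $u^*$ is a viscosity subsolution of $\mathcal H(x,Du(x))=0$ in $\Omega\setminus\mathcal T$. A pair $(u,\Omega)$ with $u:\mathbb R^n\setminus\overset{\circ}{\mathcal T}\to\mathbb R\cup\{+\infty\}$ and $\Omega\supset\mathcal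 T$ open is a solution to (BVP) if $u$ is a supersolution and $(u,\Omega)$ (with $u$ restricted to $\Omega\setminus\overset{\circ}{\mathcal T}$) is a subsolution. It is nonnegative if $u\ge0$. *)

(* Defs.v *)
From HB Require Import structures.
From mathcomp Require Import all_boot all_order all_algebra.
From mathcomp Require Import all_classical all_reals all_analysis.

Set Implicit Arguments.
Unset Strict Implicit.
Unset Printing Implicit Defensive.

Import Order.TTheory GRing.Theory Num.Theory.
Import numFieldNormedType.Exports.

Local Open Scope classical_set_scope.
Local Open Scope ring_scope.

(* [interior T] is the topological interior of [T].  A function defined on
   R^n \ interior T with values in R or R u {+oo} is represented by a total
   function ['rV[R]_n -> \bar R] of which only the values on
   [outside T] are ever used.  Likewise a function on R_+ (control, trajectory)
   is a total function on [R] of which only the values on [0, +oo[ are used. *)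

Section Euclidean.
Context {R : realType} {n : nat}.
Implicit Types x p : 'rV[R]_n.

Definition dotp p x : R := \sum_(i < n) p 0 i * x 0 i.

(* The library norm on ['rV[R]_n] is the sup norm; the topologies agree. *)
Definition enorm x : R := Num.sqrt (dotp x x).

(* +oo when T is empty *)
Definition dist (T : set 'rV[R]_n) x : \bar R :=
  ereal_inf [set (enorm (x - z))%:E | z in T].

Definition outside (T : set 'rV[R]_n) : set 'rV[R]_n := ~` interior T.

Definition boundary (T : set 'rV[R]_n) : set 'rV[R]_n :=
  closure T `\` interior T.

(* Topological boundary of D in the subspace X, for D included in X. *)
Definition boundary_in (X D : set 'rV[R]_n) : set 'rV[R]_n :=
  X `&` closure D `&` closure (X `\` D).

End Euclidean.

Section Control.
Context {R : realType} {n m : nat}.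
Variables (f : 'rV[R]_n -> 'rV[R]_m -> 'rV[R]_n)
          (l : 'rV[R]_n -> 'rV[R]_m -> R)
          (A : set 'rV[R]_m) (T : set 'rV[R]_n).
Implicit Types (x : 'rV[R]_n) (alpha : R -> 'rV[R]_m).

(* A map into R^m is measurable when its coordinates are. *)
Definition controls : set (R -> 'rV[R]_m) :=
  [set alpha | (forall t, 0 <= t -> A (alpha t)) /\
     forall i : 'I_m, measurable_fun (`[0, +oo[ : set R) (fun t : R => alpha t 0 i)].

(* Solution in the sense of Caratheodory, as controls are only measurable. *)
Definition is_trajectory x alpha (y : R -> 'rV[R]_n) : Prop :=
  {within (`[0, +oo[ : set R), continuous y} /\
  forall (t : R) (i : 'I_n), 0 <= t ->
    y t 0 i = x 0 i +
      Rintegral lebesgue_measure `[0, t] (fun s : R => f (y s) (alpha s) 0 i).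

(* Under the standing assumptions the solution exists and is unique on
   [0, +oo[, which makes this choice irrelevant there. *)
Definition trajectory x alpha : R -> 'rV[R]_n := get (is_trajectory x alpha).

Definition entry_time x alpha : \bar R :=
  ereal_inf [set t%:E | t in [set t : R | 0 <= t /\ T (trajectory x alpha t)]].

Definition cost (t : \bar R) x alpha : \bar R :=
  (\int[lebesgue_measure]_(s in [set s : R | (0 <= s)%R /\ s%:E <= t])
     (l (trajectory x alpha s) (alpha s))%:E)%E.

(* The filter of real s tending to t from the left. *)
Definition left_filter (t : \bar R) : set_system R :=
  match t with
  | r%:E => r^'-
  | +oo%E => pinfty_nbhs R
  | -oo%E => ninfty_nbhs R
  end.

Definition approaching_controls x : set (R -> 'rV[R]_m) :=
  [set alpha | controls alpha /\
     limf_einf (fun t => dist T (trajectory x alpha t))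
               (left_filter (entry_time x alpha)) = 0%E].

Definition value x : \bar R :=
  if x \in T then 0%E
  else ereal_inf [set cost (entry_time x alpha) x alpha
                 | alpha in approaching_controls x].

Definition value_m x : \bar R :=
  if x \in T then 0%E
  else ereal_inf [set cost (entry_time x alpha) x alpha
                 | alpha in controls].

Definition hamiltonian (x p : 'rV[R]_n) : \bar R :=
  ereal_sup [set (- dotp p (f x a) - l x a)%:E | a in A].

End Control.

Section Viscosity.
Context {R : realType} {n : nat}.
Implicit Types (u w : 'rV[R]_n -> \bar R) (X O : set 'rV[R]_n).

(* Semicontinuous envelopes of the restriction of u to X; the neighbourhoods
   [within X (nbhs x)] are not punctured, so u x itself is taken into account
   for x in X. *)
Definition lsc_env X u (x : 'rV[R]_n) : \bar R := limf_einf u (within X (nbhs x)).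
Definition usc_env X u (x : 'rV[R]_n) : \bar R := limf_esup u (within X (nbhs x)).

Definition grad (phi : 'rV[R]_n -> R) (x : 'rV[R]_n) : 'rV[R]_n :=
  \row_(i < n) 'D_(delta_mx 0 i) phi x.

Definition C1_on O (phi : 'rV[R]_n -> R) : Prop :=
  forall x, O x -> differentiable phi x /\ {for x, continuous (grad phi)}.

(* O is open; test functions touch w only at points where w is finite. *)
Definition visc_supersol (H : 'rV[R]_n -> 'rV[R]_n -> \bar R) O w : Prop :=
  forall phi x, C1_on O phi -> O x -> w x \is a fin_num ->
    (\forall z \near x, w x - (phi x)%:E <= w z - (phi z)%:E)%E ->
    (0 <= H x (grad phi x))%E.

Definition visc_subsol (H : 'rV[R]_n -> 'rV[R]_n -> \bar R) O w : Prop :=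
  forall phi x, C1_on O phi -> O x -> w x \is a fin_num ->
    (\forall z \near x, w z - (phi z)%:E <= w x - (phi x)%:E)%E ->
    (H x (grad phi x) <= 0)%E.

End Viscosity.

Section BVP.
Context {R : realType} {n : nat}.
Variables (H : 'rV[R]_n -> 'rV[R]_n -> \bar R) (T : set 'rV[R]_n).
Implicit Types (u : 'rV[R]_n -> \bar R) (Omega : set 'rV[R]_n).

Definition bvp_supersolution u : Prop :=
  [/\ forall x, outside T x -> u x != -oo%E,
      forall x, boundary T x -> (0 <= lsc_env (outside T) u x)%E
    & visc_supersol H (~` T) (lsc_env (outside T) u)].

Definition locally_bounded_on (D : set 'rV[R]_n) u : Prop :=
  forall x, D x -> exists M : R,
    \forall z \near within D (nbhs x), (`|u z| <= M%:E)%E.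

Definition bvp_subsolution u Omega : Prop :=
  let D := Omega `\` interior T in
  [/\ open Omega /\ T `<=` Omega,
      forall x, D x -> u x \is a fin_num,
      locally_bounded_on D u,
      forall x, boundary T x -> (usc_env D u x <= 0)%E
    & visc_subsol H (Omega `\` T) (usc_env D u)].

Definition bvp_solution u Omega : Prop :=
  bvp_supersolution u /\ bvp_subsolution u Omega.

Definition Dom u : set 'rV[R]_n := [set x | outside T x /\ (u x < +oo)%E].

(* The limit is over z in [outside T], z = xb included: it forces
   u xb = +oo, so that Dom u is open relative to [outside T]. *)
Definition blows_up u : Prop :=
  forall xb, boundary_in (outside T) (Dom u) xb ->
    u z @[z --> within (outside T) (nbhs xb)] --> +oo%E.

Definition nonneg_bvp_solution u : Prop :=
  (forall x, outside T x -> (0 <= u x)%E) /\ bvp_solution u (Dom u `|` T).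

(* u is the only member of the class P, as a function on [outside T]. *)
Definition unique_in (P : ('rV[R]_n -> \bar R) -> Prop) u : Prop :=
  P u /\ forall v, P v -> forall x, outside T x -> v x = u x.

End BVP.

(* Main.v *)
Require Import Defs.
From HB Require Import structures.
From mathcomp Require Import all_boot all_order all_algebra.
From mathcomp Require Import all_classical all_reals all_analysis.
From mathcomp Require Import measurable_realfun.
From mathcomp Require Import ring lra.

Set Implicit Arguments.
Unset Strict Implicit.
Unset Printing Implicit Defensive.

Import Order.TTheory GRing.Theory Num.Theory.
Import numFieldNormedType.Exports.

Local Open Scope classical_set_scope.
Local Open Scope ring_scope.

(* Comparison is done by dynamic programming.  Given a nonnegative lower semicontinuous
   supersolution w, an Euler scheme driven by the minimizers of w + |. - y|^2 / e yields controls
   along which w decreases almost as fast as the running cost grows.  The error of the arcs is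
   harmless if w is continuous; under the convexity assumption the arcs converge to a genuine
   trajectory, whose control is found by measurable selection.  Concatenating such controls with
   geometrically decreasing errors, one either never stops or comes near T, where V^m is small:
   in both cases V^m <= w.  Given a subsolution v, doubling variables along an arbitrary
   trajectory shows that v is at most the running cost plus the value of v further on; this is
   propagated backwards from times at which the trajectory is close to T, where v is small, and
   the blow-up of v on the boundary of Dom v keeps the trajectory in Dom v.  Hence v <= V.  A
   solution u thus satisfies u <= V = V^m <= u_* <= u.  Upper semicontinuity of V, which makes it
   a solution, comes from V = V^m, since V only involves controls that approach T. *)

(** Controls are only measurable, so an arc need not have a velocity at a given time and the
    viscosity inequalities cannot be tested along it pointwise in time. Both comparison arguments
    therefore use only the quadratic test functions [penalty k y]: the inequality is frozen at one
    optimal point z, integrated over a time step h with an error of order h^2, and the steps are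
    summed by [time_stepping]. The Euler scheme controls w at a point z close to the end of the arc,
    not at the end itself, where lower semicontinuity gives no upper bound; this is the gap that
    continuity or convexity closes. A chained control may run forever without coming near T, so it
    is a competitor for V^m but not for V. Conversely a subsolution is known to be small only near
    T, so it can be bounded only along controls that approach T. Uniqueness thus rests on V =
    V^m. *)

(** * Integrals over compact intervals, Gronwall's inequality, time stepping *)

Section IntervalIntegral.
Context {R : realType}.
Implicit Types (k : R -> R) (a b c s t : R).
Local Notation mu := (@lebesgue_measure R).

(** The integrands met along trajectories are of this kind, controls being only measurable. The
    class is stable under sums, products and shifts, and its members are integrable on compact
    intervals of the half-line. *)
Definition locally_bounded_measurable k : Prop :=
  measurable_fun (`[0, +oo[ : set R) k /\
  forall t, exists C : R, forall s, 0 <= s <= t -> `|k s| <= C.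

Definition itg k a b : R := Rintegral mu `[a, b] k.

Lemma lbm_integrable k a b : locally_bounded_measurable k -> 0 <= a ->
  mu.-integrable `[a, b] (EFin \o k).
Proof.
move=> [mk bk] a0; apply: measurable_bounded_integrable => //.
- have : compact `[a, b] by exact: segment_compact.
  exact: compact_finite_measure.
- apply: measurable_funS mk => //; apply: subset_itv => //.
- have [C HC] := bk b; exists C; split; first exact: num_real.
  move=> M CM s; rewrite /= in_itv/= => /andP[as_ sb].
  by rewrite (le_trans _ (ltW CM))// HC// sb (le_trans a0).
Qed.

Lemma lbm_cst c : locally_bounded_measurable (fun=> c).
Proof. by split; [exact: measurable_cst | move=> t; exists `|c|]. Qed.

Lemma lbmD k1 k2 : locally_bounded_measurable k1 -> locally_bounded_measurable k2 ->
  locally_bounded_measurable (fun s => k1 s + k2 s).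
Proof.
move=> [m1 b1] [m2 b2]; split; first exact: measurable_funD.
move=> t; have [C1 H1] := b1 t; have [C2 H2] := b2 t; exists (C1 + C2) => s st.
by rewrite (le_trans (ler_normD _ _))// lerD ?H1 ?H2.
Qed.

Lemma lbmM k1 k2 : locally_bounded_measurable k1 -> locally_bounded_measurable k2 ->
  locally_bounded_measurable (fun s => k1 s * k2 s).
Proof.
move=> [m1 b1] [m2 b2]; split; first exact: measurable_funM.
move=> t; have [C1 H1] := b1 t; have [C2 H2] := b2 t; exists (C1 * C2) => s st.
by rewrite normrM ler_pM ?H1 ?H2.
Qed.

Lemma lbmZ c k : locally_bounded_measurable k ->
  locally_bounded_measurable (fun s => c * k s).
Proof. by move=> ?; apply: lbmM => //; exact: lbm_cst. Qed.

Lemma lbm_norm k : locally_bounded_measurable k ->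
  locally_bounded_measurable (fun s => `|k s|).
Proof.
move=> [mk bk]; split; first exact: measurableT_comp.
by move=> t; have [C HC] := bk t; exists C => s st; rewrite normr_id HC.
Qed.

Lemma lbm_sum (I : finType) (k : I -> R -> R) :
  (forall i, locally_bounded_measurable (k i)) ->
  locally_bounded_measurable (fun s => \sum_i k i s).
Proof.
move=> H; split; first by apply: measurable_sum => i; have [] := H i.
move=> t; have /choice[C HC] : forall i, exists C : R, forall s, 0 <= s <= t -> `|k i s| <= C.
  by move=> i; have [_] := H i.
by exists (\sum_i C i) => s st; rewrite (le_trans (ler_norm_sum _ _ _))// ler_sum// => i _; exact: HC.
Qed.

Lemma lbm_continuous k : {within (`[0, +oo[ : set R), continuous k} ->
  locally_bounded_measurable k.
Proof.
move=> ck; split; first exact: subspace_continuous_measurable_fun.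
move=> t.
have ct : {within `[0, t], continuous k}.
  by apply: continuous_subspaceW ck; apply: subset_itv => //; rewrite bnd_simp.
have /compact_bounded[M [_ HM]] :=
  continuous_compact ct (@segment_compact _ 0 t).
exists (M + 1) => s st; apply: (HM (M + 1)); first by rewrite ltrDl.
by exists s => //=; rewrite in_itv.
Qed.

Lemma lbm_ext k1 k2 : (forall s, 0 <= s -> k1 s = k2 s) ->
  locally_bounded_measurable k1 -> locally_bounded_measurable k2.
Proof.
move=> e [m1 b1]; split.
  by apply: eq_measurable_fun m1 => s; rewrite inE/= in_itv/= andbT => /e.
move=> t; have [C HC] := b1 t; exists C => s st; rewrite -e ?HC//.
by case/andP: st.
Qed.

Lemma itg_same k a : itg k a a = 0.
Proof. by rewrite /itg set_itv1 Rintegral_set1. Qed.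

Lemma itg_cst c a b : a <= b -> itg (fun=> c) a b = c * (b - a).
Proof.
move=> ab; rewrite /itg Rintegral_cst//; have := lebesgue_measure_itv `[a, b].
by move=> /= ->; rewrite lte_fin; case: ltgtP ab => // ->; rewrite subrr.
Qed.

Lemma itgZ c k a b : locally_bounded_measurable k -> 0 <= a ->
  itg (fun s => c * k s) a b = c * itg k a b.
Proof. by move=> hk a0; rewrite /itg RintegralZl//; exact: lbm_integrable. Qed.

Lemma itgD k1 k2 a b : locally_bounded_measurable k1 ->
  locally_bounded_measurable k2 -> 0 <= a ->
  itg (fun s => k1 s + k2 s) a b = itg k1 a b + itg k2 a b.
Proof. by move=> h1 h2 a0; rewrite /itg RintegralD//; exact: lbm_integrable. Qed.

Lemma itg_sum (I : finType) (k : I -> R -> R) a b :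
  (forall i, locally_bounded_measurable (k i)) -> 0 <= a ->
  itg (fun s => \sum_i k i s) a b = \sum_i itg (k i) a b.
Proof.
move=> hk a0.
have H (r : seq I) : locally_bounded_measurable (fun s => \sum_(i <- r) k i s) /\
    itg (fun s => \sum_(i <- r) k i s) a b = \sum_(i <- r) itg (k i) a b.
  elim: r => [|i r [IH1 IH2]].
    rewrite big_nil; under eq_fun do rewrite big_nil.
    split; first exact: lbm_cst.
    by rewrite /itg Rintegral_cst// mul0r.
  rewrite big_cons -IH2; under eq_fun do rewrite big_cons.
  by split; [exact: lbmD | rewrite itgD].
by have [] := H (index_enum I).
Qed.

Lemma itg_cat k a b c : locally_bounded_measurable k -> 0 <= a -> a <= b -> b <= c ->
  itg k a c = itg k a b + itg k b c.
Proof.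
move=> hk a0 ab bc; have b0 := le_trans a0 ab.
have := @Rintegral_itvB R k (BLeft a) (BRight c) b.
rewrite !bnd_simp => /(_ (lbm_integrable _ hk a0) ab bc)/eqP.
rewrite subr_eq => /eqP; rewrite /itg => ->; rewrite addrC; congr (_ + _).
rewrite Rintegral_itv_obnd_cbnd//; apply: integrableS (lbm_integrable c hk b0) => //.
by apply: subset_itv => //; rewrite bnd_simp.
Qed.

Lemma itg_oo k a b : locally_bounded_measurable k -> 0 <= a ->
  itg k a b = Rintegral mu `]a, b[ k.
Proof.
move=> hk a0; rewrite /itg.
have i1 := lbm_integrable b hk a0.
have i2 : mu.-integrable `[a, b[ (EFin \o k).
  by apply: integrableS i1 => //; apply: subset_itv => //; rewrite bnd_simp.
have i3 : mu.-integrable `]a, b[ (EFin \o k).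
  by apply: integrableS i1 => //; apply: subset_itv => //; rewrite bnd_simp.
by rewrite Rintegral_itv_obnd_cbnd// Rintegral_itv_bndo_bndc.
Qed.

(** Passing to the open interval frees the hypothesis from the end points, where concatenated
    controls may take another value. *)
Lemma itg_le k1 k2 a b : locally_bounded_measurable k1 ->
  locally_bounded_measurable k2 -> 0 <= a ->
  (forall s, a < s < b -> k1 s <= k2 s) -> itg k1 a b <= itg k2 a b.
Proof.
move=> h1 h2 a0 H; rewrite !itg_oo//; apply: le_Rintegral => //.
- apply: integrableS (lbm_integrable b h1 a0) => //.
  by apply: subset_itv => //; rewrite bnd_simp.
- apply: integrableS (lbm_integrable b h2 a0) => //.
  by apply: subset_itv => //; rewrite bnd_simp.
Qed.

Lemma itg_ext k1 k2 a b : locally_bounded_measurable k1 ->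
  locally_bounded_measurable k2 -> 0 <= a ->
  (forall s, a < s < b -> k1 s = k2 s) -> itg k1 a b = itg k2 a b.
Proof.
move=> h1 h2 a0 H; apply/eqP; rewrite eq_le !itg_le//.
  by move=> s st; rewrite H.
by move=> s st; rewrite H.
Qed.

Lemma itg_ge0 k a b : (forall s, a <= s <= b -> 0 <= k s) -> 0 <= itg k a b.
Proof. by move=> H; apply: Rintegral_ge0 => s /=; rewrite in_itv; exact: H. Qed.

Lemma itg_norm k g a b : locally_bounded_measurable k ->
  locally_bounded_measurable g -> 0 <= a ->
  (forall s, a < s < b -> `|k s| <= g s) -> `|itg k a b| <= itg g a b.
Proof.
move=> hk hg a0 H.
apply: (@le_trans _ _ (itg (fun s => `|k s|) a b)).
  by apply: le_normr_Rintegral => //; exact: lbm_integrable.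
by apply: itg_le => //; exact: lbm_norm.
Qed.

Lemma itg_norm_cst k C a b : locally_bounded_measurable k -> 0 <= a -> a <= b ->
  (forall s, a < s < b -> `|k s| <= C) -> `|itg k a b| <= C * (b - a).
Proof.
by move=> hk a0 ab H; rewrite -itg_cst// itg_norm//; exact: lbm_cst.
Qed.

Lemma measurable_shift (h : R) :
  measurable_fun [set: measurableTypeR R]
    ((fun s => h + s) : measurableTypeR R -> measurableTypeR R).
Proof. exact: measurable_funD. Qed.

(** Lebesgue measure is determined by its values on the intervals ]a, b], so the comparison reduces
    to them. *)
Lemma lebesgue_measure_shift (h : R) (A : set (measurableTypeR R)) : measurable A ->
  pushforward mu ((fun s => h + s) : _ -> measurableTypeR R) A = mu A.
Proof.
move=> mA; apply/esym.
apply: (@lebesgue_measure_unique _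
  (measure_function_pushforward__canonical__measure_function_Measure mu (@measurable_shift h))) => //= _ [[a b]] _ <-.
rewrite /pushforward [X in _ = mu X](_ : _ = `]a - h, b - h]%classic).
  rewrite !lebesgue_measure_itv/= !lte_fin ltrD2r opprB.
  by case: ifPn => // _; congr (_%:E); ring.
by apply/seteqP; split => s /=; rewrite !in_itv/= ltrBlDl lerBrDl.
Qed.

Lemma itg_shift k (h a b : R) : locally_bounded_measurable k -> 0 <= h -> 0 <= a ->
  itg (fun s => k (h + s)) a b = itg k (h + a) (h + b).
Proof.
move=> hk h0 a0; rewrite /itg /Rintegral; congr fine.
set D : set (measurableTypeR R) := `[h + a, h + b]%classic.
have preD : (fun s : measurableTypeR R => h + s : measurableTypeR R) @^-1` D = `[a, b]%classic.
  by apply/seteqP; split => s; rewrite /D/= !in_itv/= !(lerD2l h).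
(* The integrand is measurable on the half-line only; its extension by 0 is measurable on R and can
   be composed with the translation. *)
pose k' : R -> R := k \_ `[0, +oo[.
have mk' : measurable_fun [set: R] k'.
  by apply/(measurable_restrictT _ _).1 => //; case: hk.
have e1 : forall s, 0 <= s -> k' s = k s.
  by move=> s s0; rewrite /k' patchE mem_set//= in_itv/= s0.
transitivity (\int[mu]_(s in `[a, b]) (k' (h + s))%:E)%E.
  apply: eq_integral => s; rewrite inE/= in_itv/= => /andP[as_ _].
  by rewrite e1// addr_ge0// (le_trans a0).
transitivity (\int[mu]_(s in D) (k' s)%:E)%E; last first.
  apply: eq_integral => s; rewrite inE /D/= in_itv/= => /andP[as_ _].
  by rewrite e1// (le_trans _ as_)// addr_ge0.
have hk' : locally_bounded_measurable k'.
  by apply: lbm_ext hk => s s0; rewrite e1.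
have hks : mu.-integrable `[a, b] (fun s => (k' (h + s))%:E).
  apply: measurable_bounded_integrable => //.
  - by apply: compact_finite_measure; exact: segment_compact.
  - apply: measurable_funTS; apply: (measurableT_comp mk').
    exact: measurable_shift.
  - have [C HC] := hk'.2 (h + b); exists C; split; first exact: num_real.
    move=> M CM s; rewrite /= in_itv/= => /andP[as_ sb].
    by rewrite (le_trans _ (ltW CM))// HC// lerD2l sb addr_ge0// (le_trans a0).
have := @integral_pushforward _ _ _ _ _ _ (@measurable_shift h) mu D (EFin \o k').
rewrite preD => <- //.
- apply: eq_measure_integral => [|mh A mA _]; first exact: measurable_shift.
  exact: (lebesgue_measure_shift h mA).
- exact/measurable_EFinP.
- exact: measurable_itv.
Qed.

Lemma lbm_shift k h : locally_bounded_measurable k -> 0 <= h ->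
  locally_bounded_measurable (fun s => k (h + s)).
Proof.
move=> hk h0.
pose k' : R -> R := k \_ `[0, +oo[.
have mk' : measurable_fun [set: R] k'.
  by apply/(measurable_restrictT _ _).1 => //; case: hk.
have e1 : forall s, 0 <= s -> k' s = k s.
  by move=> s s0; rewrite /k' patchE mem_set//= in_itv/= s0.
apply: (@lbm_ext (fun s => k' (h + s))) => [s s0|]; first by rewrite e1// addr_ge0.
split.
  by apply: measurable_funTS; apply: (measurableT_comp mk'); exact: measurable_shift.
move=> t; have [C HC] := hk.2 (h + t); exists C => s /andP[s0 st].
by rewrite e1 ?HC ?addr_ge0// lerD2l.
Qed.

Lemma itg_expR (L t : R) : 0 <= t ->
  itg (fun s => L * expR (L * s)) 0 t = expR (L * t) - 1.
Proof.
rewrite le_eqVlt => /predU1P[<-|t0]; first by rewrite itg_same mulr0 expR0 subrr.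
have dF (s : R) : is_derive s 1 (fun s => expR (L * s)) (L * expR (L * s)).
  by apply: is_derive_eq; rewrite /GRing.scale/= mulr1 mulrC.
have cF : continuous (fun s : R => expR (L * s)).
  by move=> s; apply: differentiable_continuous; apply/derivable1_diffP; have [] := dF s.
rewrite /itg /Rintegral (@continuous_FTC2 _ _ (fun s => expR (L * s)))//=.
- by rewrite mulr0 expR0.
- by apply: continuous_subspaceT => s; apply: cvgM; [exact: cvg_cst | exact: cF].
- split; first by move=> s _; have [] := dF s.
    by apply: cvg_at_right_filter; exact: cF.
  by apply: cvg_at_left_filter; exact: cF.
- by move=> s _; rewrite derive1E; have [] := dF s.
Qed.

Lemma lbm_expR (L : R) : locally_bounded_measurable (fun s => expR (L * s)).
Proof.
apply: lbm_continuous; apply: continuous_subspaceT => s.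
apply: continuous_comp; last exact: continuous_expR.
by apply: cvgM; [exact: cvg_cst | exact: cvg_id].
Qed.

(** The exponent 2 L against the factor L gains the 1 / 2 that makes [gronwall] and the Picard
    iteration contract. *)
Lemma itg_expR_le (L B t : R) : 0 <= t -> 0 <= B ->
  itg (fun s => L * (B * expR (2 * L * s))) 0 t <= B / 2 * expR (2 * L * t).
Proof.
move=> t0 B0.
have -> : (fun s => L * (B * expR (2 * L * s))) =
    (fun s => B / 2 * (2 * L * expR (2 * L * s))).
  by apply/funext => s; field.
rewrite itgZ//; last by apply: lbmZ; exact: lbm_expR.
rewrite itg_expR// ler_wpM2l ?divr_ge0//.
by rewrite lerBlDr lerDl.
Qed.

(* The set of admissible B is stable under B |-> a + B / 2, so its infimum is at most 2 a. *)
Lemma gronwall (L a t : R) (D : R -> R) : 0 <= a ->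
  (exists B, forall s, 0 <= s <= t -> D s <= B) -> 0 < L ->
  (forall B, 0 <= B -> (forall s, 0 <= s <= t -> D s <= B * expR (2 * L * s)) ->
     forall s, 0 <= s <= t -> D s <= a + B / 2 * expR (2 * L * s)) ->
  forall s, 0 <= s <= t -> D s <= 2 * a * expR (2 * L * s).
Proof.
move=> a0 [B0 HB0] L0 H s st.
have e1 u : 0 <= u -> 1 <= expR (2 * L * u).
  by move=> u0; rewrite -expR0 ler_expR mulr_ge0// mulr_ge0// ltW.
have K n : forall u, 0 <= u <= t ->
    D u <= (2 * a + `|B0| / 2 ^+ n) * expR (2 * L * u).
  elim: n => [|n IH] u ut; have /andP[u0 _] := ut.
    have := HB0 _ ut; have := ler_norm B0; have := e1 _ u0; have := normr_ge0 B0.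
    rewrite expr0 divr1; nra.
  have hB : 0 <= 2 * a + `|B0| / 2 ^+ n.
    by rewrite addr_ge0// ?mulr_ge0// divr_ge0// exprn_ge0.
  have := H _ hB IH _ ut; have := e1 _ u0.
  have -> : `|B0| / 2 ^+ n.+1 = `|B0| / 2 ^+ n / 2.
    by rewrite exprS invfM; ring.
  nra.
apply/ler_addgt0Pr => e e0.
have /andP[s0 _] := st.
have [n Hn] : exists n : nat, `|B0| * expR (2 * L * s) / e < 2 ^+ n.
  have [n hn] : exists n : nat, `|B0| * expR (2 * L * s) / e < n%:R.
    exists (Num.bound (`|B0| * expR (2 * L * s) / e)); apply: archi_boundP.
    by rewrite divr_ge0 ?(ltW e0)// mulr_ge0// expR_ge0.
  exists n; rewrite (lt_le_trans hn)// -natrX ler_nat ltnW//; exact: ltn_expl.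
apply: (le_trans (K n _ st)); rewrite mulrDl lerD2l.
rewrite ltr_pdivrMr// in Hn; rewrite mulrAC ler_pdivrMr ?exprn_gt0// ltW//.
by rewrite (mulrC e).
Qed.

(* With N equal steps the total defect is C (b - a)^2 / N. *)
Lemma time_stepping (P : R -> R -> Prop) (C a b g d : R) : 0 <= C -> a <= b ->
  (forall s x y, y <= x -> P s x -> P s y) ->
  (forall s s' x, a <= s -> s <= s' -> s' <= b -> P s x ->
     P s' (x - C * (s' - s) ^+ 2)) ->
  0 < d -> P a g -> P b (g - d).
Proof.
move=> C0 ab mono step d0 Pa.
pose q := C * (b - a) ^+ 2 / d.
have q0 : 0 <= q by rewrite divr_ge0 ?(ltW d0)// mulr_ge0// sqr_ge0.
have [N [N0 hN]] : exists N : nat, (0 < N)%N /\ q <= N%:R.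
  exists (Num.bound q).+1; split=> //; rewrite (le_trans (ltW (archi_boundP q0)))//.
  by rewrite ler_nat.
have N0' : 0 < N%:R :> R by rewrite ltr0n.
pose h := (b - a) / N%:R.
have h0 : 0 <= h by rewrite divr_ge0 ?subr_ge0.
have hb : a + N%:R * h = b by rewrite /h mulrCA divff ?mulr1 ?gt_eqF// addrC subrK.
have K (j : nat) : (j <= N)%N -> P (a + j%:R * h) (g - j%:R * (C * h ^+ 2)).
  elim: j => [_|j IH jN]; first by rewrite !mul0r addr0 subr0.
  have le1 : a + j%:R * h <= a + j.+1%:R * h by rewrite lerD2l ler_wpM2r// ler_nat.
  have := step (a + j%:R * h) (a + j.+1%:R * h) _ _ le1 _ (IH (ltnW jN)).
  rewrite lerDl mulr_ge0// => /(_ isT).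
  rewrite -{1}hb lerD2l ler_wpM2r// ?ler_nat// => /(_ isT).
  by congr P; rewrite -natr1; ring.
have := K N (leqnn _); rewrite hb; apply: mono.
rewrite lerD2l lerN2 /h.
have -> : N%:R * (C * ((b - a) / N%:R) ^+ 2) = q * d / N%:R.
  by rewrite /q; field; rewrite !gt_eqF.
by rewrite ler_pdivrMr// mulrC ler_wpM2l// ltW.
Qed.

End IntervalIntegral.

(** * Sup norm, Euclidean norm and scalar product *)

Section SupNorm.
Context {R : realType} {n : nat}.
Implicit Types x y p : 'rV[R]_n.

Lemma ler_coord x (i : 'I_n) : `|x 0 i| <= `|x|.
Proof.
rewrite /Num.norm/= mx_normrE.
exact: (le_bigmax _ (fun ij : 'I_1 * 'I_n => `|x ij.1 ij.2|) (0, i)).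
Qed.

Lemma rV_norm_le x (c : R) : 0 <= c -> (forall i, `|x 0 i| <= c) -> `|x| <= c.
Proof.
move=> c0 H; rewrite /Num.norm/= mx_normrE; apply/bigmax_leP; split => // -[i j] _ /=.
by rewrite ord1.
Qed.

Lemma coordB x y (i : 'I_n) : (x - y) 0 i = x 0 i - y 0 i.
Proof. by rewrite !mxE. Qed.

Lemma dotpC x y : dotp x y = dotp y x.
Proof. by apply: eq_bigr => i _; rewrite mulrC. Qed.

Lemma dotpDl x y p : dotp (x + y) p = dotp x p + dotp y p.
Proof. by rewrite /dotp -big_split/=; apply: eq_bigr => i _; rewrite mxE mulrDl. Qed.

Lemma dotpDr x y p : dotp p (x + y) = dotp p x + dotp p y.
Proof. by rewrite dotpC dotpDl !(dotpC p). Qed.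

Lemma dotpZl (c : R) x p : dotp (c *: x) p = c * dotp x p.
Proof. by rewrite /dotp mulr_sumr; apply: eq_bigr => i _; rewrite mxE mulrA. Qed.

Lemma dotpZr (c : R) x p : dotp p (c *: x) = c * dotp p x.
Proof. by rewrite dotpC dotpZl dotpC. Qed.

Lemma dotpNl x p : dotp (- x) p = - dotp x p.
Proof. by rewrite -scaleN1r dotpZl mulN1r. Qed.

Lemma dotpNr x p : dotp p (- x) = - dotp p x.
Proof. by rewrite dotpC dotpNl dotpC. Qed.

Lemma dotp0l p : dotp 0 p = 0.
Proof. by rewrite -[0 in LHS](scale0r 0) dotpZl mul0r. Qed.

Lemma dotp_sqrD x y : dotp (x + y) (x + y) = dotp x x + 2 * dotp x y + dotp y y.
Proof. by rewrite dotpDl !dotpDr (dotpC y x); ring. Qed.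

Lemma dotp_ge0 x : 0 <= dotp x x.
Proof. by apply: sumr_ge0 => i _; rewrite -expr2 sqr_ge0. Qed.

Lemma dotp_norm x y : `|dotp x y| <= n%:R * `|x| * `|y|.
Proof.
rewrite (le_trans (ler_norm_sum _ _ _))//.
rewrite (le_trans (y := \sum_(i < n) `|x| * `|y|))//.
  by apply: ler_sum => i _; rewrite normrM ler_pM ?ler_coord.
by rewrite sumr_const card_ord -[leLHS]mulr_natl mulrA.
Qed.

Lemma sqr_norm_le_dotp x : `|x| ^+ 2 <= dotp x x.
Proof.
have H i : `|x 0 i| ^+ 2 <= dotp x x.
  rewrite /dotp (bigD1 i)//= real_normK ?num_real// -expr2 lerDl.
  by apply: sumr_ge0 => j _; rewrite -expr2 sqr_ge0.
have : `|x| <= Num.sqrt (dotp x x).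
  apply: rV_norm_le; first exact: sqrtr_ge0.
  move=> i; rewrite -(@ler_pXn2r _ 2) ?nnegrE ?sqrtr_ge0//.
  by rewrite sqr_sqrtr ?dotp_ge0.
by rewrite -(@ler_pXn2r _ 2) ?nnegrE ?sqrtr_ge0// sqr_sqrtr ?dotp_ge0.
Qed.

Lemma norm_le_enorm x : `|x| <= enorm x.
Proof.
by rewrite -(@ler_pXn2r _ 2) ?nnegrE ?sqrtr_ge0// sqr_sqrtr ?dotp_ge0 ?sqr_norm_le_dotp.
Qed.

(** The constant n + 1, cruder than the square root of n, stays positive for n = 0 and can thus be
    multiplied into positive constants. *)
Lemma enorm_le_norm x : enorm x <= n.+1%:R * `|x|.
Proof.
rewrite -(@ler_pXn2r _ 2) ?nnegrE ?sqrtr_ge0 ?mulr_ge0// sqr_sqrtr ?dotp_ge0//.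
apply: (le_trans (ler_norm _)); apply: (le_trans (dotp_norm _ _)).
rewrite exprMn expr2 -mulrA -(expr2 `|x|) ler_wpM2r ?sqr_ge0//.
by rewrite -natrM ler_nat mulnS addSn ltnW// ltnS -[X in (X <= _)%N]addn0 leq_add// leq_addr.
Qed.

Lemma continuous_coord (D : set R) (g : R -> 'rV[R]_n) i :
  {within D, continuous g} -> {within D, continuous (fun t => g t 0 i)}.
Proof.
move=> cg t; apply: (@continuous_comp (subspace D) _ _ g (fun v : 'rV[R]_n => v 0 i) t (cg t)).
exact: coord_continuous.
Qed.

Lemma closed_ball_compact (r : R) : compact [set x : 'rV[R]_n | `|x| <= r].
Proof.
apply: bounded_closed_compact.
  by exists r; split; [exact: num_real | move=> M rM x /= /le_trans; apply; exact: ltW].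
have -> : [set x : 'rV[R]_n | `|x| <= r] = (fun x => `|x|) @^-1` [set c : R | c <= r] by [].
by apply: closed_comp => [x _|]; [exact: norm_continuous | exact: closed_le].
Qed.

End SupNorm.

(** * Measurability of continuous functions of arc and control *)

Section Composition.
Context {R : realType}.

Lemma rV_rat_approx {k : nat} (x : 'rV[R]_k) (e : R) : 0 < e ->
  exists q : 'rV[rat]_k, forall i, `|x 0 i - ratr (q 0 i)| < e.
Proof.
move=> e0; have /choice[q Hq] : forall i, exists q : rat, `|x 0 i - ratr q| < e.
  move=> i; have [q] := @rat_in_itvoo R (x 0 i - e) (x 0 i + e) ltac:(by lra).
  by rewrite in_itv/= => /andP[? ?]; exists q; rewrite ltr_norml; apply/andP; split; lra.
by exists (\row_i q i) => i; rewrite mxE.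
Qed.

Lemma measurable_box {k : nat} (D : set R) (y : R -> 'rV[R]_k) (q : 'rV[rat]_k) (e : R) :
  measurable D -> (forall i, measurable_fun D (fun t => y t 0 i)) ->
  measurable (D `&` [set t | forall i, `|y t 0 i - ratr (q 0 i)| < e]).
Proof.
move=> mD my.
(* For k = 0 the intersection over coordinates below would be the whole line instead of D. *)
have [k0|k0] := eqVneq k 0%N.
  rewrite (_ : [set t | _] = setT) ?setIT//.
  by apply/seteqP; split => // t _ /= i; have := ltn_ord i; rewrite {2}k0.
have -> : D `&` [set t | forall i, `|y t 0 i - ratr (q 0 i)| < e] =
    \bigcap_(i in [set: 'I_k]) (D `&` (fun t => `|y t 0 i - ratr (q 0 i)|) @^-1` `]-oo, e[).
  apply/seteqP; split => t /=.
    by move=> [Dt H] i _; split => //=; rewrite in_itv/=.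
  move=> H; have i0 : 'I_k by apply: Ordinal (_ : (0 < k)%N); rewrite lt0n.
  split; first by have [] := H i0 I.
  by move=> i; have [_] := H i I; rewrite /= in_itv.
apply: fin_bigcap_measurable; first exact: finite_finset.
move=> i _; have : measurable_fun D (fun t => `|y t 0 i - ratr (q 0 i)|).
  by apply: measurableT_comp => //; apply: measurable_funB.
by move=> /(_ mD); apply; exact: measurable_itv.
Qed.

(** An open W is a countable union of boxes with rational centres and radii 1 / (k + 1), and the
    preimage of a box is measurable coordinate by coordinate. *)
Lemma measurable_preimage_open {n m : nat} (D : set R) (y : R -> 'rV[R]_n)
    (al : R -> 'rV[R]_m) (W : set ('rV[R]_n * 'rV[R]_m)) :
  measurable D -> open W ->
  (forall i, measurable_fun D (fun t => y t 0 i)) ->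
  (forall i, measurable_fun D (fun t => al t 0 i)) ->
  measurable (D `&` [set t | W (y t, al t)]).
Proof.
move=> mD oW my ma.
pose box (c : 'rV[rat]_n * 'rV[rat]_m * nat) (z : 'rV[R]_n * 'rV[R]_m) :=
  (forall i, `|z.1 0 i - ratr (c.1.1 0 i)| < c.2.+1%:R^-1) /\
  (forall i, `|z.2 0 i - ratr (c.1.2 0 i)| < c.2.+1%:R^-1).
pose F c := [set t | (box c `<=` W) /\ D t /\ box c (y t, al t)].
have -> : D `&` [set t | W (y t, al t)] = \bigcup_c F c.
  apply/seteqP; split => t /=; last first.
    by move=> [c _ [sub [Dt bt]]]; split=> //; exact: sub.
  move=> [Dt Wt].
  have /nbhs_ballP[e /= e0 He] : nbhs (y t, al t) W by exact: open_nbhs_nbhs.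
  (* The factor 2 is there because both (y t, al t) and the other points of the box are within 1 /
     (k + 1) of the centre. *)
  have [k hk] : exists k : nat, 2 * k.+1%:R^-1 < e.
    exists (Num.bound (2 / e)); rewrite ltr_pdivrMr ?ltr0n// -ltr_pdivrMl// mulrC.
    rewrite (lt_le_trans (archi_boundP _)) ?ler_nat//.
    by rewrite divr_ge0// ltW.
  have k0 : 0 < k.+1%:R^-1 :> R by rewrite invr_gt0.
  have [q Hq] := rV_rat_approx (y t) k0.
  have [p Hp] := rV_rat_approx (al t) k0.
  exists (q, p, k) => //; split; last by [].
  move=> [u v] [/= Hu Hv]; apply: He; split => /=; rewrite mx_norm_ball /ball_/=.
    apply: le_lt_trans hk; apply: rV_norm_le => [|i]; first by rewrite mulr_ge0// ltW.
    rewrite !mxE; have := Hq i; have := Hu i.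
    move: (k.+1%:R^-1) (ratr _) => d r; rewrite !ltr_norml ler_norml => /andP[? ?] /andP[? ?]; apply/andP; split; lra.
  apply: le_lt_trans hk; apply: rV_norm_le => [|i]; first by rewrite mulr_ge0// ltW.
  rewrite !mxE; have := Hp i; have := Hv i.
  move: (k.+1%:R^-1) (ratr _) => d r; rewrite !ltr_norml ler_norml => /andP[? ?] /andP[? ?]; apply/andP; split; lra.
apply: countable_bigcupT_measurable => [|c]; first exact: countableP.
have [sub|nsub] := pselect (box c `<=` W); last first.
  rewrite (_ : F c = set0)//.
  by apply/seteqP; split => // t [].
have -> : F c = (D `&` [set t | forall i, `|y t 0 i - ratr (c.1.1 0 i)| < c.2.+1%:R^-1]) `&`
     (D `&` [set t | forall i, `|al t 0 i - ratr (c.1.2 0 i)| < c.2.+1%:R^-1]).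
  apply/seteqP; split => t; first by move=> [_ [Dt [b1 b2]]].
  by move=> [[Dt b1] [_ b2]].
by apply: measurableI; exact: measurable_box.
Qed.

(** Continuity on the product with A makes the preimage of an open ray the trace of an open set W;
    as al stays in A, the trace may be replaced by W. *)
Lemma measurable_comp_within {n m : nat} (D : set R) (A : set 'rV[R]_m)
    (g : 'rV[R]_n -> 'rV[R]_m -> R) (y : R -> 'rV[R]_n) (al : R -> 'rV[R]_m) :
  measurable D -> {within setT `*` A, continuous (fun z => g z.1 z.2)} ->
  (forall i, measurable_fun D (fun t => y t 0 i)) ->
  (forall i, measurable_fun D (fun t => al t 0 i)) ->
  (forall t, D t -> A (al t)) ->
  measurable_fun D (fun t => g (y t) (al t)).
Proof.
move=> mD cg my ma aA.
apply: (measurability _ (RGenOInfty.measurableE R)) => // _ [_ [c ->] <-].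
have /open_subspaceP[W oW WE] : open ((fun z : subspace (setT `*` A) =>
    g z.1 z.2) @^-1` `]c, +oo[).
  by move/continuousP : cg; apply; exact: interval_open.
rewrite (_ : D `&` _ = D `&` [set t | W (y t, al t)]).
  exact: measurable_preimage_open.
apply/seteqP; split => t [Dt].
  move=> H; split => //=; have [] : (W `&` (setT `*` A)) (y t, al t) => //.
  by rewrite WE; split => //; split => //=; exact: aA.
move=> H; split => //=.
have [] : ([set z | g z.1 z.2 \in `]c, +oo[] `&` (setT `*` A)) (y t, al t) => //.
by rewrite -[X in X `&` _]/((fun z : subspace (setT `*` A) => g z.1 z.2) @^-1` `]c, +oo[) -WE; split => //; split => //=; exact: aA.
Qed.

End Composition.

(** * Geometrically convergent sequences *)

Section Geometric.
Context {R : realType}.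
Implicit Types (a b c : R).

Lemma le_of_geometric a b c : (forall j : nat, a <= b + c / 2 ^+ j) -> a <= b.
Proof.
move=> H; apply/ler_addgt0Pr => e e0.
have [j Hj] : exists j : nat, `|c| / e < 2 ^+ j.
  exists (Num.bound (`|c| / e)); rewrite (lt_le_trans (archi_boundP _))//.
    by rewrite divr_ge0// ltW.
  by rewrite -natrX ler_nat ltnW//; exact: ltn_expl.
apply: (le_trans (H j)); rewrite lerD2l ler_pdivrMr ?exprn_gt0//.
rewrite ltr_pdivrMr// in Hj; apply: (le_trans (ler_norm _)).
by rewrite mulrC ltW.
Qed.

(** The intervals of centre u j and radius 2 c / 2^j are nested; the supremum of their left ends
    lies in all of them. *)
Lemma geometric_limit (u : nat -> R) c :
  (forall j : nat, `|u j.+1 - u j| <= c / 2 ^+ j) ->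
  exists v, forall j : nat, `|v - u j| <= 2 * c / 2 ^+ j.
Proof.
move=> H.
have c0 : 0 <= c by have := H 0%N; rewrite expr0 divr1; apply: le_trans.
pose lo j := u j - 2 * c / 2 ^+ j; pose hi j := u j + 2 * c / 2 ^+ j.
have e2 j : 2 * c / 2 ^+ j.+1 = c / 2 ^+ j by rewrite exprS invfM; field; rewrite expf_neq0.
have lo1 j : lo j <= lo j.+1.
  rewrite /lo e2; have := H j; rewrite ler_norml => /andP[+ _].
  rewrite -(mulrA 2); lra.
have hi1 j : hi j.+1 <= hi j.
  rewrite /hi e2; have := H j; rewrite ler_norml => /andP[_].
  rewrite -(mulrA 2); lra.
have lohi j k : lo j <= hi k.
  apply: (@le_trans _ _ (lo (maxn j k))).
    by apply: (homo_leq (@lexx _ R) (@le_trans _ R) lo1); exact: leq_maxl.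
  apply: (@le_trans _ _ (hi (maxn j k))).
    have : 0 <= 2 * c / 2 ^+ maxn j k by rewrite divr_ge0 ?mulr_ge0// exprn_ge0.
    rewrite /lo /hi; lra.
  rewrite -lerN2.
  have hi2 i : - hi i <= - hi i.+1 by rewrite lerN2.
  by apply: (homo_leq (@lexx _ R) (@le_trans _ R) hi2); exact: leq_maxr.
exists (sup (range lo)) => j.
have ub : ubound (range lo) (hi j) by move=> _ [k _ <-].
have h1 : lo j <= sup (range lo).
  by apply: ub_le_sup; [exists (hi j) | exists j].
have h2 : sup (range lo) <= hi j.
  by apply: ge_sup => //; exists (lo 0%N); exists 0%N.
move: h1 h2; rewrite /lo /hi ler_norml => ? ?; apply/andP; split; lra.
Qed.

(** The limit does not depend on the constant of the rate. The Picard limit at time t is chosen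
    once, whereas the constants of the rate depend on the time horizon. *)
Lemma geometric_limit_bound (u : nat -> R) (v c0 c : R) :
  (forall j : nat, `|v - u j| <= c0 / 2 ^+ j) ->
  (forall j : nat, `|u j.+1 - u j| <= c / 2 ^+ j) ->
  forall j : nat, `|v - u j| <= 2 * c / 2 ^+ j.
Proof.
move=> Hv /geometric_limit[w Hw] j.
suff -> : v = w by [].
apply/eqP; rewrite -subr_eq0 -normr_le0; apply: (@le_of_geometric _ _ (c0 + 2 * c)) => k.
rewrite add0r mulrDl (_ : v - w = (v - u k) - (w - u k)); last by ring.
by rewrite (le_trans (ler_normB _ _))// lerD.
Qed.

End Geometric.

Lemma continuous_norm_within {R : realType} {k : nat} (D : set R) (y : R -> 'rV[R]_k) :
  {within D, continuous y} -> {within D, continuous (fun s => `|y s|)}.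
Proof. by move=> cy s; exact: (cvg_norm (cy s)). Qed.

(** * Trajectories and their costs *)

Section Dynamics.
Context {R : realType} {n m : nat}.
Variables (A : set 'rV[R]_m) (f : 'rV[R]_n -> 'rV[R]_m -> 'rV[R]_n)
  (l : 'rV[R]_n -> 'rV[R]_m -> R).
Definition standing_dynamics : Prop :=
  [/\ compact A,
      {within [set: 'rV[R]_n] `*` A, continuous (fun z => f z.1 z.2)},
      {within [set: 'rV[R]_n] `*` A, continuous (fun z => l z.1 z.2)},
      exists2 M : R, 0 < M &
        forall x a, A a -> enorm (f x a) <= M * (1 + enorm x)
    & forall r : R, 0 < r -> exists2 L : R, 0 < L &
        forall x1 x2 a, enorm x1 <= r -> enorm x2 <= r -> A a ->
          enorm (f x1 a - f x2 a) <= L * enorm (x1 - x2) /\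
          `|l x1 a - l x2 a| <= L * enorm (x1 - x2)].

Hypothesis dyn : standing_dynamics.

Let A_compact : compact A. Proof. by case: dyn. Qed.

Let f_cont : {within [set: 'rV[R]_n] `*` A, continuous (fun z => f z.1 z.2)}.
Proof. by case: dyn. Qed.

Let l_cont : {within [set: 'rV[R]_n] `*` A, continuous (fun z => l z.1 z.2)}.
Proof. by case: dyn. Qed.

Let f_growth : exists2 M : R, 0 < M &
  forall x a, A a -> enorm (f x a) <= M * (1 + enorm x).
Proof. by case: dyn. Qed.

(** The assumptions use the Euclidean norm; from here on they are used in the sup norm, with worse
    constants. *)
Lemma norm_growth : exists2 M : R, 0 < M &
  forall x a, A a -> `|f x a| <= M * (1 + `|x|).
Proof.
have [M M0 H] := f_growth; exists (M * n.+1%:R); first by rewrite mulr_gt0.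
move=> x a Aa; apply: (le_trans (norm_le_enorm _)); apply: (le_trans (H _ _ Aa)).
rewrite -mulrA ler_pM2l// mulrDr mulr1 lerD ?enorm_le_norm//.
by rewrite ler1n.
Qed.

Lemma norm_lipschitz (r : R) : 0 < r -> exists2 L : R, 0 < L &
  forall x1 x2 a, `|x1| <= r -> `|x2| <= r -> A a ->
    `|f x1 a - f x2 a| <= L * `|x1 - x2| /\ `|l x1 a - l x2 a| <= L * `|x1 - x2|.
Proof.
move=> r0; have [_ _ _ _ fl_lipschitz] := dyn.
have [|L L0 H] := fl_lipschitz (n.+1%:R * r); first by rewrite mulr_gt0.
exists (L * n.+1%:R); first by rewrite mulr_gt0.
move=> x1 x2 a h1 h2 Aa.
have K (x : 'rV[R]_n) : `|x| <= r -> enorm x <= n.+1%:R * r.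
  by move=> hx; rewrite (le_trans (enorm_le_norm x))// ler_pM2l.
have [H1 H2] := H x1 x2 a (K _ h1) (K _ h2) Aa.
split.
  rewrite (le_trans (norm_le_enorm _))// (le_trans H1)// -mulrA ler_pM2l//.
  exact: enorm_le_norm.
by rewrite (le_trans H2)// -mulrA ler_pM2l// enorm_le_norm.
Qed.

Lemma f_bounded (r : R) : exists2 C, 0 < C & forall x a, `|x| <= r -> A a -> `|f x a| <= C.
Proof.
have [M M0 H] := norm_growth.
exists (M * (1 + `|r|)); first by rewrite mulr_gt0// ltr_pwDl.
move=> x a xr Aa; rewrite (le_trans (H _ _ Aa))// ler_pM2l// lerD2l.
by rewrite (le_trans xr)// ler_norm.
Qed.

(** No growth bound is assumed on l: compactness of A bounds it at x = 0, and the Lipschitz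
    condition carries the bound to the ball. *)
Lemma l_bounded (r : R) : exists2 C, 0 < C & forall x a, `|x| <= r -> A a -> `|l x a| <= C.
Proof.
pose K : set ('rV[R]_n * 'rV[R]_m) := [set 0] `*` A.
have cK : compact K by apply: compact_setX => //; exact: compact_set1.
have cl : {within K, continuous (fun z => l z.1 z.2)}.
  by apply: continuous_subspaceW l_cont => -[x a] [].
have /compact_bounded[C [_ HC]] := continuous_compact cl cK.
have r0 : 0 < `|r| + 1 by rewrite ltr_wpDl.
have [L L0 HL] := norm_lipschitz r0.
exists (`|C| + 1 + L * (`|r| + 1)); first by rewrite addr_gt0 ?mulr_gt0// ltr_wpDl.
move=> x a xr Aa.
have h0 : `|l 0 a| <= `|C| + 1.
  apply: (HC (`|C| + 1)); first by rewrite ltr_pwDr// ler_norm.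
  by exists (0, a).
have hx : `|x| <= `|r| + 1 by rewrite (le_trans xr)// (le_trans (ler_norm _))// lerDl.
have [|_] := HL x 0 a hx _ Aa; first by rewrite normr0 ltW.
rewrite subr0 => h1.
rewrite -(subrK (l 0 a) (l x a)) (le_trans (ler_normD _ _))// addrC lerD//.
by rewrite (le_trans h1)// ler_pM2l.
Qed.

Lemma lbm_f (y : R -> 'rV[R]_n) (al : R -> 'rV[R]_m) i :
  {within (`[0, +oo[ : set R), continuous y} -> controls A al ->
  locally_bounded_measurable (fun s => f (y s) (al s) 0 i).
Proof.
move=> cy [aA ma]; split.
  apply: (@measurable_comp_within _ _ _ _ A (fun x a => f x a 0 i)) => //.
  - move=> z; apply: (@continuous_comp (subspace ([set: 'rV[R]_n] `*` A)) _ _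
      (fun z => f z.1 z.2) (fun v : 'rV[R]_n => v 0 i) z (f_cont (x:=z))).
    exact: coord_continuous.
  - move=> j; apply: subspace_continuous_measurable_fun => //.
    exact: continuous_coord.
  - by move=> t /=; rewrite in_itv/= andbT; exact: aA.
move=> t; have [_ bn] : locally_bounded_measurable (fun s => `|y s|).
  by apply: lbm_continuous; exact: continuous_norm_within.
have [C HC] := bn t; have [C' C'0 HC'] := f_bounded C.
exists C' => s st; have /andP[s0 _] := st.
rewrite (le_trans (ler_coord _ _))// HC'//; last exact: aA.
by have := HC _ st; rewrite normr_id.
Qed.

Lemma lbm_l (y : R -> 'rV[R]_n) (al : R -> 'rV[R]_m) :
  {within (`[0, +oo[ : set R), continuous y} -> controls A al ->
  locally_bounded_measurable (fun s => l (y s) (al s)).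
Proof.
move=> cy [aA ma]; split.
  apply: (@measurable_comp_within _ _ _ _ A l) => //.
  - move=> j; apply: subspace_continuous_measurable_fun => //.
    exact: continuous_coord.
  - by move=> t /=; rewrite in_itv/= andbT; exact: aA.
move=> t; have [_ bn] : locally_bounded_measurable (fun s => `|y s|).
  by apply: lbm_continuous; exact: continuous_norm_within.
have [C HC] := bn t; have [C' C'0 HC'] := l_bounded C.
exists C' => s st; have /andP[s0 _] := st; rewrite HC'//; last exact: aA.
by have := HC _ st; rewrite normr_id.
Qed.

Lemma lipschitz_continuous (y : R -> 'rV[R]_n) :
  (forall T, 0 <= T -> exists C : R, forall s t, 0 <= s -> s <= t -> t <= T ->
     `|y t - y s| <= C * (t - s)) ->
  {within (`[0, +oo[ : set R), continuous y}.
Proof.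
move=> H; apply/subspace_continuousP => t; rewrite /= in_itv/= andbT => t0.
have [C HC] := H (t + 1) (addr_ge0 t0 ler01).
apply/cvgrPdist_le => e e0.
have C0 : 0 < `|C| + 1 by rewrite ltr_wpDl.
have d0 : 0 < Num.min 1 (e / (`|C| + 1)) by rewrite lt_min ltr01 divr_gt0.
rewrite /within/=; apply/nbhs_ballP; exists (Num.min 1 (e / (`|C| + 1))) => //= s.
rewrite /ball/= lt_min => /andP[s1 s2]; rewrite in_itv/= andbT => s0.
have K u v : 0 <= u -> u <= v -> v <= t + 1 -> `|u - v| <= e / (`|C| + 1) -> `|y v - y u| <= e.
  move=> u0 uv vt h; rewrite (le_trans (HC _ _ u0 uv vt))//.
  rewrite distrC ger0_norm ?subr_ge0// in h.
  rewrite (le_trans (y := (`|C| + 1) * (v - u)))//.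
    by rewrite ler_wpM2r ?subr_ge0// (le_trans (ler_norm _))// lerDl.
  by rewrite mulrC -ler_pdivlMr.
have [st|/ltW ts] := leP s t.
  by apply: K => //; rewrite ?lerDl// distrC ltW.
rewrite distrC; apply: K => //; last exact: ltW.
by move: s1; rewrite ltr_norml => /andP[? ?]; lra.
Qed.

Lemma continuous_lipschitz_bound (y : R -> 'rV[R]_n) (t : R) :
  {within (`[0, +oo[ : set R), continuous y} ->
  exists2 r, 0 < r & forall s, 0 <= s <= t -> `|y s| <= r.
Proof.
move=> cy; have [_ bn] : locally_bounded_measurable (fun s => `|y s|).
  by apply: lbm_continuous; exact: continuous_norm_within.
have [C HC] := bn t; exists (`|C| + 1) => [|s st]; first by rewrite ltr_wpDl.
by have := HC s st; rewrite normr_id => h; rewrite (le_trans h)// (le_trans (ler_norm _))// lerDl.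
Qed.

Lemma trajectory_coordE x al y : is_trajectory f x al y ->
  forall t i, 0 <= t -> y t 0 i = x 0 i + itg (fun s => f (y s) (al s) 0 i) 0 t.
Proof. by move=> [_]. Qed.

Lemma trajectory0 x al y : is_trajectory f x al y -> y 0 = x.
Proof.
by move=> H; apply/rowP => i; rewrite (trajectory_coordE H)// itg_same addr0.
Qed.

(** Gronwall's inequality is applied to 1 + |y|, which absorbs the constant term of the linear
    growth. *)
Lemma trajectory_growth (M : R) x al y : 0 < M ->
  (forall x a, A a -> `|f x a| <= M * (1 + `|x|)) ->
  controls A al -> is_trajectory f x al y ->
  forall t, 0 <= t -> 1 + `|y t| <= 2 * (1 + `|x|) * expR (2 * M * t).
Proof.
move=> M0 HM cal Hy t t0; have cy := Hy.1.
apply: (@gronwall _ M _ t (fun t => 1 + `|y t|)) => //; last by rewrite t0 lexx.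
- have [r _ Hr] := continuous_lipschitz_bound t cy.
  by exists (1 + r) => s st; rewrite lerD2l Hr.
move=> B B0 HB s st; have /andP[s0 s1] := st.
rewrite -addrA lerD2l.
have e0 : 0 <= B / 2 * expR (2 * M * s) by rewrite mulr_ge0 ?divr_ge0 ?expR_ge0.
apply: rV_norm_le => [|i]; first by rewrite addr_ge0.
rewrite (trajectory_coordE Hy)// (le_trans (ler_normD _ _))// lerD ?ler_coord//.
rewrite (le_trans _ (itg_expR_le M s0 B0))// itg_norm//.
- exact: lbm_f.
- by apply: lbmZ; apply: lbmZ; exact: lbm_expR.
move=> u /andP[u0 us]; rewrite (le_trans (ler_coord _ _))// (le_trans (HM _ _ _))//.
  by apply: cal.1; exact: ltW.
by rewrite ler_pM2l// HB// (ltW u0)/= (le_trans (ltW us)).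
Qed.

(** Limit arcs satisfy the equation up to time 1 only. Continuity is kept on the whole half-line so
    that the integrands remain [locally_bounded_measurable]. *)
Definition trajectory_until (tau : R) (x : 'rV[R]_n) (al : R -> 'rV[R]_m) (y : R -> 'rV[R]_n) : Prop :=
  {within (`[0, +oo[ : set R), continuous y} /\
  forall t i, 0 <= t <= tau -> y t 0 i = x 0 i + itg (fun s => f (y s) (al s) 0 i) 0 t.

(* Controls need only agree before tau: the trajectory up to tau is causal. *)
Lemma trajectory_stability (L r tau : R) x1 x2 al1 al2 y1 y2 : 0 < L ->
  (forall x1 x2 a, `|x1| <= r -> `|x2| <= r -> A a ->
    `|f x1 a - f x2 a| <= L * `|x1 - x2|) ->
  controls A al1 -> controls A al2 ->
  trajectory_until tau x1 al1 y1 -> trajectory_until tau x2 al2 y2 ->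
  (forall s, 0 <= s < tau -> al1 s = al2 s) ->
  (forall s, 0 <= s <= tau -> `|y1 s| <= r /\ `|y2 s| <= r) ->
  forall s, 0 <= s <= tau -> `|y1 s - y2 s| <= 2 * `|x1 - x2| * expR (2 * L * s).
Proof.
move=> L0 HL c1 c2 H1 H2 e12 Hr.
apply: (@gronwall _ L _ tau (fun s => `|y1 s - y2 s|)) => //.
  exists (r + r) => s st; have [h1 h2] := Hr s st.
  by rewrite (le_trans (ler_normB _ _))// lerD.
move=> B B0 HB s st; have /andP[s0 s1] := st.
have e0 : 0 <= B / 2 * expR (2 * L * s) by rewrite mulr_ge0 ?divr_ge0 ?expR_ge0.
apply: rV_norm_le => [|i]; first by rewrite addr_ge0.
rewrite !mxE H1.2// H2.2//.
rewrite (_ : _ - _ = (x1 - x2) 0 i +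
  itg (fun s => f (y1 s) (al1 s) 0 i + -1 * f (y2 s) (al2 s) 0 i) 0 s); last first.
  have f1 := lbm_f i H1.1 c1; have f2 := lbm_f i H2.1 c2.
  by rewrite !mxE itgD// ?itgZ//; [ring | exact: lbmZ].
rewrite (le_trans (ler_normD _ _))// lerD ?ler_coord//.
rewrite (le_trans _ (itg_expR_le L s0 B0))// itg_norm//.
- by apply: lbmD; [exact: lbm_f H1.1 c1 | apply: lbmZ; exact: lbm_f H2.1 c2].
- by apply: lbmZ; apply: lbmZ; exact: lbm_expR.
move=> u /andP[u0 us].
have ut : 0 <= u <= tau by rewrite (ltW u0) (le_trans (ltW us)).
rewrite -(e12 u) ?(ltW u0) ?(lt_le_trans us)//.
rewrite (_ : _ + _ = (f (y1 u) (al1 u) - f (y2 u) (al1 u)) 0 i); last by rewrite !mxE mulN1r.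
have [h1 h2] := Hr u ut.
rewrite (le_trans (ler_coord _ _))// (le_trans (HL _ _ _ h1 h2 _))//.
  by apply: c1.1; exact: ltW.
by rewrite ler_pM2l// HB.
Qed.

Lemma trajectory_until_causal (tau : R) x al1 al2 y1 y2 :
  controls A al1 -> controls A al2 ->
  trajectory_until tau x al1 y1 -> trajectory_until tau x al2 y2 ->
  (forall s, 0 <= s < tau -> al1 s = al2 s) ->
  forall s, 0 <= s <= tau -> y1 s = y2 s.
Proof.
move=> c1 c2 H1 H2 e12 s st.
have [r1 r10 Hr1] := continuous_lipschitz_bound tau H1.1.
have [r2 r20 Hr2] := continuous_lipschitz_bound tau H2.1.
have [|L L0 HL] := @norm_lipschitz (r1 + r2); first exact: addr_gt0.
have := @trajectory_stability L (r1 + r2) tau x x al1 al2 y1 y2 L0 _ c1 c2 H1 H2 e12.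
rewrite subrr normr0 mulr0 => H.
apply/eqP; rewrite -subr_eq0 -normr_le0 -[leRHS](mul0r (expR (2 * L * s))); apply: H => //.
  by move=> ? ? a h1 h2 Aa; have [] := HL _ _ _ h1 h2 Aa.
by move=> u ut; rewrite (le_trans (Hr1 u ut)) ?(le_trans (Hr2 u ut)) ?lerDl ?lerDr// ltW.
Qed.

Lemma trajectory_causal (tau : R) x al1 al2 y1 y2 :
  controls A al1 -> controls A al2 ->
  is_trajectory f x al1 y1 -> is_trajectory f x al2 y2 ->
  (forall s, 0 <= s < tau -> al1 s = al2 s) ->
  forall s, 0 <= s <= tau -> y1 s = y2 s.
Proof.
have tr al y : is_trajectory f x al y -> trajectory_until tau x al y.
  by move=> H; split=> [|t i /andP[t0 _]]; [exact: H.1|exact: (trajectory_coordE H)].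
by move=> c1 c2 /tr H1 /tr H2; exact: trajectory_until_causal H1 H2.
Qed.

(* Picard iteration: measured with the weight exp (- 2 L t), each step halves the distances. *)
Lemma trajectory_exists x al : controls A al -> exists y, is_trajectory f x al y.
Proof.
move=> cal; have [M M0 HM] := norm_growth.
pose next (y : R -> 'rV[R]_n) t : 'rV[R]_n :=
  \row_i (x 0 i + itg (fun s => f (y s) (al s) 0 i) 0 t).
pose Y j := iter j next (fun=> x).
have e1 t : 0 <= t -> 1 <= expR (2 * M * t).
  by move=> t0; rewrite -expR0 ler_expR mulr_ge0// mulr_ge0// ltW.
(* The bound of [trajectory_growth] is invariant under [next], so it holds for all iterates at
   once. *)
pose rad t := 2 * (1 + `|x|) * expR (2 * M * t).
have rad_mono s t : s <= t -> rad s <= rad t.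
  move=> st; rewrite /rad ler_wpM2l ?mulr_ge0 ?addr_ge0// ler_expR ler_wpM2l//.
  by rewrite mulr_ge0// ltW.
have rad_gt0 t : 0 < rad t.
  by rewrite /rad mulr_gt0 ?expR_gt0// mulr_gt0// ltr_pwDl.
have HY j : {within (`[0, +oo[ : set R), continuous (Y j)} /\
    forall t, 0 <= t -> 1 + `|Y j t| <= rad t.
  elim: j => [|j [cY bY]].
    split; first by move=> ?; exact: cvg_cst.
    by move=> t t0 /=; rewrite /rad; have := e1 t t0; have := normr_ge0 x; nra.
  have lY i := lbm_f i cY cal; split.
    apply: lipschitz_continuous => T T0; exists (M * rad T) => s t s0 st tT.
    apply: rV_norm_le => [|i].
      by rewrite mulr_ge0 ?subr_ge0// mulr_ge0 ?(ltW M0) ?(ltW (rad_gt0 _)).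
    rewrite /= !mxE (itg_cat (b := s))// (_ : _ - _ = itg (fun s => f (Y j s) (al s) 0 i) s t); last by ring.
    apply: itg_norm_cst => // u /andP[su ut].
    have u0 : 0 <= u by rewrite (le_trans s0)// ltW.
    rewrite (le_trans (ler_coord _ _))// (le_trans (HM _ _ (cal.1 _ u0)))// ler_pM2l//.
    by rewrite (le_trans (bY u u0))// rad_mono// ltW// (lt_le_trans ut).
  move=> t t0 /=.
  suff : `|next (Y j) t| <= `|x| + (1 + `|x|) * expR (2 * M * t).
    by rewrite /rad; have := e1 t t0; have := normr_ge0 x; nra.
  apply: rV_norm_le => [|i].
    by rewrite addr_ge0// mulr_ge0 ?expR_ge0// addr_ge0.
  rewrite mxE (le_trans (ler_normD _ _))// lerD ?ler_coord//.
  have B0 : 0 <= 2 * (1 + `|x|) by rewrite mulr_ge0// addr_ge0.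
  have := itg_expR_le M t0 B0; rewrite (mulrAC 2) divff// mul1r; apply: le_trans.
  apply: itg_norm => //; first by apply: lbmZ; apply: lbmZ; exact: lbm_expR.
  move=> u /andP[/ltW u0 ut].
  rewrite (le_trans (ler_coord _ _))// (le_trans (HM _ _ (cal.1 _ u0)))// ler_pM2l//.
  exact: bY.
have Yr j s T : 0 <= s <= T -> `|Y j s| <= rad T.
  move=> /andP[s0 sT]; rewrite (le_trans _ (rad_mono _ _ sT))//.
  by rewrite (le_trans _ ((HY j).2 s s0))// lerDr.
have lY j i := lbm_f i (HY j).1 cal.
have YS j t i : Y j.+1 t 0 i = x 0 i + itg (fun s => f (Y j s) (al s) 0 i) 0 t.
  by rewrite /= mxE.
have lipT T : exists2 L, 0 < L & forall x1 x2 a, `|x1| <= rad T -> `|x2| <= rad T ->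
    A a -> `|f x1 a - f x2 a| <= L * `|x1 - x2|.
  have [L L0 HL] := norm_lipschitz (rad_gt0 T).
  by exists L => // x1 x2 a h1 h2 Aa; have [] := HL x1 x2 a h1 h2 Aa.
have step T : 0 <= T -> exists2 C : R, 0 <= C & forall s j, 0 <= s <= T ->
    `|Y j.+1 s - Y j s| <= C / 2 ^+ j.
  move=> T0; have [L L0 HL] := lipT T.
  have K j s : 0 <= s <= T -> `|Y j.+1 s - Y j s| <= 2 * rad T / 2 ^+ j * expR (2 * L * s).
    elim: j s => [|j IH] s sT; have /andP[s0 s1] := sT.
      rewrite expr0 divr1 (le_trans (ler_normB _ _))//.
      have h1 := Yr 1%N s T sT; have h2 := Yr 0%N s T sT.
      have : 1 <= expR (2 * L * s) by rewrite -expR0 ler_expR mulr_ge0// mulr_ge0// ltW.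
      have := ltW (rad_gt0 T); nra.
    have B0 : 0 <= 2 * rad T / 2 ^+ j by rewrite divr_ge0 ?exprn_ge0// mulr_ge0// ltW.
    have := itg_expR_le L s0 B0.
    rewrite (_ : 2 * rad T / 2 ^+ j / 2 = 2 * rad T / 2 ^+ j.+1); last first.
      by rewrite exprS invfM; ring.
    apply: le_trans; apply: rV_norm_le => [|i].
      by apply: itg_ge0 => u _; rewrite !mulr_ge0 ?expR_ge0// ltW.
    rewrite coordB !YS (_ : _ - _ = itg (fun s => f (Y j.+1 s) (al s) 0 i + -1 * f (Y j s) (al s) 0 i) 0 s); last first.
      by rewrite itgD ?itgZ//; [ring | exact: lbmZ].
    apply: itg_norm => //.
    - by apply: lbmD => //; exact: lbmZ.
    - by apply: lbmZ; apply: lbmZ; exact: lbm_expR.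
    move=> u /andP[/ltW u0 us].
    have uT : 0 <= u <= T by rewrite u0 ltW// (lt_le_trans us).
    rewrite (_ : _ + _ = (f (Y j.+1 u) (al u) - f (Y j u) (al u)) 0 i); last by rewrite !mxE mulN1r.
    rewrite (le_trans (ler_coord _ _))// (le_trans (HL _ _ _ (Yr _ _ _ uT) (Yr _ _ _ uT) (cal.1 _ u0)))//.
    by rewrite ler_pM2l// IH.
  exists (2 * rad T * expR (2 * L * T)).
    by rewrite !mulr_ge0 ?expR_ge0// ltW.
  move=> s j sT; rewrite (le_trans (K j s sT))// mulrAC.
  rewrite ler_wpM2r ?invr_ge0 ?exprn_ge0// ler_wpM2l ?mulr_ge0 ?(ltW (rad_gt0 _))//.
  by case/andP: sT => _ sT; rewrite ler_expR ler_wpM2l// mulr_ge0// ltW.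
have /choice[y Hy] : forall t, exists v : 'rV[R]_n, 0 <= t -> forall C : R, 0 <= C ->
    (forall j : nat, `|Y j.+1 t - Y j t| <= C / 2 ^+ j) ->
    forall j : nat, `|v - Y j t| <= 2 * C / 2 ^+ j.
  move=> t; have [t0|t0] := leP 0 t; last first.
    exists 0 => h; exfalso; lra.
  have [C C0 HC] := step t t0.
  have HCi i j : `|Y j.+1 t 0 i - Y j t 0 i| <= C / 2 ^+ j.
    rewrite -coordB.
    by rewrite (le_trans (ler_coord _ _))// HC// t0 lexx.
  have /choice[v Hv] := fun i => geometric_limit (HCi i).
  exists (\row_i v i) => _ C' C'0 HC' j; apply: rV_norm_le => [|i].
    by rewrite divr_ge0 ?exprn_ge0// mulr_ge0.
  rewrite !mxE; apply: geometric_limit_bound (Hv i) _ j => k.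
  rewrite -coordB.
  by rewrite (le_trans (ler_coord _ _)).
have close T : 0 <= T -> exists2 C : R, 0 <= C & forall s j, 0 <= s <= T ->
    `|y s - Y j s| <= C / 2 ^+ j.
  move=> T0; have [C C0 HC] := step T T0; exists (2 * C); first exact: mulr_ge0.
  by move=> s j sT; apply: Hy => //; [case/andP: sT | move=> k; exact: HC].
have yr s T : 0 <= s <= T -> `|y s| <= rad T.
  move=> sT; have T0 : 0 <= T by case/andP: sT; exact: le_trans.
  have [C C0 HC] := close T T0; apply: (@le_of_geometric _ _ _ C) => j.
  rewrite -(subrK (Y j s) (y s)) (le_trans (ler_normD _ _))// addrC lerD ?HC//.
  exact: Yr.
have cy : {within (`[0, +oo[ : set R), continuous y}.
  apply: lipschitz_continuous => T T0; exists (M * (1 + rad T)) => s t s0 st tT.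
  have [C C0 HC] := close T T0; apply: (@le_of_geometric _ _ _ (C + C)) => j.
  have sT : 0 <= s <= T by rewrite s0 (le_trans st).
  have tT' : 0 <= t <= T by rewrite tT (le_trans s0).
  have h1 : `|Y j.+1 t - Y j.+1 s| <= M * (1 + rad T) * (t - s).
    apply: rV_norm_le => [|i].
      by rewrite mulr_ge0 ?subr_ge0// mulr_ge0 ?(ltW M0)// addr_ge0// ltW.
    rewrite /= !mxE (itg_cat (b := s))// (_ : _ - _ = itg (fun s => f (Y j s) (al s) 0 i) s t); last by ring.
    apply: itg_norm_cst => // u /andP[su ut].
    have u0 : 0 <= u by rewrite (le_trans s0)// ltW.
    rewrite (le_trans (ler_coord _ _))// (le_trans (HM _ _ (cal.1 _ u0)))// ler_pM2l//.
    by rewrite lerD2l Yr// u0 ltW// (lt_le_trans ut).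
  have hC : C / 2 ^+ j.+1 <= C / 2 ^+ j.
    rewrite ler_wpM2l// lef_pV2 ?posrE ?exprn_gt0// exprS ler_peMl ?exprn_ge0//.
    by rewrite ler1n.
  have h2 := le_trans (HC s j.+1 sT) hC; have h3 := le_trans (HC t j.+1 tT') hC.
  rewrite (_ : y t - y s = (Y j.+1 t - Y j.+1 s) + ((y t - Y j.+1 t) - (y s - Y j.+1 s))); last first.
    by apply/rowP => i; rewrite !mxE; ring.
  by rewrite (le_trans (ler_normD _ _))// lerD// mulrDl (le_trans (ler_normB _ _))// lerD.
exists y; split => // t i t0.
have [C C0 HC] := close t t0; have [L L0 HL] := lipT t.
have ly := lbm_f i cy cal.
change (y t 0 i = x 0 i + itg (fun s => f (y s) (al s) 0 i) 0 t).
apply/eqP; rewrite -subr_eq0 -normr_le0; apply: (@le_of_geometric _ _ _ (C + L * C * t)) => j.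
rewrite add0r.
have tt : 0 <= t <= t by rewrite t0 lexx.
have h1 : `|y t 0 i - Y j.+1 t 0 i| <= C / 2 ^+ j.
  rewrite -coordB.
  rewrite (le_trans (ler_coord _ _))// (le_trans (HC _ _ tt))//.
  rewrite ler_wpM2l// lef_pV2 ?posrE ?exprn_gt0// exprS ler_peMl ?exprn_ge0//.
  by rewrite ler1n.
have h2 : `|itg (fun s => f (Y j s) (al s) 0 i + -1 * f (y s) (al s) 0 i) 0 t| <= L * (C / 2 ^+ j) * (t - 0).
  apply: itg_norm_cst => //; first by apply: lbmD => //; exact: lbmZ.
  move=> u /andP[/ltW u0 /ltW ut].
  have uT : 0 <= u <= t by rewrite u0.
  rewrite (_ : _ + _ = (f (Y j u) (al u) - f (y u) (al u)) 0 i); last by rewrite !mxE mulN1r.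
  rewrite (le_trans (ler_coord _ _))// (le_trans (HL _ _ _ (Yr _ _ _ uT) (yr _ _ uT) (cal.1 _ u0)))//.
  by rewrite ler_pM2l// distrC HC.
rewrite itgD ?itgZ// in h2; last exact: lbmZ.
rewrite (_ : _ - _ = (y t 0 i - Y j.+1 t 0 i) + (itg (fun s => f (Y j s) (al s) 0 i) 0 t + -1 * itg (fun s => f (y s) (al s) 0 i) 0 t)); last first.
  by rewrite YS; ring.
rewrite (le_trans (ler_normD _ _))// mulrDl lerD// (le_trans h2)// subr0.
by rewrite le_eqVlt; apply/orP; left; apply/eqP; ring.
Qed.

Lemma trajectoryP x al : controls A al -> is_trajectory f x al (trajectory f x al).
Proof.
by move=> cal; have [y Hy] := trajectory_exists x cal; exact: (@getPex _ (is_trajectory f x al) (ex_intro _ y Hy)).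
Qed.

Lemma trajectory_unique x al y : controls A al -> is_trajectory f x al y ->
  forall t, 0 <= t -> y t = trajectory f x al t.
Proof.
move=> cal Hy t t0; apply: (@trajectory_causal t x al al) => //; first exact: trajectoryP.
by rewrite t0 lexx.
Qed.

Lemma control_shift al h : controls A al -> 0 <= h -> controls A (fun s => al (h + s)).
Proof.
move=> [aA ma] h0; split; first by move=> t t0; apply: aA; rewrite addr_ge0.
move=> i; have mi : measurable_fun [set: R] ((fun t => al t 0 i) \_ `[0, +oo[).
  by apply/(measurable_restrictT _ _).1.
apply: (@eq_measurable_fun _ _ _ _ _ (fun t => ((fun t => al t 0 i) \_ `[0, +oo[) (h + t))).
  move=> t; rewrite inE/= in_itv/= andbT => t0.
  by rewrite patchE mem_set//= in_itv/= andbT addr_ge0.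
by apply: measurable_funTS; apply: (measurableT_comp mi); exact: measurable_shift.
Qed.

Definition concat (h : R) (al be : R -> 'rV[R]_m) : R -> 'rV[R]_m :=
  fun s => if s < h then al s else be (s - h).

Lemma control_concat h al be : 0 <= h -> controls A al -> controls A be ->
  controls A (concat h al be).
Proof.
move=> h0 [a1 m1] [a2 m2]; split.
  move=> t t0; rewrite /concat; case: ltP => ht; first exact: a1.
  by apply: a2; rewrite subr_ge0.
move=> i; rewrite (@itv_bndbnd_setU _ _ _ (BLeft h)) ?bnd_simp//.
apply/measurable_funU => //; split.
  apply: (@eq_measurable_fun _ _ _ _ _ (fun t => al t 0 i)).
    by move=> t; rewrite inE/= in_itv/= /concat => /andP[_ ->].
  by apply: measurable_funS (m1 i) => //; apply: subset_itv => //; rewrite bnd_simp.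
have mi : measurable_fun [set: R] ((fun t => be t 0 i) \_ `[0, +oo[).
  by apply/(measurable_restrictT _ _).1.
apply: (@eq_measurable_fun _ _ _ _ _ (fun t => ((fun t => be t 0 i) \_ `[0, +oo[) (- h + t))).
  move=> t; rewrite inE/= in_itv/= andbT => ht.
  by rewrite patchE mem_set//= ?in_itv/= ?andbT addrC ?subr_ge0// /concat ltNge ht.
by apply: measurable_funTS; apply: (measurableT_comp mi); exact: measurable_shift.
Qed.

(** Semigroup property: the shifted arc solves the equation for the shifted control, and solutions
    are unique. *)
Lemma trajectory_shift x al h : controls A al -> 0 <= h ->
  forall t, 0 <= t -> trajectory f x al (h + t) =
    trajectory f (trajectory f x al h) (fun s => al (h + s)) t.
Proof.
move=> cal h0; have Hy := trajectoryP x cal; set y := trajectory f x al.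
have cal' := control_shift cal h0.
apply: trajectory_unique => //; split.
  apply: lipschitz_continuous => T T0.
  have [r r0 Hr] := continuous_lipschitz_bound (h + T) Hy.1.
  have [C C0 HC] := f_bounded r.
  exists C => s t s0 st tT; apply: rV_norm_le => [|i].
    by rewrite mulr_ge0 ?subr_ge0// ltW.
  have ly := lbm_f i Hy.1 cal.
  have hs0 : 0 <= h + s by rewrite addr_ge0.
  have hst : h + s <= h + t by rewrite lerD2l.
  rewrite !mxE !(trajectory_coordE Hy) ?(le_trans hs0)//.
  rewrite (itg_cat (b := h + s))// (_ : _ - _ = itg (fun s => f (y s) (al s) 0 i) (h + s) (h + t)); last by ring.
  rewrite (_ : t - s = h + t - (h + s)); last by ring.
  apply: itg_norm_cst => // u /andP[/ltW su /ltW ut].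
  have u0 : 0 <= u by rewrite (le_trans hs0).
  rewrite (le_trans (ler_coord _ _))// HC//; last exact: cal.1.
  by apply: Hr; rewrite u0 (le_trans ut)// lerD2l.
move=> t i t0; have ly := lbm_f i Hy.1 cal.
rewrite -/(itg _ _ _) (itg_shift (k := fun s => f (y s) (al s) 0 i))// addr0.
rewrite !(trajectory_coordE Hy) ?addr_ge0// (itg_cat (b := h) (c := h + t)) ?lerDl//.
by rewrite addrA.
Qed.

Lemma trajectory_concat_before x al be h : 0 <= h -> controls A al -> controls A be ->
  forall t, 0 <= t <= h -> trajectory f x (concat h al be) t = trajectory f x al t.
Proof.
move=> h0 ca cb t th; have cc := control_concat h0 ca cb.
apply: (@trajectory_causal h x (concat h al be) al) => //; try exact: trajectoryP.
by move=> s /andP[_ sh]; rewrite /concat sh.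
Qed.

Lemma concat_shift h al be s : 0 <= s -> concat h al be (h + s) = be s.
Proof. by move=> s0; rewrite /concat ltNge lerDl s0/= addrC addKr. Qed.

Lemma trajectory_eq_control x al be tau : controls A al -> controls A be ->
  (forall s, 0 <= s < tau -> al s = be s) ->
  forall t, 0 <= t <= tau -> trajectory f x al t = trajectory f x be t.
Proof.
by move=> ca cb e t tt; apply: (@trajectory_causal tau x al be) => //; exact: trajectoryP.
Qed.

End Dynamics.

(** * Running costs over finite and infinite horizons *)

Section Cost.
Context {R : realType}.
Local Notation mu := (@lebesgue_measure R).
Implicit Types (k : R -> R) (t : \bar R).

Definition running_cost k t : \bar R :=
  (\int[mu]_(s in [set s : R | (0 <= s)%R /\ s%:E <= t]) (k s)%:E)%E.

Lemma upto_itv (t : R) : [set s : R | (0 <= s)%R /\ (s%:E <= t%:E)%E] = `[0, t]%classic.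
Proof.
apply/seteqP; split => s /=; rewrite in_itv/= lee_fin; first by move=> [-> ->].
by move=> /andP[].
Qed.

Lemma upto_itvy : [set s : R | (0 <= s)%R /\ (s%:E <= +oo)%E] = `[0, +oo[%classic.
Proof. by apply/seteqP; split => s /=; rewrite in_itv/= andbT leey// => -[]. Qed.

Lemma upto_measurable t : measurable [set s : R | (0 <= s)%R /\ (s%:E <= t)%E].
Proof.
case: t => [t||]; rewrite ?upto_itv ?upto_itvy//.
rewrite (_ : [set s | _] = set0)//; apply/seteqP; split => // s /=.
by rewrite leeNy_eq => -[].
Qed.

Lemma running_cost_fin k (t : R) : locally_bounded_measurable k ->
  running_cost k t%:E = (itg k 0 t)%:E.
Proof.
move=> hk; rewrite /running_cost upto_itv /itg /Rintegral fineK//.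
by apply: integrable_fin_num => //; exact: lbm_integrable.
Qed.

Lemma running_cost_mono k t1 t2 : locally_bounded_measurable k ->
  (forall s, 0 <= s -> 0 <= k s) -> (t1 <= t2)%E ->
  (running_cost k t1 <= running_cost k t2)%E.
Proof.
move=> [mk _] k0 t12; apply: ge0_subset_integral.
- exact: upto_measurable.
- exact: upto_measurable.
- apply/measurable_EFinP; apply: measurable_funS mk => //.
  by move=> s [s0 _]; rewrite /= in_itv/= s0.
- by move=> s [s0 _]; rewrite lee_fin k0.
- by move=> s [s0 st]; split => //; exact: le_trans t12.
Qed.

Lemma running_cost_ge0 k t : (forall s, 0 <= s -> 0 <= k s) -> (0 <= running_cost k t)%E.
Proof. by move=> k0; apply: integral_ge0 => s [s0 _]; rewrite lee_fin k0. Qed.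

(** For t = +oo the integral is the limit of those over [0, N], so finite horizons decide. *)
Lemma running_cost_le k t (c : \bar R) : locally_bounded_measurable k ->
  (forall s, 0 <= s -> 0 <= k s) -> (0 <= t)%E ->
  (forall s : R, 0 <= s -> (s%:E <= t)%E -> ((itg k 0 s)%:E <= c)%E) ->
  (running_cost k t <= c)%E.
Proof.
move=> hk k0; case: t => [t||//].
  by rewrite lee_fin => t0 H; rewrite running_cost_fin// H.
move=> _ H; rewrite /running_cost upto_itvy.
pose k' : R -> R := k \_ `[0, +oo[.
have e1 : forall s, 0 <= s -> k' s = k s.
  by move=> s s0; rewrite /k' patchE mem_set//= in_itv/= s0.
rewrite (_ : (\int[mu]_(s in _) _)%E = \int[mu]_(s in `[0%R, +oo[) (k' s)%:E)%E; last first.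
  by apply: eq_integral => s; rewrite inE/= in_itv/= andbT => /e1 ->.
have cv : (\int[mu]_(x in `[0%R, n%:R]) (k' x)%:E @[n --> \oo] -->
  \int[mu]_(x in `[0%R, +oo[) (k' x)%:E)%E.
  apply: ge0_cvgn_integral.
  - move=> s; rewrite /k' patchE; case: ifPn => //; rewrite inE/= in_itv/= andbT.
    exact: k0.
  - by apply/(measurable_restrictT _ _).1 => //; case: hk.
rewrite -(cvg_lim _ cv)//; apply: lime_le; first by apply/cvg_ex; eexists; exact: cv.
apply: nearW => N.
rewrite (_ : (\int[mu]_(s in _) _)%E = \int[mu]_(s in `[0%R, N%:R]) (k s)%:E)%E; last first.
  by apply: eq_integral => s; rewrite inE/= in_itv/= => /andP[/e1 ->].
have := H N%:R (ler0n _ _) (leey _).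
by rewrite -running_cost_fin// /running_cost upto_itv.
Qed.

Lemma itg_le_running_cost k (s : R) t : locally_bounded_measurable k ->
  (forall s, 0 <= s -> 0 <= k s) -> (s%:E <= t)%E -> ((itg k 0 s)%:E <= running_cost k t)%E.
Proof. by move=> hk k0 st; rewrite -running_cost_fin// running_cost_mono. Qed.

(** As t may be +oo, each inequality is obtained from finite horizons. *)
Lemma running_cost_shift k (h : R) t : locally_bounded_measurable k ->
  (forall s, 0 <= s -> 0 <= k s) -> 0 <= h -> (0 <= t)%E ->
  running_cost k (h%:E + t)%E = ((itg k 0 h)%:E + running_cost (fun s => k (h + s)%R) t)%E.
Proof.
move=> hk k0 h0 t0.
have hks := lbm_shift hk h0.
have k0s s : 0 <= s -> 0 <= k (h + s) by move=> s0; rewrite k0// addr_ge0.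
have I0 : 0 <= itg k 0 h by apply: itg_ge0 => s /andP[+ _]; exact: k0.
apply/eqP; rewrite eq_le; apply/andP; split.
  apply: running_cost_le => //; first by rewrite adde_ge0// lee_fin.
  move=> s s0 st; have [sh|/ltW hs] := leP s h.
    rewrite -[leLHS]adde0 leeD ?running_cost_ge0// lee_fin.
    rewrite (itg_cat (b := s) (c := h))// lerDl; apply: itg_ge0 => u /andP[su _].
    by rewrite k0// (le_trans s0).
  rewrite (itg_cat (b := h))// EFinD leeD2l//.
  rewrite -[X in itg k X s]addr0 -[s](subrKC h) -itg_shift//.
  apply: itg_le_running_cost => //.
  by rewrite EFinB leeBlDl.
rewrite -leeBrDl//; apply: running_cost_le => //.
move=> s s0 st; rewrite leeBrDl// itg_shift// addr0 -EFinD.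
rewrite -itg_cat ?lerDl//; apply: itg_le_running_cost => //.
by rewrite EFinD leeD2l.
Qed.

End Cost.

(** * Dynamic programming for [value_m] *)

Section DynamicProgramming.
Context {R : realType} {n m : nat}.
Variables (A : set 'rV[R]_m) (f : 'rV[R]_n -> 'rV[R]_m -> 'rV[R]_n)
  (l : 'rV[R]_n -> 'rV[R]_m -> R) (T : set 'rV[R]_n).
Hypotheses (dyn : standing_dynamics A f l) (l_ge0 : forall x a, A a -> 0 <= l x a).
Implicit Types (x : 'rV[R]_n) (al be : R -> 'rV[R]_m).

Local Notation traj := (trajectory f).
Local Notation running x al := (fun s => l (traj x al s) (al s)).
Local Notation entry := (entry_time f T).
Local Notation delay h al := (fun s => al (h + s)%R).
Local Notation Vm := (value_m f l A T).

Lemma lbm_running x al : controls A al -> locally_bounded_measurable (running x al).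
Proof. by move=> ca; apply: (lbm_l dyn) => //; have [] := trajectoryP dyn x ca. Qed.

Lemma running_ge0 x al : controls A al -> forall s, 0 <= s -> 0 <= running x al s.
Proof. by move=> ca s s0; apply: l_ge0; exact: ca.1. Qed.

Lemma itg_running_ge0 x al (a b : R) : controls A al -> 0 <= a -> 0 <= itg (running x al) a b.
Proof.
by move=> ca a0; apply: itg_ge0 => s /andP[as_ _]; rewrite running_ge0// (le_trans a0).
Qed.

Lemma costE t x al : cost f l t x al = running_cost (running x al) t.
Proof. by []. Qed.

Lemma entry_time_ge0 x al : (0 <= entry x al)%E.
Proof. by apply: le_ereal_inf_tmp => _ [t [t0 _] <-]; rewrite lee_fin. Qed.

Lemma entry_time_le x al (t : R) : 0 <= t -> T (traj x al t) -> (entry x al <= t%:E)%E.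
Proof. by move=> t0 Tt; apply: ereal_inf_lbound; exists t. Qed.

(** Only an inequality, since T may already have been visited before time h. *)
Lemma entry_time_shift x al (h : R) : controls A al -> 0 <= h ->
  (entry x al <= h%:E + entry (traj x al h) (delay h al))%E.
Proof.
move=> ca h0; rewrite -leeBlDl//; apply: le_ereal_inf_tmp => _ [t [t0 Tt] <-].
rewrite leeBlDl// -EFinD; apply: entry_time_le; first by rewrite addr_ge0.
by rewrite (trajectory_shift dyn).
Qed.

Lemma entry_time_shift_ge x al (h : R) : controls A al -> 0 <= h ->
  (forall s, 0 <= s <= h -> ~ T (traj x al s)) ->
  (h%:E + entry (traj x al h) (delay h al) <= entry x al)%E.
Proof.
move=> ca h0 nT; apply: le_ereal_inf_tmp => _ [t [t0 Tt] <-].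
have ht : h <= t by rewrite leNgt; apply/negP => /ltW th; apply: (nT t) => //; rewrite t0.
rewrite -leeBrDl// -EFinB; apply: entry_time_le; first by rewrite subr_ge0.
by rewrite -(trajectory_shift dyn) ?subr_ge0// subrKC.
Qed.

Lemma cost_shift x al (h : R) t : controls A al -> 0 <= h -> (0 <= t)%E ->
  cost f l (h%:E + t)%E x al =
  ((itg (running x al) 0 h)%:E + cost f l t (traj x al h) (delay h al))%E.
Proof.
move=> ca h0 t0; rewrite costE running_cost_shift//; [|exact: lbm_running|exact: running_ge0].
congr (_ + _)%E; apply: eq_integral => s; rewrite inE/= => -[s0 _].
by rewrite (trajectory_shift dyn).
Qed.

Lemma value_m_ge0 x : (0 <= Vm x)%E.
Proof.
rewrite /value_m; case: ifP => // _; apply: le_ereal_inf_tmp => _ [al ca <-].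
by apply: running_cost_ge0; exact: running_ge0.
Qed.

Lemma value_m_le x al : controls A al -> (Vm x <= cost f l (entry x al) x al)%E.
Proof.
move=> ca; rewrite /value_m; case: ifP => _.
  by apply: running_cost_ge0; exact: running_ge0.
by apply: ereal_inf_lbound; exists al.
Qed.

Lemma trajectory_delay_concat x al be (h t : R) : 0 <= h -> controls A al ->
  controls A be -> 0 <= t -> traj x (delay h (concat h al be)) t = traj x be t.
Proof.
move=> h0 ca cb t0; apply: (@trajectory_eq_control _ _ _ A f l dyn x _ be t) => //.
- by apply: control_shift => //; exact: control_concat.
- by move=> s /andP[s0 _]; rewrite concat_shift.
- by rewrite t0 lexx.
Qed.

(** If the arc meets T before h, its cost stops there and [value_m] is nonnegative; otherwise al is
    continued after h by an arbitrary control issued from the point reached. *)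
Lemma value_m_le_running x al (h : R) : controls A al -> 0 <= h ->
  (Vm x <= (itg (running x al) 0 h)%:E + Vm (traj x al h))%E.
Proof.
move=> ca h0.
have [hT|nT] := pselect (exists2 s, 0 <= s <= h & T (traj x al s)).
  have [s /andP[s0 sh] Ts] := hT.
  rewrite (le_trans (value_m_le x ca))// -[leLHS]adde0 leeD ?value_m_ge0//.
  rewrite costE -(running_cost_fin _ (lbm_running x ca)) running_cost_mono//.
  - exact: lbm_running.
  - exact: running_ge0.
  - by rewrite (le_trans (entry_time_le s0 Ts))// lee_fin.
have nTh : ~ T (traj x al h) by move=> Th; apply: nT; exists h => //; rewrite h0 lexx.
rewrite {2}/value_m memNset// -leeBlDl//.
apply: le_ereal_inf_tmp => _ [be cb <-].
have cc := control_concat h0 ca cb.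
rewrite leeBlDl//; apply: (le_trans (value_m_le x cc)).
have eh : traj x (concat h al be) h = traj x al h.
  by apply: (trajectory_concat_before dyn) => //; rewrite h0 lexx.
have es : entry (traj x al h) (fun s => concat h al be (h + s)) = entry (traj x al h) be.
  by congr ereal_inf; apply/seteqP; split => _ [t [t0 Tt] <-]; exists t => //;
    split => //; move: Tt; rewrite trajectory_delay_concat.
have := entry_time_shift x cc h0; rewrite eh es => le1.
rewrite (le_trans (running_cost_mono (lbm_running x cc) (running_ge0 x cc) le1))//.
rewrite -costE cost_shift ?entry_time_ge0// eh.
rewrite (_ : itg _ 0 h = itg (running x al) 0 h); last first.
  apply: itg_ext => //; try exact: lbm_running.
  move=> s /andP[/ltW s0 sh]; rewrite (trajectory_concat_before dyn) ?s0 ?(ltW sh)//.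
  by rewrite /concat sh.
rewrite leeD2l//.
rewrite le_eqVlt; apply/orP; left; apply/eqP.
apply: eq_integral => s; rewrite inE/= => -[s0 _].
by rewrite concat_shift// trajectory_delay_concat.
Qed.

(** The converse half, for one control: while T is avoided, the tail of al is a competitor at the
    point reached. *)
Lemma running_value_m_le x al (h : R) : controls A al -> 0 <= h ->
  (forall s, 0 <= s <= h -> ~ T (traj x al s)) ->
  ((itg (running x al) 0 h)%:E + Vm (traj x al h) <= cost f l (entry x al) x al)%E.
Proof.
move=> ca h0 nT; have cs := control_shift ca h0.
have le1 := entry_time_shift_ge ca h0 nT.
rewrite (le_trans _ (running_cost_mono (lbm_running x ca) (running_ge0 x ca) le1))//.
by rewrite -costE cost_shift ?entry_time_ge0// leeD2l// value_m_le.
Qed.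

End DynamicProgramming.

(** * Sub- and superoptimality principles *)

Section Semicontinuity.
Context {R : realType}.
Implicit Types (c : \bar R).

(** Real strict bounds treat finite and infinite limits alike: at an infinite limit one of the two
    conditions is vacuous. *)
Lemma ereal_cvgP (T : Type) (F : set_system T) (u : T -> \bar R) (L : \bar R) : Filter F ->
  u @ F --> L <-> (forall r : R, (r%:E < L)%E -> \forall z \near F, (r%:E < u z)%E) /\
                  (forall r : R, (L < r%:E)%E -> \forall z \near F, (u z < r%:E)%E).
Proof.
move=> FF; split=> [H|[H1 H2]].
  split=> r rL.
    by apply: (H [set y | (r%:E < y)%E]); exact: open_ereal_gt'.
  by apply: (H [set y | (y < r%:E)%E]); exact: open_ereal_lt'.
case: L H1 H2 => [L||] H1 H2 U /=.
- move=> [e /= e0 HU].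
  have := H1 (L - e); rewrite lte_fin ltrBlDr ltrDl => /(_ e0) h1.
  have := H2 (L + e); rewrite lte_fin ltrDl => /(_ e0) h2.
  rewrite /nbhs/=; near=> z.
  have z1 : ((L - e)%:E < u z)%E by near: z.
  have z2 : (u z < (L + e)%:E)%E by near: z.
  suff: U (u z) by [].
  case: (u z) z1 z2 => [v||]//; rewrite !lte_fin => z1 z2.
  apply: HU; rewrite /ball_/= ltr_norml; apply/andP; split; lra.
- move=> [M [_ HM]]; apply: filterS (H1 M (ltry _)) => z; exact: HM.
- move=> [M [_ HM]]; apply: filterS (H2 M (ltNyr _)) => z; exact: HM.
Unshelve. all: by end_near. Qed.

Context {n : nat}.
Implicit Types (u w : 'rV[R]_n -> \bar R) (X K : set 'rV[R]_n) (x : 'rV[R]_n).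

Lemma lsc_env_gt X u x c : (c < lsc_env X u x)%E ->
  \forall z \near x, X z -> (c < u z)%E.
Proof.
rewrite /lsc_env limf_einfE => /ereal_sup_gt[_ [V FV <-]] cV.
move: FV; rewrite /within /=; apply: filterS => z VX Xz.
by apply: (lt_le_trans cV); apply: ereal_inf_lbound; exists z => //; exact: VX.
Qed.

Lemma le_lsc_env X u x c : (\forall z \near x, X z -> (c <= u z)%E) ->
  (c <= lsc_env X u x)%E.
Proof.
move=> H; rewrite /lsc_env limf_einfE.
apply: le_trans (ereal_sup_ubound (x := ereal_inf (u @` [set z | (c <= u z)%E])) _).
  by apply: le_ereal_inf_tmp => _ [z /= cz <-].
by exists [set z | (c <= u z)%E].
Qed.

Lemma lsc_env_le X u x : X x -> (lsc_env X u x <= u x)%E.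
Proof.
move=> Xx; rewrite leNgt; apply/negP => /lsc_env_gt/nbhs_singleton/(_ Xx).
by rewrite ltxx.
Qed.

(** A neighbourhood of x on which the bound holds is also a neighbourhood of the points near x. *)
Lemma lsc_env_lsc X u x c : (c < lsc_env X u x)%E ->
  \forall z \near x, (c < lsc_env X u z)%E.
Proof.
rewrite {1}/lsc_env limf_einfE => /ereal_sup_gt[_ [V FV <-]] cV.
move: FV; rewrite /within/= => /nbhs_interior; apply: filterS => z Hz.
apply: (lt_le_trans cV); rewrite /lsc_env limf_einfE.
by apply: ereal_sup_ubound; exists V.
Qed.

Lemma lsc_env_approx X u x c (e : R) : 0 < e -> (lsc_env X u x < c)%E ->
  exists2 z, `|z - x| < e & X z /\ (u z < c)%E.
Proof.
move=> e0 uc; apply/not_exists2P => H.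
suff : (c <= lsc_env X u x)%E by rewrite leNgt uc.
apply: le_lsc_env; apply/nbhs_ballP; exists e => //= z; rewrite mx_norm_ball /ball_/= => xz Xz.
rewrite leNgt; apply/negP => uz; have := H z; rewrite distrC xz => -[//|]; apply.
by split.
Qed.

Lemma usc_env_lt X u x c : (usc_env X u x < c)%E ->
  \forall z \near x, X z -> (u z < c)%E.
Proof.
rewrite /usc_env limf_esupE => /ereal_inf_lt[_ [V FV <-]] cV.
move: FV; rewrite /within /=; apply: filterS => z VX Xz.
by apply: le_lt_trans cV; apply: ereal_sup_ubound; exists z => //; exact: VX.
Qed.

Lemma usc_env_le X u x c : (\forall z \near x, X z -> (u z <= c)%E) ->
  (usc_env X u x <= c)%E.
Proof.
move=> H; rewrite /usc_env limf_esupE.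
apply: (@le_trans _ _ (ereal_sup (u @` [set z | (u z <= c)%E]))).
  by apply: ereal_inf_lbound; exists [set z | (u z <= c)%E].
by apply: ge_ereal_sup => _ [z /= cz <-].
Qed.

Lemma usc_env_ge X u x : X x -> (u x <= usc_env X u x)%E.
Proof.
move=> Xx; rewrite leNgt; apply/negP => /usc_env_lt/nbhs_singleton/(_ Xx).
by rewrite ltxx.
Qed.

Lemma usc_env_usc X u x c : (usc_env X u x < c)%E ->
  \forall z \near x, (usc_env X u z < c)%E.
Proof.
rewrite {1}/usc_env limf_esupE => /ereal_inf_lt[_ [V FV <-]] cV.
move: FV; rewrite /within/= => /nbhs_interior; apply: filterS => z Hz.
apply: le_lt_trans cV; rewrite /usc_env limf_esupE.
by apply: ereal_inf_lbound; exists V.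
Qed.

(** If the infimum M were not attained, w would exceed some d > M near each point of K; compactness
    makes d uniform, which contradicts the choice of M. *)
Lemma lsc_attains K w (c0 : R) : compact K -> K !=set0 ->
  (forall x, K x -> (c0%:E <= w x)%E) ->
  (forall x, K x -> forall c : R, (c%:E < w x)%E -> \forall z \near x, (c%:E < w z)%E) ->
  exists2 z, K z & forall z', K z' -> (w z <= w z')%E.
Proof.
move=> cK [z0 Kz0] lb lsc.
pose M := ereal_inf (w @` K).
have Mle z : K z -> (M <= w z)%E by move=> Kz; apply: ereal_inf_lbound; exists z.
have [[z Kz wz]|H] := pselect (exists2 z, K z & w z = M).
  by exists z => // z' Kz'; rewrite wz Mle.
have Mlt z : K z -> (M < w z)%E.
  by move=> Kz; rewrite lt_neqAle Mle// andbT; apply/eqP => e; apply: H; exists z.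
have : (c0%:E <= M)%E by apply: le_ereal_inf_tmp => _ [z Kz <-]; exact: lb.
have := Mlt z0 Kz0.
case EM : M => [r||] //.
- rewrite EM in Mlt H Mle => _ _.
  have nc : near_covering K by apply/compact_near_coveringP.
  have : \forall d \near r^'+, K `<=` (fun z => (d%:E < w z)%E).
    apply: nc => z Kz.
    have [d rd dw] : exists2 d : R, r < d & (d%:E < w z)%E.
      have := Mlt z Kz; case: (w z) => [v||]//.
        by rewrite lte_fin => rv; exists ((r + v) / 2); rewrite ?lte_fin; lra.
      by move=> _; exists (r + 1); rewrite ?ltry// ltrDl.
    exists ([set z' | (d%:E < w z')%E], [set d' | d' < d]) => /=.
      by split; [exact: lsc | exact: nbhs_right_lt].
    by move=> [z' d'] [/= h1 h2]; apply: lt_trans h1; rewrite lte_fin.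
  move=> Hd; have : \forall d \near r^'+, False.
    near=> d.
    have Kd : K `<=` (fun z => (d%:E < w z)%E) by near: d.
    have rd : r < d by near: d; exact: nbhs_right_gt.
    have : (d%:E <= M)%E.
      by apply: le_ereal_inf_tmp => _ [z Kz <-]; apply: ltW; exact: Kd.
    by rewrite EM lee_fin leNgt rd.
  by move=> /filter_ex[].
- by rewrite ltNge leey.
Unshelve. all: by end_near. Qed.

End Semicontinuity.

(** * Gradients and quadratic test functions *)

Section Gradient.
Context {R : realType} {n : nat}.
Implicit Types (x y z : 'rV[R]_n).

Lemma rV_sum_delta x : x = \sum_(i < n) x 0 i *: delta_mx 0 i.
Proof. exact: row_sum_delta. Qed.

Lemma diff_grad (phi : 'rV[R]_n -> R) x : differentiable phi x ->
  forall v, 'd phi x v = dotp (grad phi x) v.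
Proof.
move=> dphi v; rewrite {1}(rV_sum_delta v) linear_sum; apply: eq_bigr => i _.
by rewrite linearZ/= mxE deriveE// mulrC.
Qed.

Lemma differentiable_expansion (phi : 'rV[R]_n -> R) x (e : R) : differentiable phi x ->
  0 < e -> exists2 d : R, 0 < d & forall z, `|z - x| < d ->
    `|phi z - phi x - dotp (grad phi x) (z - x)| <= e * `|z - x|.
Proof.
move=> dphi e0; have E := diff_locallyx dphi.
set k := ('o_ _ _) in E.
have /(littleoP [littleo of k]) /nbhs_ballP[d /= d0 Hd] := e0.
exists d => // z zx; rewrite -diff_grad//.
have := E (z - x); rewrite subrK => ->.
have -> : phi x + 'd phi x (z - x) + k (z - x) - phi x - 'd phi x (z - x) = k (z - x) by ring.
by apply: Hd; rewrite mx_norm_ball /ball_/= sub0r normrN.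
Qed.

Definition penalty (k : R) y : 'rV[R]_n -> R := fun z => k * dotp (z - y) (z - y).

Lemma penalty_differentiable k y z : differentiable (penalty k y) z.
Proof.
pose pr i : 'rV[R]_n -> R := (fun z : 'rV[R]_n => z 0 i) - cst (y 0 i).
have -> : penalty k y = \sum_(i < n) (cst k * (pr i * pr i)).
  apply/funext => v; rewrite /penalty /dotp mulr_sumr fct_sumE.
  by apply: eq_bigr => i _; rewrite !mxE.
apply: differentiable_sum => i.
have dp : differentiable (pr i) z.
  by apply: differentiableB; [exact: differentiable_coord | exact: differentiable_cst].
apply: differentiableM; first exact: differentiable_cst.
exact: differentiableM.
Qed.

Lemma grad_penalty k y z : grad (penalty k y) z = (2 * k) *: (z - y).
Proof.
apply/rowP => i; rewrite [LHS]mxE [RHS]mxE coordB.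
have e (h : R) : penalty k y (h *: delta_mx 0 i + z) - penalty k y z =
    h * (k * (2 * (z 0 i - y 0 i) + h)).
  rewrite /penalty -mulrBr (_ : h *: delta_mx 0 i + z - y = h *: delta_mx 0 i + (z - y)); last by rewrite addrA.
  have E1 v : dotp (delta_mx 0 i) v = v 0 i :> R.
    rewrite /dotp (bigD1 i)//= mxE !eqxx mul1r big1 ?addr0// => j ji.
    by rewrite mxE (negbTE ji) andbF mul0r.
  rewrite !(dotpDl, dotpDr) !(dotpZl, dotpZr) !dotpNl !dotpNr.
  rewrite (dotpC z (delta_mx 0 i)) (dotpC y (delta_mx 0 i)) !E1 !mxE !eqxx mulr1n.
  by rewrite (dotpC y z); ring.
rewrite /derive; apply: cvg_lim => //; apply/cvgrPdist_le => d d0.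
near=> h.
have h0 : h != 0 by near: h; exact: nbhs_dnbhs_neq.
rewrite /= e /GRing.scale/= mulKf//.
rewrite (_ : _ - _ = - (k * h)); last by ring.
rewrite normrN normrM (le_trans (y := (`|k| + 1) * `|h|))//.
  by rewrite ler_wpM2r// lerDl.
rewrite -ler_pdivlMl ?ltr_wpDl//.
by near: h; apply: dnbhs0_le; rewrite mulr_gt0 ?invr_gt0 ?ltr_wpDl.
Unshelve. all: by end_near. Qed.

Lemma continuous_affine_rV (c : R) y : continuous (fun z : 'rV[R]_n => c *: (z - y)).
Proof.
have c0 : 0 < `|c| + 1 by rewrite ltr_wpDl.
suff H z : (fun z : 'rV[R]_n => c *: (z - y)) @ z --> c *: (z - y) by exact: H.
have FF : Filter (nbhs z) by exact: nbhs_filter.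
apply/(@cvgrPdist_le _ _ _ (nbhs z) FF) => e e0; apply/nbhs_ballP; exists (e / (`|c| + 1)); first exact: divr_gt0.
move=> v; rewrite mx_norm_ball /ball_/= ltr_pdivlMr// => /ltW zv.
rewrite -scalerBr normrZ (_ : z - y - (v - y) = z - v); last by rewrite opprB addrA subrK.
by rewrite (le_trans _ zv)// mulrC ler_wpM2l// lerDl.
Qed.

Lemma penalty_C1 (O : set 'rV[R]_n) k y : C1_on O (penalty k y).
Proof.
move=> z _; split; first exact: penalty_differentiable.
by rewrite (_ : grad _ = fun z => (2 * k) *: (z - y)); [exact: continuous_affine_rV | apply/funext => ?; exact: grad_penalty].
Qed.

Lemma continuous_penalty k y : continuous (penalty k y).
Proof. by move=> z; apply: differentiable_continuous; exact: penalty_differentiable. Qed.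

End Gradient.

Section Penalized.
Context {R : realType} {n : nat}.
Implicit Types (w : 'rV[R]_n -> \bar R) (x y z : 'rV[R]_n).

Lemma lsc_add_penalty w k y z (c : R) :
  (forall c : R, (c%:E < w z)%E -> \forall z' \near z, (c%:E < w z')%E) ->
  (c%:E < w z + (penalty k y z)%:E)%E ->
  \forall z' \near z, (c%:E < w z' + (penalty k y z')%:E)%E.
Proof.
move=> lw cw.
have [d d0 dw] : exists2 d : R, 0 < d & ((c - penalty k y z + d)%:E < w z)%E.
  move: cw; case: (w z) => [v||]//.
    rewrite -EFinD lte_fin => cv; exists ((v + penalty k y z - c) / 2); first lra.
    rewrite lte_fin; lra.
  by exists 1 => //; rewrite ltry.
have cp := @continuous_penalty R n k y z.
have Hp : \forall z' \near z, `|penalty k y z - penalty k y z'| < d.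
  by move/cvgrPdist_lt : cp; exact.
have Hw := lw _ dw; near=> z'.
have h1 : `|penalty k y z - penalty k y z'| < d by near: z'.
have h2 : ((c - penalty k y z + d)%:E < w z')%E by near: z'.
case: (w z') h2 => [v||] h2; [|by rewrite addye// ltry|by rewrite ltNge leNye in h2].
move: h2; rewrite -EFinD !lte_fin => h2.
by move: h1; rewrite ltr_norml => /andP[? ?]; lra.
Unshelve. all: by end_near. Qed.

End Penalized.

(** * One penalized time step, and local suboptimality of subsolutions *)

Section PenaltyStep.
Context {R : realType} {n m : nat}.
Variables (A : set 'rV[R]_m) (f : 'rV[R]_n -> 'rV[R]_m -> 'rV[R]_n)
  (l : 'rV[R]_n -> 'rV[R]_m -> R).
Hypotheses (dyn : standing_dynamics A f l).
Implicit Types (x z : 'rV[R]_n) (al : R -> 'rV[R]_m).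

Local Notation traj := (trajectory f).
Local Notation running x al := (fun s => l (traj x al s) (al s)).
Local Notation sq v := (dotp v v).

Definition bounds_on_ball (rho L F : R) : Prop :=
  [/\ 0 < L, 0 < F,
      forall x1 x2 a, `|x1| <= rho -> `|x2| <= rho -> A a ->
        `|f x1 a - f x2 a| <= L * `|x1 - x2| /\ `|l x1 a - l x2 a| <= L * `|x1 - x2|
    & forall x a, `|x| <= rho -> A a -> `|f x a| <= F /\ `|l x a| <= F].

Lemma bounds_on_ball_exist (rho : R) : 0 < rho -> exists L F, bounds_on_ball rho L F.
Proof.
move=> r0; have [L L0 HL] := norm_lipschitz dyn r0.
have [F1 F10 HF1] := f_bounded dyn rho; have [F2 F20 HF2] := l_bounded dyn rho.
exists L, (F1 + F2); split => //; first exact: addr_gt0.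
move=> x a xr Aa; split.
  by rewrite (le_trans (HF1 x a xr Aa))// lerDl ltW.
by rewrite (le_trans (HF2 x a xr Aa))// lerDr ltW.
Qed.

Lemma trajectory_incr_dotp x al v (s t : R) : controls A al -> 0 <= s -> s <= t ->
  dotp v (traj x al t - traj x al s) =
  itg (fun u => dotp v (f (traj x al u) (al u))) s t.
Proof.
move=> ca s0 st; have Hy := trajectoryP dyn x ca.
have lf i := lbm_f dyn i Hy.1 ca.
rewrite /dotp itg_sum//; last by move=> i; exact: lbmZ.
apply: eq_bigr => i _; rewrite itgZ// coordB !(trajectory_coordE Hy) ?(le_trans s0)//.
rewrite (itg_cat (b := s) (c := t))//; congr (_ * _); ring.
Qed.

Lemma lbm_dotp_f x al v : controls A al ->
  locally_bounded_measurable (fun u => dotp v (f (traj x al u) (al u))).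
Proof.
move=> ca; have Hy := trajectoryP dyn x ca.
by apply: lbm_sum => i; apply: lbmZ; exact: (lbm_f dyn i Hy.1 ca).
Qed.

Lemma trajectory_incr_norm x al (rho L F s t : R) : bounds_on_ball rho L F ->
  controls A al -> 0 <= s -> s <= t ->
  (forall u, s <= u <= t -> `|traj x al u| <= rho) ->
  `|traj x al t - traj x al s| <= F * (t - s).
Proof.
move=> [L0 F0 _ HF] ca s0 st Hr; have Hy := trajectoryP dyn x ca.
apply: rV_norm_le => [|i]; first by rewrite mulr_ge0 ?subr_ge0// ltW.
have lf := lbm_f dyn i Hy.1 ca.
rewrite coordB !(trajectory_coordE Hy) ?(le_trans s0)// (itg_cat (b := s) (c := t))//.
rewrite (_ : _ - _ = itg (fun u => f (traj x al u) (al u) 0 i) s t); last by ring.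
apply: itg_norm_cst => // u /andP[/ltW su /ltW ut].
have Aa : A (al u) by apply: ca.1; exact: le_trans su.
have yu : `|traj x al u| <= rho by rewrite Hr// su.
by rewrite (le_trans (ler_coord _ _))//; have [] := HF _ _ yu Aa.
Qed.

(* The weight [expR (- 2 n L s)] decreases fast enough to absorb the Lipschitz error
   made when the dynamics is evaluated at [z] instead of along the trajectory. *)
Lemma penalty_step (c rho L F e k0 s h : R) x al z :
  let y := traj x al in let th u := expR (- (2 * (n%:R * L) * u)) in
  bounds_on_ball rho L F -> controls A al -> 0 <= s -> 0 <= h -> 0 <= e -> `|c| <= 1 ->
  0 <= k0 -> `|z| <= rho -> (forall u, s <= u <= s + h -> `|y u| <= rho) ->
  (forall u, s < u < s + h ->
     2 * (e * th s) * dotp (y s - z) (f z (al u)) <= c * l z (al u) + k0) ->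
  e * th (s + h) * sq (y (s + h) - z) <=
    e * th s * sq (y s - z) + c * itg (running x al) s (s + h) +
    (k0 + L * `|y s - z|) * h +
    (L * F + 2 * e * (n%:R * L) * (2 * rho) * F + e * n%:R * F ^+ 2 + 2 * (n%:R * L) * F) * h ^+ 2.
Proof.
(* The sign c is 1 for subsolutions and -1 for supersolutions; k0 is the slack left in the viscosity
   inequality. *)
move=> y th bb ca s0 h0 e0 c1 k00 zr yr H.
have [L0 F0 HL HF] := bb.
have L0' := ltW L0; have F0' := ltW F0.
set v := y s - z; set La := n%:R * L.
have La0 : 0 <= La by rewrite mulr_ge0// ltW.
have sh : s <= s + h by rewrite lerDl.
have th0 u : 0 < th u by exact: expR_gt0.
have ths : th s <= 1 by rewrite -expR0 ler_expR oppr_le0 !mulr_ge0// ltW.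
have thE : th (s + h) = th s * expR (- (2 * La * h)).
  by rewrite /th -expRD; congr expR; rewrite /La; ring.
have q1 : expR (- (2 * La * h)) <= 1 by rewrite -expR0 ler_expR oppr_le0 !mulr_ge0//.
have q2 : 1 - 2 * La * h <= expR (- (2 * La * h)) by have := expR_ge1Dx (- (2 * La * h)).
(* The decay of th over the step pays for the term in 2 La h |v|^2 that the Lipschitz error of f
   produces. *)
have q3 : th (s + h) * (1 + 2 * La * h) <= th s.
  rewrite thE -mulrA -[leRHS]mulr1 ler_pM2l// expRN mulrC ler_pdivrMr ?expR_gt0//.
  by rewrite mul1r; exact: expR_ge1Dx.
set q := expR (- (2 * La * h)) in thE q1 q2.
have q0 : 0 < q by exact: expR_gt0.
have sr : s <= s <= s + h by rewrite lexx.
have vr : `|v| <= 2 * rho.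
  by rewrite (le_trans (ler_normB _ _))// mulrDl mul1r lerD// yr.
have rho0 : 0 <= rho by exact: le_trans zr.
have D2 : `|v| ^+ 2 <= sq v by exact: sqr_norm_le_dotp.
have lr := lbm_l dyn (trajectoryP dyn x ca).1 ca.
(* The rate of error from having l and f at z instead of y u, where |y u - z| <= |v| + F h. *)
pose K := k0 + L * (`|v| + F * h) + 2 * (e * th s) * (La * `|v| * (`|v| + F * h)).
have K0 : 0 <= K.
  have t0' := ltW (th0 s).
  by rewrite /K !addr_ge0 ?mulr_ge0 ?addr_ge0 ?mulr_ge0.
have h1 : 2 * (e * th s) * dotp v (y (s + h) - y s) <= c * itg (running x al) s (s + h) + K * h.
  rewrite trajectory_incr_dotp// -itgZ//; last exact: lbm_dotp_f.
  rewrite -itgZ// (_ : K * h = itg (fun=> K) s (s + h)); last first.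
    by rewrite itg_cst// addrAC subrr add0r.
  rewrite -itgD//; [|exact: lbmZ|exact: lbm_cst].
  apply: itg_le => //.
  - by apply: lbmZ; exact: lbm_dotp_f.
  - by apply: lbmD; [exact: lbmZ | exact: lbm_cst].
  move=> u /andP[su us].
  have Aa : A (al u) by apply: ca.1; rewrite (le_trans s0)// ltW.
  have yu : `|y u| <= rho by rewrite yr// !ltW.
  have yus : `|y u - y s| <= F * h.
    have := @trajectory_incr_norm x al rho L F s u bb ca s0 (ltW su).
    move=> /(_ _)/le_trans; apply.
      by move=> u' /andP[? ?]; apply: yr; apply/andP; split=> //; rewrite (le_trans (y := u))// ltW.
    by rewrite ler_pM2l// lerBlDl ltW.
  have yuz : `|y u - z| <= `|v| + F * h.
    rewrite (_ : y u - z = v + (y u - y s)); last by rewrite /v [RHS]addrC addrA subrK.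
    by rewrite (le_trans (ler_normD _ _))// lerD2l.
  have [Hf Hl] := HL (y u) z (al u) yu zr Aa.
  have := H u; rewrite su us => /(_ isT) Hz.
  have d1 : dotp v (f (y u) (al u)) <= dotp v (f z (al u)) + La * `|v| * (`|v| + F * h).
    rewrite -lerBlDl -dotpNr -dotpDr; apply: (le_trans (ler_norm _)).
    rewrite (le_trans (dotp_norm _ _))// /La -!mulrA ler_wpM2l//.
    rewrite (mulrCA L) ler_wpM2l// (le_trans Hf)// ler_pM2l//.
  have l1 : c * l z (al u) <= c * l (y u) (al u) + L * (`|v| + F * h).
    rewrite -lerBlDl -mulrBr; apply: (le_trans (ler_norm _)); rewrite normrM.
    rewrite (le_trans (y := 1 * `|l z (al u) - l (y u) (al u)|))//.
      by rewrite ler_wpM2r.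
    by rewrite mul1r distrC (le_trans Hl)// ler_pM2l.
  have et : 0 <= 2 * (e * th s) by rewrite !mulr_ge0// ltW.
  move: (ler_wpM2l et d1) Hz l1; rewrite mulrDr /K -/v.
  move: (2 * (e * th s)) (dotp v _) (dotp v _) (c * _) (c * _) (L * _) (La * _ * _) => t' D1 D2' c1' c2' L' La'.
  by clear; lra.
have dE : sq (y (s + h) - z) = sq v + 2 * dotp v (y (s + h) - y s) + sq (y (s + h) - y s).
  rewrite (_ : y (s + h) - z = v + (y (s + h) - y s)); last by rewrite /v [RHS]addrC addrA subrK.
  exact: dotp_sqrD.
have dD : sq (y (s + h) - y s) <= n%:R * F ^+ 2 * h ^+ 2.
  have yss := @trajectory_incr_norm x al rho L F s (s + h) bb ca s0 sh yr.
  rewrite addrAC subrr add0r in yss.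
  apply: (le_trans (ler_norm _)); rewrite (le_trans (dotp_norm _ _))//.
  rewrite (_ : n%:R * F ^+ 2 * h ^+ 2 = n%:R * (F * h) * (F * h)); last by ring.
  by rewrite ler_pM ?mulr_ge0// ler_wpM2l.
have Jb : `|c * itg (running x al) s (s + h)| <= F * h.
  rewrite normrM (le_trans (y := 1 * (F * h)))// ?mul1r//.
  rewrite -[leRHS]mul1r ler_pM// (le_trans (itg_norm_cst (C := F) _ _ _ _))//.
    move=> u /andP[/ltW su /ltW us].
    have Aa : A (al u) by apply: ca.1; exact: le_trans su.
    have yu : `|y u| <= rho by rewrite yr// su.
    by have [] := HF _ _ yu Aa.
  by rewrite addrAC subrr add0r.
set J := c * itg _ _ _ in h1 Jb *.
have a1 : e * th (s + h) * (2 * dotp v (y (s + h) - y s)) <= q * (J + K * h).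
  rewrite thE (_ : _ * _ = q * (2 * (e * th s) * dotp v (y (s + h) - y s))); last by ring.
  by rewrite ler_pM2l.
have a2 : q * J <= J + 2 * La * h * (F * h).
  rewrite -lerBlDl -{2}(mul1r J) -mulrBl.
  apply: (le_trans (ler_norm _)); rewrite normrM ler_pM//.
  by rewrite distrC ger0_norm; lra.
have a3 : q * (K * h) <= (k0 + L * (`|v| + F * h)) * h +
    e * th (s + h) * (2 * La * h) * sq v + 2 * e * La * (2 * rho) * F * h ^+ 2.
  have b1 : q * ((k0 + L * (`|v| + F * h)) * h) <= (k0 + L * (`|v| + F * h)) * h.
    apply: ler_piMl => //; rewrite mulr_ge0// addr_ge0// mulr_ge0 ?(ltW L0)// addr_ge0// mulr_ge0 ?(ltW F0)//.
  have b2 : q * (2 * (e * th s) * (La * `|v| * (`|v| + F * h)) * h) =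
    e * th (s + h) * (2 * La * h) * `|v| ^+ 2 + th (s + h) * (2 * e * La * `|v| * F * h ^+ 2).
    by rewrite thE; ring.
  have b3 : e * th (s + h) * (2 * La * h) * `|v| ^+ 2 <= e * th (s + h) * (2 * La * h) * sq v.
    by rewrite ler_wpM2l// !mulr_ge0// ltW.
  have b4 : th (s + h) * (2 * e * La * `|v| * F * h ^+ 2) <= 2 * e * La * (2 * rho) * F * h ^+ 2.
    apply: (@le_trans _ _ (2 * e * La * `|v| * F * h ^+ 2)).
      apply: ler_piMl; first by rewrite !mulr_ge0 ?sqr_ge0 ?(ltW F0).
      by rewrite (le_trans _ ths)// thE ler_piMr// ltW.
    by rewrite ler_wpM2r ?sqr_ge0// ler_wpM2r ?(ltW F0)// ler_wpM2l// !mulr_ge0.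
  by rewrite /K mulrDl mulrDr b2 -addrA lerD// lerD.
have a4 : e * th (s + h) * (1 + 2 * La * h) * sq v <= e * th s * sq v.
  by rewrite ler_wpM2r ?dotp_ge0// -mulrA ler_wpM2l.
have a5 : e * th (s + h) * sq (y (s + h) - y s) <= e * n%:R * F ^+ 2 * h ^+ 2.
  apply: (@le_trans _ _ (e * (n%:R * F ^+ 2 * h ^+ 2))); last by rewrite !mulrA.
  rewrite -mulrA ler_wpM2l// (le_trans (y := 1 * sq (y (s + h) - y s)))//.
    by rewrite ler_wpM2r ?dotp_ge0// (le_trans _ ths)// thE ler_piMr// ltW.
  by rewrite mul1r.
rewrite dE -/La; move: a1 a2 a3 a4 a5.
move: (th (s + h)) (th s) (dotp v v) (dotp v _) (dotp _ _) (q) (K) (J) `|v| (La) => t' t D dv dd q' K' J' nv La'.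
clear; lra.
Qed.

Local Notation H := (hamiltonian f l A).

Lemma hamiltonian_le0 x p a : (H x p <= 0)%E -> A a -> - dotp p (f x a) <= l x a.
Proof.
move=> Hp Aa; rewrite -subr_le0 -lee_fin; apply: le_trans Hp.
by apply: ereal_sup_ubound; exists a.
Qed.

Lemma hamiltonian_ge0 x p (k : R) : (0 <= H x p)%E -> 0 < k ->
  exists2 a, A a & dotp p (f x a) + l x a <= k.
Proof.
move=> Hp k0; have : ((- k)%:E < H x p)%E by apply: lt_le_trans Hp; rewrite lte_fin oppr_lt0.
move=> /ereal_sup_gt[_ [a Aa <-]]; rewrite lte_fin => h; exists a => //; lra.
Qed.

Lemma visc_subsol_penalty (O : set 'rV[R]_n) (w : 'rV[R]_n -> \bar R) (k : R) y z a :
  visc_subsol H O w -> O z -> w z \is a fin_num -> A a ->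
  (\forall z' \near z, w z' - (penalty k y z')%:E <= w z - (penalty k y z)%:E)%E ->
  2 * k * dotp (y - z) (f z a) <= l z a.
Proof.
move=> sub Oz wz Aa mx.
have := sub (penalty k y) z (@penalty_C1 _ _ O k y) Oz wz mx.
move=> /hamiltonian_le0/(_ Aa); rewrite grad_penalty dotpZl; apply: le_trans.
by rewrite -mulrN -dotpNl opprB.
Qed.

Lemma visc_supersol_penalty (O : set 'rV[R]_n) (w : 'rV[R]_n -> \bar R) (k k0 : R) y z :
  visc_supersol H O w -> O z -> w z \is a fin_num -> 0 < k0 ->
  (\forall z' \near z, w z + (penalty k y z)%:E <= w z' + (penalty k y z')%:E)%E ->
  exists2 a, A a & 2 * k * dotp (y - z) (f z a) <= -1 * l z a + k0.
Proof.
move=> sup Oz wz k00 mn.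
(* A minimum of w + [penalty k y] means that w is touched from below by [penalty (- k) y]. *)
have pN v : penalty (- k) y v = - penalty k y v by rewrite /penalty mulNr.
have Hp : (0 <= H z (grad (penalty (- k) y) z))%E.
  apply: sup => //; first exact: penalty_C1.
  by apply: filterS mn => z'; rewrite !pN !EFinN !oppeK.
have [a Aa b] := hamiltonian_ge0 Hp k00; exists a => //.
by move: b; rewrite grad_penalty dotpZl -(opprB y z) dotpNl => b; lra.
Qed.

(** The maximum over z of w z - e th(s) |y s - z|^2, plus the cost paid so far, decreases along the
    arc by at most a small drift and O(h^2) per step: the maximizer at time s is a competitor at
    time s + h, and the subsolution inequality holds at it. For large e the maximizers approach the
    arc, and upper semicontinuity of w at the end point concludes. *)
Lemma suboptimality_local (O : set 'rV[R]_n) (w : 'rV[R]_n -> \bar R) x0 :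
  (forall x a, A a -> 0 <= l x a) ->
  open O -> (forall z, O z -> w z \is a fin_num) -> (forall z, O z -> 0 <= w z)%E ->
  (forall z, O z -> forall c : R, (w z < c%:E)%E -> \forall z' \near z, (w z' < c%:E)%E) ->
  visc_subsol H O w -> O x0 ->
  exists2 r : R, 0 < r & forall x al t, controls A al -> 0 <= t ->
    (forall s, 0 <= s <= t -> `|traj x al s - x0| < r) ->
    (w x <= (itg (running x al) 0 t)%:E + w (traj x al t))%E.
Proof.
move=> l0 oO wfin w0 usc sub Ox0.
pose W := fine (w x0) + 1.
have wx0 : (w x0 < W%:E)%E by rewrite /W EFinD fineK ?wfin// lteDl ?wfin// lte_fin.
(* The arc stays within r of x0 while maximizers are sought within 2 r: one that is closer than r to
   the arc is interior, hence a local maximizer. *)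
have [r r0 Hr] : exists2 r : R, 0 < r & forall z, `|z - x0| <= 2 * r -> O z /\ (w z < W%:E)%E.
  have /nbhs_ballP[d /= d0 Hd] : nbhs x0 (O `&` [set z | (w z < W%:E)%E]).
    by apply: filterI; [exact: open_nbhs_nbhs | exact: usc].
  exists (d / 4); first exact: divr_gt0.
  move=> z zx; apply: Hd; rewrite mx_norm_ball /ball_/= distrC; lra.
exists r => // x al t ca t0 Hy; set y := traj x al in Hy *.
have yx : y 0 = x by exact: trajectory0 (trajectoryP dyn x ca).
have inO z : `|z - x0| <= 2 * r -> O z by move=> /Hr[].
have leW z : `|z - x0| <= 2 * r -> fine (w z) <= W.
  by move=> /Hr[Oz wz]; rewrite -lee_fin fineK ?wfin// ltW.
have wB z : `|z - x0| <= 2 * r -> w z \is a fin_num by move=> /inO; exact: wfin.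
have ge0 z : `|z - x0| <= 2 * r -> 0 <= fine (w z).
  by move=> /inO Oz; rewrite fine_ge0// w0.
pose B2 : set 'rV[R]_n := [set z | `|z - x0| <= 2 * r].
have cB : compact B2.
  apply: (@subclosed_compact _ _ [set z : 'rV[R]_n | `|z| <= `|x0| + 2 * r]).
  - have -> : B2 = (fun z => `|z - x0|) @^-1` [set c : R | c <= 2 * r] by [].
    apply: closed_comp => [z _|]; last exact: closed_le.
    apply: (@continuous_comp _ _ _ (fun z : 'rV[R]_n => z - x0) (fun z => `|z|)); last exact: norm_continuous.
    by have := @continuous_affine_rV R n 1 x0 z; under [X in continuous_at _ X]eq_fun do rewrite scale1r.
  - exact: closed_ball_compact.
  - by move=> z /=; rewrite -{2}(subrK x0 z) => h; rewrite (le_trans (ler_normD _ _))// addrC lerD2l.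
have yB s : 0 <= s <= t -> B2 (y s).
  by move=> st; rewrite /B2/= (le_trans (ltW (Hy s st)))// mulrDl mul1r lerDl ltW.
pose rho := `|x0| + 2 * r.
have rho0 : 0 < rho by rewrite /rho ltr_wpDl// mulr_gt0.
have Brho z : B2 z -> `|z| <= rho.
  by move=> /= h; rewrite -(subrK x0 z) (le_trans (ler_normD _ _))// addrC lerD2l.
have [L [F bb]] := bounds_on_ball_exist rho0; have [L0 F0 _ _] := bb.
pose th (u : R) := expR (- (2 * (n%:R * L) * u)).
have th0 u : 0 < th u by exact: expR_gt0.
have lal := lbm_l dyn (trajectoryP dyn x ca).1 ca.
pose J s := itg (running x al) 0 s.
have W0 : 0 < W.
  by rewrite /W ltr_wpDl// ge0// subrr normr0 mulr_ge0// ltW.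
(* With penalty parameter [e] the maximizers stay within [eta] of the trajectory *)
have main (eta : R) : 0 < eta -> eta < r ->
    exists2 z, `|y t - z| <= eta & fine (w x) <= fine (w z) + J t + L * eta * t + eta.
  move=> eta0 etar.
  (* Since 0 <= w <= W on the ball, a penalty above W loses against z = y s; th t is the least
     weight on [0, t]. *)
  have [e e0 eE] : exists2 e : R, 0 < e & e * th t * eta ^+ 2 = W.
    exists (W / (th t * eta ^+ 2)); first by rewrite divr_gt0// mulr_gt0// exprn_gt0.
    by field; rewrite !gt_eqF// th0.
  have maxz s : 0 <= s <= t -> exists z, [/\ B2 z, `|y s - z| <= eta &
      forall z', B2 z' -> fine (w z') - e * th s * dotp (y s - z') (y s - z') <=
                          fine (w z) - e * th s * dotp (y s - z) (y s - z)].
    move=> st; have /andP[s0 s1] := st.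
    have pE z : dotp (y s - z) (y s - z) = dotp (z - y s) (z - y s).
      by rewrite -opprB dotpNl dotpNr opprK.
    have penE z : penalty (e * th s) (y s) z = e * th s * dotp (y s - z) (y s - z).
      by rewrite /penalty pE.
    have eth : 0 < e * th s by rewrite mulr_gt0.
    have wE z : B2 z -> (- w z + (penalty (e * th s) (y s) z)%:E)%E =
        (- fine (w z) + e * th s * dotp (y s - z) (y s - z))%:E.
      by move=> Bz; rewrite penE EFinD EFinN fineK// wB//.
    have [|||z Bz Hz] := @lsc_attains R n B2
      (fun z => - w z + (penalty (e * th s) (y s) z)%:E)%E (- W) cB.
    - by exists (y s); exact: yB.
    - move=> z Bz; rewrite wE// lee_fin -[leLHS]addr0 lerD// ?lerN2 ?leW//.
      by rewrite mulr_ge0 ?dotp_ge0// ltW.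
    - move=> z Bz c; apply: lsc_add_penalty => c' c'w.
      have := usc z (inO z Bz) (- c'); rewrite EFinN lteNr => /(_ c'w).
      by apply: filterS => z'; rewrite lteNr.
    have Hz' z' : B2 z' -> fine (w z') - e * th s * dotp (y s - z') (y s - z') <=
                          fine (w z) - e * th s * dotp (y s - z) (y s - z).
      by move=> Bz'; have := Hz z' Bz'; rewrite !wE// lee_fin; lra.
    exists z; split=> //.
    have := Hz' _ (yB s st); rewrite subrr dotp0l mulr0 subr0 => h1.
    have h2 : e * th s * dotp (y s - z) (y s - z) <= W.
      have := ge0 _ (yB s st); have := leW z Bz; lra.
    have ths : th t <= th s.
      rewrite ler_expR lerN2 ler_wpM2l// !mulr_ge0// ltW//.
    have h3 : e * th t * `|y s - z| ^+ 2 <= e * th t * eta ^+ 2.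
      rewrite eE; apply: le_trans h2; rewrite ler_pM ?sqr_norm_le_dotp ?sqr_ge0//.
        by rewrite mulr_ge0 ?(ltW e0) ?ltW.
      by rewrite ler_pM2l.
    have ett : 0 < e * th t by apply: mulr_gt0.
    move: h3; rewrite ler_pM2l// => h3.
    by rewrite -(@ler_pXn2r _ 2)// ?nnegrE// ltW.
  pose C := L * F + 2 * e * (n%:R * L) * (2 * rho) * F + e * n%:R * F ^+ 2 + 2 * (n%:R * L) * F.
  have C0 : 0 <= C.
    have L0' := ltW L0; have F0' := ltW F0; have e0' := ltW e0; have r0' := ltW rho0.
    by rewrite /C !addr_ge0 ?mulr_ge0 ?sqr_ge0 ?ler0n.
  pose P s g := exists2 z, B2 z &
    g <= fine (w z) - e * th s * dotp (y s - z) (y s - z) + J s + L * eta * s.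
  have monoP s g g' : g' <= g -> P s g -> P s g'.
    by move=> gg [z Bz Hz]; exists z => //; exact: le_trans Hz.
  have stepP s s' g : 0 <= s -> s <= s' -> s' <= t -> P s g -> P s' (g - C * (s' - s) ^+ 2).
    move=> s0 ss' s't [z0 Bz0 Hz0].
    have st : 0 <= s <= t by rewrite s0 (le_trans ss').
    have [z [Bz yz Hz]] := maxz s st.
    exists z => //.
    have Ha a : A a -> 2 * (e * th s) * dotp (y s - z) (f z a) <= l z a.
      move=> Aa; apply: (visc_subsol_penalty sub) => //; [exact: inO|exact: wB|].
      have zx : `|z - x0| < 2 * r.
        rewrite -(subrK (y s) z) -addrA (le_lt_trans (ler_normD _ _))//.
        by rewrite mulrDl mul1r ltrD ?Hy// distrC (le_lt_trans yz).
      apply/nbhs_ballP; exists (2 * r - `|z - x0|); first by rewrite /= subr_gt0.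
      move=> z'; rewrite mx_norm_ball /ball_/= => zz'.
      have Bz' : B2 z'.
        rewrite /B2/= -(subrK z z') -addrA (le_trans (ler_normD _ _))//.
        by rewrite distrC -lerBrDr ltW.
      have pE v : penalty (e * th s) (y s) v = e * th s * dotp (y s - v) (y s - v).
        by rewrite /penalty -opprB dotpNl dotpNr opprK.
      have := Hz z' Bz'; rewrite -lee_fin !EFinB !fineK ?wB// !pE; exact.
    have h0 : 0 <= s' - s by rewrite subr_ge0.
    have hE : s + (s' - s) = s' by rewrite subrKC.
    have yr u : s <= u <= s + (s' - s) -> `|y u| <= rho.
      rewrite hE => /andP[su us]; apply: Brho; apply: yB.
      by rewrite (le_trans s0 su) (le_trans us).
    have n1 : `|1 : R| <= 1 by rewrite normr1.
    have Hu u : s < u < s + (s' - s) ->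
        2 * (e * th s) * dotp (y s - z) (f z (al u)) <= 1 * l z (al u) + 0.
      by move=> /andP[su _]; rewrite mul1r addr0; apply: Ha; apply: ca.1; rewrite (le_trans s0)// ltW.
    have := penalty_step bb ca s0 h0 (ltW e0) n1 (lexx _) (Brho _ Bz) yr Hu.
    rewrite hE.
    rewrite -/y -/(th s) -/(th s') -/C mul1r add0r => h1.
    have h2 : L * `|y s - z| * (s' - s) <= L * eta * (s' - s).
      by rewrite ler_wpM2r// ler_pM2l.
    have h3 : J s' = J s + itg (running x al) s s' by rewrite /J (itg_cat (b := s)).
    have := Hz z0 Bz0; rewrite h3 -/y; lra.
  have P0 : P 0 (fine (w x)).
    exists x; first by rewrite -yx; apply: yB; rewrite lexx.
    by rewrite yx subrr dotp0l /J itg_same !mulr0 subr0 !addr0.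
  have [z1 Bz1 Hz1] := time_stepping C0 t0 monoP stepP eta0 P0.
  have tt : 0 <= t <= t by rewrite t0 lexx.
  have [z [Bz yz Hz]] := maxz t tt.
  exists z => //; have := Hz z1 Bz1.
  have : 0 <= e * th t * dotp (y t - z) (y t - z).
    by rewrite mulr_ge0 ?dotp_ge0// mulr_ge0 ?(ltW e0) ?ltW.
  lra.
have tt : 0 <= t <= t by rewrite t0 lexx.
have Ot : O (y t) by apply: inO; exact: yB.
have Ox : O x by rewrite -yx; apply: inO; apply: yB; rewrite lexx.
rewrite -(fineK (wfin _ Ox)) -(fineK (wfin _ Ot)) -EFinD lee_fin -/(J t).
apply/ler_addgt0Pr => d d0.
have [d1 /= d10 Hd1] : exists2 d1 : R, 0 < d1 & forall z, `|y t - z| < d1 ->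
    (w z < (fine (w (y t)) + d / 2)%:E)%E.
  have /nbhs_ballP[d1 /= d10 Hd1] : \forall z \near y t, (w z < (fine (w (y t)) + d / 2)%:E)%E.
    by apply: usc => //; rewrite EFinD fineK ?wfin// lteDl ?wfin// lte_fin divr_gt0.
  by exists d1 => // z zd; apply: Hd1; rewrite mx_norm_ball.
have Lt0 : 0 < 2 * (L * t + 1) by rewrite mulr_gt0// ltr_wpDl// mulr_ge0// ltW.
(* Below r as [main] requires, below the radius of upper semicontinuity at y t, and such that L eta
   t + eta <= d / 2. *)
pose eta := Num.min (r / 2) (Num.min (d1 / 2) (d / (2 * (L * t + 1)))).
have eta0 : 0 < eta by rewrite !lt_min !divr_gt0.
have etar : eta < r by rewrite gt_min; apply/orP; left; lra.
have etad : eta < d1 by rewrite !gt_min; apply/orP; right; apply/orP; left; lra.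
have etaL : (2 * (L * t + 1)) * eta <= d.
  by rewrite mulrC -ler_pdivlMr// !ge_min lexx !orbT.
have [z yz Hz] := main eta eta0 etar.
have := Hd1 z (le_lt_trans yz etad).
have Oz : O z.
  apply: inO; rewrite -(subrK (y t) z) -addrA (le_trans (ler_normD _ _))//.
  rewrite mulrDl mul1r lerD//; last by rewrite ltW// Hy.
  by rewrite distrC (le_trans yz)// ltW.
rewrite -(fineK (wfin _ Oz)) lte_fin; lra.
Qed.

End PenaltyStep.

(** * Superoptimality of supersolutions by an Euler scheme *)

Section Superoptimality.
Context {R : realType} {n m : nat}.
Variables (A : set 'rV[R]_m) (f : 'rV[R]_n -> 'rV[R]_m -> 'rV[R]_n)
  (l : 'rV[R]_n -> 'rV[R]_m -> R) (T : set 'rV[R]_n).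
Hypotheses (dyn : standing_dynamics A f l) (l_ge0 : forall x a, A a -> 0 <= l x a).
Implicit Types (x y z : 'rV[R]_n) (al : R -> 'rV[R]_m) (w : 'rV[R]_n -> \bar R).

Local Notation traj := (trajectory f).
Local Notation running x al := (fun s => l (traj x al s) (al s)).
Local Notation H := (hamiltonian f l A).

Definition lsc_everywhere w : Prop :=
  forall z (c : R), (c%:E < w z)%E -> \forall z' \near z, (c%:E < w z')%E.

Lemma closed_ball_at_compact y (r : R) : compact [set z : 'rV[R]_n | `|z - y| <= r].
Proof.
apply: (@subclosed_compact _ _ [set z : 'rV[R]_n | `|z| <= `|y| + r]).
- have -> : [set z | `|z - y| <= r] = (fun z => `|z - y|) @^-1` [set c : R | c <= r] by [].
  apply: closed_comp => [z _|]; last exact: closed_le.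
  apply: (@continuous_comp _ _ _ (fun z : 'rV[R]_n => z - y) (fun z => `|z|)); last exact: norm_continuous.
  by have := @continuous_affine_rV R n 1 y z; under [X in continuous_at _ X]eq_fun do rewrite scale1r.
- exact: closed_ball_compact.
- by move=> z /=; rewrite -{2}(subrK y z) => h; rewrite (le_trans (ler_normD _ _))// addrC lerD2l.
Qed.

(** Every point at level at most W lies strictly inside the ball of radius eta, by nonnegativity of
    w. The minimum over the closed ball is therefore interior, hence local. *)
Lemma penalized_min w y z0 (k W eta : R) : lsc_everywhere w -> (forall z, (0 <= w z)%E) ->
  0 < k -> 0 < eta -> W < k * eta ^+ 2 ->
  (w z0 + (penalty k y z0)%:E <= W%:E)%E ->
  exists z, [/\ `|y - z| <= eta, w z \is a fin_num, (w z + (penalty k y z)%:E <= W%:E)%E &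
    \forall z' \near z, (w z + (penalty k y z)%:E <= w z' + (penalty k y z')%:E)%E].
Proof.
move=> lw w0 k0 eta0 Wk Hz0.
have near_of z : (w z + (penalty k y z)%:E <= W%:E)%E -> `|z - y| < eta.
  move=> Hz; have : ((penalty k y z)%:E <= W%:E)%E.
    by apply: le_trans Hz; rewrite leeDr.
  rewrite lee_fin => /le_lt_trans/(_ Wk) h.
  rewrite -(@ltr_pXn2r _ 2)// ?nnegrE// ?(ltW eta0)// -(ltr_pM2l k0).
  by apply: le_lt_trans h; rewrite ler_pM2l// sqr_norm_le_dotp.
pose K : set 'rV[R]_n := [set z | `|z - y| <= eta].
have [||||z Kz Hz] := @lsc_attains R n K (fun z => w z + (penalty k y z)%:E)%E 0.
- exact: closed_ball_at_compact.
- by exists z0; have /ltW := near_of z0 Hz0.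
- move=> z _; rewrite adde_ge0// lee_fin /penalty mulr_ge0 ?dotp_ge0// ltW//.
- by move=> z Kz c; apply: lsc_add_penalty => c' c'w; exact: lw.
have zW : (w z + (penalty k y z)%:E <= W%:E)%E.
  have /ltW Kz0 := near_of z0 Hz0.
  by apply: le_trans Hz0; exact: Hz.
have zy := near_of z zW.
exists z; split => //; first by rewrite distrC ltW.
- by move: zW (w0 z); case: (w z) => [v||] //; rewrite addye// leye_eq.
- apply/nbhs_ballP; exists (eta - `|z - y|); first by rewrite /= subr_gt0.
  move=> z'; rewrite mx_norm_ball /ball_/= => zz'; apply: Hz.
  rewrite /K/= -(subrK z z') -addrA (le_trans (ler_normD _ _))//.
  by rewrite distrC -lerBrDr ltW.
Qed.

Lemma controls_cst a : A a -> controls A (fun=> a).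
Proof. by move=> Aa; split => // i; exact: measurable_cst. Qed.

Lemma trajectory_bounded x (t : R) : exists2 rho : R, 0 < rho &
  forall al s, controls A al -> 0 <= s <= t -> `|traj x al s| <= rho.
Proof.
have [M M0 HM] := norm_growth dyn.
exists (2 * (1 + `|x|) * expR (2 * M * t)).
  by rewrite mulr_gt0 ?expR_gt0// mulr_gt0// ltr_pwDl.
move=> al s ca /andP[s0 st].
have := trajectory_growth dyn M0 HM ca (trajectoryP dyn x ca) s0 => h.
apply: (@le_trans _ _ (1 + `|traj x al s|)); first by rewrite lerDr.
apply: (le_trans h); rewrite ler_wpM2l//.
by rewrite ler_expR ler_wpM2l// mulr_ge0// ltW.
Qed.

(* Explicit Euler scheme for the inf-convolution of [w]: at each step the control is
   frozen at a value given by the supersolution inequality at the current minimizer. *)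
Lemma superoptimality_euler w x (Wx eta0 del : R) :
  A !=set0 -> lsc_everywhere w -> (forall z, (0 <= w z)%E) ->
  visc_supersol H (~` T) w -> (w x <= Wx%:E)%E -> 0 < eta0 -> 0 < del ->
  (exists al t z, [/\ controls A al, 0 <= t <= 1, T z, `|traj x al t - z| <= eta0 &
     itg (running x al) 0 t <= Wx + del]) \/
  (exists al z, [/\ controls A al, `|traj x al 1 - z| <= eta0 &
     (w z + (itg (running x al) 0 1)%:E <= (Wx + del)%:E)%E]).
Proof.
move=> [a0 Aa0] lw w0 sup wx eta00 del0.
have [rho1 rho10 Hrho1] := trajectory_bounded x 1.
(* The additional 1 makes room for the minimizers, which are within eta <= 1 of the arc. *)
pose rho := rho1 + 1.
have rho0 : 0 < rho by rewrite /rho addr_gt0.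
have [L [F bb]] := bounds_on_ball_exist dyn rho0; have [L0 F0 _ _] := bb.
have L0' := ltW L0; have F0' := ltW F0; have rho0' := ltW rho0.
have Wx0 : 0 <= Wx by rewrite -lee_fin; apply: le_trans wx.
have [eta [eta_gt0 eta1 etae etak]] : exists eta : R,
    [/\ 0 < eta, eta <= 1, eta <= eta0 & (1 + L) * eta <= del / 2].
  have L1 : 0 < 1 + L by rewrite addr_gt0.
  exists (Num.min 1 (Num.min eta0 (del / 2 / (1 + L)))); split.
  - by rewrite !lt_min ltr01 eta00/= !divr_gt0.
  - by rewrite ge_min lexx.
  - by rewrite !ge_min lexx !orbT.
  - by rewrite mulrC -ler_pdivlMr// !ge_min lexx !orbT.
pose th (u : R) := expR (- (2 * (n%:R * L) * u)).
have th0 u : 0 < th u by exact: expR_gt0.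
have th1 u : 0 <= u -> u <= 1 -> th 1 <= th u <= 1.
  move=> u0 u1; apply/andP; split.
    by rewrite ler_expR lerN2 ler_wpM2l// !mulr_ge0.
  by rewrite -expR0 ler_expR oppr_le0 !mulr_ge0.
have [e e0 eE] : exists2 e : R, 0 < e & Wx + del < e * th 1 * eta ^+ 2.
  exists ((Wx + del + 1) / (th 1 * eta ^+ 2)).
    by rewrite divr_gt0 ?mulr_gt0 ?exprn_gt0// addr_gt0// ltr_wpDl.
  rewrite [ltRHS](_ : _ = Wx + del + 1) ?ltrDl//.
  by field; rewrite !gt_eqF// th0.
have e0' := ltW e0.
(* Error per unit time: eta for the nearly optimal choice of the control value, L eta for evaluating
   l at z. *)
pose kap := (1 + L) * eta.
have kap0 : 0 <= kap by rewrite mulr_ge0 ?addr_ge0// ltW.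
pose C := L * F + 2 * e * (n%:R * L) * (2 * rho) * F + e * n%:R * F ^+ 2 + 2 * (n%:R * L) * F.
have C0 : 0 <= C by rewrite /C !addr_ge0 ?mulr_ge0 ?sqr_ge0 ?ler0n.
pose reach := exists al t z, [/\ controls A al, 0 <= t <= 1, T z, `|traj x al t - z| <= eta0 &
     itg (running x al) 0 t <= Wx + del].
pose state s g := exists al z, controls A al /\
  (w z + (penalty (e * th s) (traj x al s) z + itg (running x al) 0 s - kap * s)%:E <= (- g)%:E)%E.
(* As [time_stepping] lowers g, minus g is the budget. A budget above Wx + del / 2, for which the
   minimizers would no longer be localized, falls under the first alternative; the final g excludes
   it. Once [reach] holds it persists. *)
pose P s (g : R) := [\/ g < - (Wx + del / 2), reach | state s g].
have monoP s g g' : g' <= g -> P s g -> P s g'.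
  move=> gg [h|h|[al [z [ca h]]]].
  - by apply: Or31; exact: le_lt_trans gg h.
  - exact: Or32.
  apply: Or33; exists al, z; split => //; apply: (le_trans h).
  by rewrite lee_fin lerN2.
have state_min s g : 0 <= s -> s <= 1 -> - (Wx + del / 2) <= g -> state s g ->
  exists al z, [/\ controls A al, `|traj x al s - z| <= eta, w z \is a fin_num,
    (w z + (penalty (e * th s) (traj x al s) z + itg (running x al) 0 s - kap * s)%:E <= (- g)%:E)%E &
    \forall z' \near z, (w z + (penalty (e * th s) (traj x al s) z)%:E <=
       w z' + (penalty (e * th s) (traj x al s) z')%:E)%E].
  move=> s0 s1 gW [al [z0 [ca Hz0]]].
  pose W := - g - itg (running x al) 0 s + kap * s.
  have WE z : (w z + (penalty (e * th s) (traj x al s) z + itg (running x al) 0 s - kap * s)%:E <= (- g)%:E)%E =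
     (w z + (penalty (e * th s) (traj x al s) z)%:E <= W%:E)%E.
    have := w0 z; case: (w z) => [v||] w0z; [|by rewrite !addye// !leye_eq|by rewrite leNgt ltNyr in w0z].
    by rewrite -!EFinD !lee_fin /W; apply/idP/idP => ?; lra.
  have J0 := itg_running_ge0 f l_ge0 x s ca (lexx 0).
  have ks : kap * s <= kap by rewrite ler_piMr.
  have kW : W < e * th s * eta ^+ 2.
    rewrite /W; apply: (@le_lt_trans _ _ (Wx + del)); first by rewrite -/kap in etak; lra.
    rewrite (lt_le_trans eE)// ler_wpM2r ?sqr_ge0// ler_wpM2l//.
    by have /andP[] := th1 s s0 s1.
  have eth : 0 < e * th s by rewrite mulr_gt0.
  move: (Hz0); rewrite WE => Hz0W.
  have [z [h1 h2 h3 h4]] := penalized_min lw w0 eth eta_gt0 kW Hz0W.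
  by exists al, z; split => //; rewrite WE.
have stepP s s' g : 0 <= s -> s <= s' -> s' <= 1 -> P s g -> P s' (g - C * (s' - s) ^+ 2).
  move=> s0 ss' s'1 Ps.
  have d0 : 0 <= C * (s' - s) ^+ 2 by rewrite mulr_ge0 ?sqr_ge0.
  have [gW|gW] := ltP g (- (Wx + del / 2)).
    by apply: Or31; lra.
  case: Ps => [h|h|Ps]; [by rewrite ltNge gW in h|exact: Or32|].
  have s1 : s <= 1 by exact: le_trans s'1.
  have [al [z [ca yz wz Hz mn]]] := state_min s g s0 s1 gW Ps.
  have J0 := itg_running_ge0 f l_ge0 x s ca (lexx 0).
  have ks : kap * s <= kap by rewrite ler_piMr.
  have pen0 : 0 <= penalty (e * th s) (traj x al s) z.
    by rewrite /penalty mulr_ge0 ?dotp_ge0// mulr_ge0 ?ltW.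
  have [Tz|nTz] := pselect (T z).
    apply: Or32; exists al, s, z; split=> //; first by rewrite s0.
      exact: le_trans etae.
    have := w0 z; move: Hz; rewrite -(fineK wz) -EFinD !lee_fin => h1 h2.
    rewrite -/kap in etak; lra.
  have eth : 0 < e * th s by rewrite mulr_gt0.
  have [a Aa Ha] := visc_supersol_penalty sup nTz wz eta_gt0 mn.
  apply: Or33; pose al' := concat s al (fun=> a).
  have ca' : controls A al' by apply: control_concat => //; exact: controls_cst.
  have yE u : 0 <= u <= s -> traj x al' u = traj x al u.
    by move=> us; apply: (trajectory_concat_before dyn) => //; exact: controls_cst.
  have ys : traj x al' s = traj x al s by rewrite yE// s0 lexx.
  exists al', z; split => //.
  have h0 : 0 <= s' - s by rewrite subr_ge0.
  have hE : s + (s' - s) = s' by rewrite subrKC.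
  have n1 : `|-1 : R| <= 1 by rewrite normrN normr1.
  have zr : `|z| <= rho.
    rewrite -(subrK (traj x al s) z) (le_trans (ler_normD _ _))// addrC lerD//.
      by rewrite Hrho1// s0.
    by rewrite distrC (le_trans yz).
  have yr u : s <= u <= s + (s' - s) -> `|traj x al' u| <= rho.
    rewrite hE => /andP[su us]; apply: (@le_trans _ _ rho1); last by rewrite lerDl.
    by rewrite Hrho1// (le_trans s0 su) (le_trans us).
  have Hu u : s < u < s + (s' - s) ->
      2 * (e * th s) * dotp (traj x al' s - z) (f z (al' u)) <= -1 * l z (al' u) + eta.
    by move=> /andP[su _]; rewrite /al' /concat ltNge (ltW su)/= -/al' ys.
  have := penalty_step dyn bb ca' s0 h0 e0' n1 (ltW eta_gt0) zr yr Hu.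
  rewrite hE ys -/(th s) -/(th s') -/C => h1.
  have h2 : (eta + L * `|traj x al s - z|) * (s' - s) <= kap * (s' - s).
    by rewrite ler_wpM2r// /kap mulrDl mul1r lerD2l ler_wpM2l.
  have pE k v u : penalty k v u = k * dotp (v - u) (v - u).
    by rewrite /penalty -opprB dotpNl dotpNr opprK.
  have J1 : itg (running x al') 0 s' = itg (running x al) 0 s + itg (running x al') s s'.
    rewrite (itg_cat (b := s))//; last exact: (lbm_running dyn x ca').
    congr (_ + _); apply: itg_ext => //; [exact: (lbm_running dyn x ca')|exact: (lbm_running dyn x ca)|].
    by move=> u /andP[/ltW u0 us]; rewrite yE ?u0 ?(ltW us)// /al' /concat us.
  move: Hz; rewrite -(fineK wz) -!EFinD !lee_fin !pE J1 => h3.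
  lra.
have P0 : P 0 (- Wx).
  apply: Or33; exists (fun=> a0), x; split; first exact: controls_cst.
  rewrite (trajectory0 (trajectoryP dyn x (controls_cst Aa0))) itg_same mulr0 subr0 addr0.
  by rewrite /penalty subrr dotp0l mulr0 adde0 opprK.
have del2 : 0 < del / 2 by rewrite divr_gt0.
have := time_stepping C0 ler01 monoP stepP del2 P0.
have WE : - (Wx + del / 2) = - Wx - del / 2 by rewrite opprD.
case=> [h|h|h]; [by rewrite WE ltxx in h|by left|right].
have gW : - (Wx + del / 2) <= - Wx - del / 2 by rewrite WE.
have [al [z [ca yz wz Hz _]]] := state_min _ _ ler01 (lexx 1) gW h.
exists al, z; split => //; first exact: le_trans etae.
have pen0 : 0 <= penalty (e * th 1) (traj x al 1) z.
  by rewrite /penalty mulr_ge0 ?dotp_ge0// mulr_ge0 ?ltW.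
move: Hz; rewrite -(fineK wz) -!EFinD !lee_fin => h1.
rewrite -/kap in etak; lra.
Qed.

End Superoptimality.

(** * Points close to the target *)

Section NearTarget.
Context {R : realType} {n : nat}.
Implicit Types (z b : 'rV[R]_n) (T : set 'rV[R]_n).

(** The first point of the segment that is in T cannot be interior to T, or slightly earlier points
    would be in T as well. *)
Lemma segment_meets_boundary T z z' : closed T -> ~ T z -> T z' ->
  exists2 b, boundary T b & `|z - b| <= `|z - z'|.
Proof.
move=> cT nTz Tz'.
pose p (t : R) := z + t *: (z' - z); pose D := `|z' - z|.
have D0 : 0 <= D by exact: normr_ge0.
have D1 : 0 < D + 1 by rewrite ltr_wpDl.
have pE s t : `|p s - p t| = `|s - t| * D.
  by rewrite /p opprD addrACA subrr add0r -scalerBl normrZ.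
pose S := [set t : R | 0 <= t <= 1 /\ T (p t)].
have S1 : S 1 by split; rewrite ?ler01 ?lexx// /p scale1r subrKC.
have lbS : has_inf S.
  by split; [exists 1 | exists 0 => t [/andP[]]].
pose t0 := inf S.
have t00 : 0 <= t0 by apply: lb_le_inf; [exists 1 | move=> t [/andP[]]].
have t01 : t0 <= 1 by apply: ge_inf => //; exact: lbS.2.
have close t (e : R) : `|t - t0| < e / (D + 1) -> `|p t0 - p t| < e.
  rewrite pE distrC ltr_pdivlMr// => h; apply: le_lt_trans h.
  by rewrite ler_wpM2l// lerDl.
have Tt0 : T (p t0).
  apply: contrapT => nT.
  have /nbhs_ballP[e /= e0 He] : nbhs (p t0) (~` T).
    by apply: open_nbhs_nbhs; split => //; exact: closed_openC.
  have ed0 : 0 < e / (D + 1) by exact: divr_gt0.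
  have [t St tt0] := inf_adherent ed0 lbS.
  have t0t : t0 <= t by apply: ge_inf => //; exact: lbS.2.
  apply: (He (p t)); last exact: St.2.
  by rewrite mx_norm_ball /ball_/=; apply: close; rewrite ger0_norm ?subr_ge0// ltrBlDl.
exists (p t0); last first.
  have -> : z - p t0 = (- t0) *: (z' - z).
    by apply/rowP => i; rewrite /p !mxE; ring.
  by rewrite normrZ normrN ger0_norm// distrC ler_piMl.
split; first exact: subset_closure.
move=> /nbhs_ballP[e /= e0 He].
have t0p : 0 < t0.
  rewrite lt_neqAle t00 andbT; apply/eqP => t0E; apply: nTz.
  by move: Tt0; rewrite -t0E /p scale0r addr0.
have ed0 : 0 < e / (D + 1) by exact: divr_gt0.
pose s := Num.max 0 (t0 - e / (D + 1) / 2).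
have st0 : s < t0 by rewrite gt_max t0p/=; lra.
have s0 : 0 <= s by rewrite le_max lexx.
have sd : t0 - s < e / (D + 1).
  have : t0 - e / (D + 1) / 2 <= s by rewrite le_max lexx orbT.
  lra.
have Ss : S s.
  split; first by rewrite s0/= ltW// (lt_le_trans st0).
  apply: He; rewrite mx_norm_ball /ball_/=; apply: close.
  by rewrite ltr0_norm ?subr_lt0// opprB.
by have := ge_inf lbS.2 Ss; rewrite leNgt st0.
Qed.

(** A point off T that is close to T is as close to the boundary, whose compactness makes the
    neighbourhoods given by the hypothesis uniform. *)
Lemma near_target T (Q : 'rV[R]_n -> Prop) : closed T -> compact (boundary T) ->
  (forall b, boundary T b -> \forall z \near b, Q z) ->
  exists2 r : R, 0 < r & forall z z', ~ T z -> T z' -> `|z - z'| < r -> Q z.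
Proof.
move=> cT cB HQ.
have nc : near_covering (boundary T) by apply/compact_near_coveringP.
have : \forall d \near (0 : R)^'+, boundary T `<=` (fun b => forall z, `|z - b| < d -> Q z).
  apply: nc => b Bb; have /nbhs_ballP[e /= e0 He] := HQ b Bb.
  exists (ball b (e / 2), [set d : R | d < e / 2]) => /=.
    split; first by apply/nbhs_ballP; exists (e / 2); rewrite //= divr_gt0.
    by apply: nbhs_right_lt; rewrite divr_gt0.
  move=> [b' d] [/= bb' de] z zb'; apply: He.
  move: bb'; rewrite mx_norm_ball /ball_/= => bb'.
  rewrite -(subrK b' b) -addrA (le_lt_trans (ler_normD _ _))//.
  by rewrite (splitr e) ltrD// distrC (lt_trans zb').
move=> Hd; have [d [d0 dB]] : exists d : R, 0 < d /\
    boundary T `<=` (fun b => forall z, `|z - b| < d -> Q z).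
  have [d dP] := filter_ex (filterI Hd (@nbhs_right_gt R 0)).
  by exists d; case: dP.
exists d => // z z' nTz Tz' zz'.
have [b Bb zb] := segment_meets_boundary cT nTz Tz'.
by apply: (dB b Bb); exact: le_lt_trans zz'.
Qed.

End NearTarget.

(** * Chains of controls over unit times *)

Section InfiniteConcatenation.
Context {R : realType} {n m : nat}.
Variables (A : set 'rV[R]_m) (f : 'rV[R]_n -> 'rV[R]_m -> 'rV[R]_n)
  (l : 'rV[R]_n -> 'rV[R]_m -> R) (T : set 'rV[R]_n).
Hypotheses (dyn : standing_dynamics A f l) (l_ge0 : forall x a, A a -> 0 <= l x a).
Implicit Types (x y z : 'rV[R]_n) (al : R -> 'rV[R]_m) (w : 'rV[R]_n -> \bar R).

Local Notation traj := (trajectory f).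
Local Notation running x al := (fun s => l (traj x al s) (al s)).
Local Notation Vm := (value_m f l A T).

Definition chain (als : nat -> R -> 'rV[R]_m) : R -> 'rV[R]_m :=
  fun t => als (Num.truncn t) (t - (Num.truncn t)%:R).

Lemma chainE (als : nat -> R -> 'rV[R]_m) (k : nat) (s : R) :
  0 <= s < 1 -> chain als (k%:R + s) = als k s.
Proof.
move=> /andP[s0 s1]; rewrite /chain (_ : Num.truncn (k%:R + s) = k).
  by rewrite addrC addKr.
by apply/truncn_def; rewrite lerDl s0/= -natr1 ltrD2l.
Qed.

Lemma controls_chain (als : nat -> R -> 'rV[R]_m) :
  (forall k, controls A (als k)) -> controls A (chain als).
Proof.
move=> H; split.
  move=> t t0; apply: (H _).1; rewrite subr_ge0.
  by have /andP[] := truncn_itv t0.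
move=> i.
have -> : (`[0, +oo[ : set R)%classic = \bigcup_k `[k%:R, k.+1%:R[%classic.
  apply/seteqP; split => t /=; rewrite in_itv/= ?andbT.
    by move=> t0; exists (Num.truncn t) => //=; rewrite in_itv/=; exact: truncn_itv.
  by move=> [k _] /=; rewrite in_itv/= => /andP[kt _]; apply: le_trans kt.
apply/measurable_fun_bigcup => // k.
have mi : measurable_fun [set: R] ((fun t => als k t 0 i) \_ `[0, +oo[).
  by apply/(measurable_restrictT _ _).1 => //; exact: (H k).2.
apply: (@eq_measurable_fun _ _ R R _ (fun t : R => ((fun t : R => als k t 0 i) \_ `[0, +oo[) (- (k%:R : R) + t))).
  move=> t; rewrite inE/= in_itv/= => /andP[kt tk].
  have s0 : 0 <= t - k%:R by rewrite subr_ge0.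
  rewrite [in LHS]addrC /= patchE mem_set//= ?in_itv/= ?andbT//.
  rewrite -[in RHS](subrKC k%:R t) chainE// s0/=.
  by rewrite ltrBlDl natr1.
by apply: measurable_funTS; apply: (measurableT_comp mi); exact: measurable_shift.
Qed.

(* Greedy choice with errors del / 2^(k+1): the surplus Vm - w never decreases to 0 along
   the chain, so the chain never stops and its concatenation has total cost w + del. *)
Lemma value_m_le_of_steps w :
  (forall z, (0 <= w z)%E) ->
  (forall x (Wx del : R), ~ T x -> (w x <= Wx%:E)%E -> 0 < del ->
     (Vm x <= (Wx + del)%:E)%E \/
     exists2 al, controls A al &
       (w (traj x al 1) + (itg (running x al) 0 1)%:E <= (Wx + del)%:E)%E) ->
  forall x, (Vm x <= w x)%E.
Proof.
move=> w0 Hstep x.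
have := w0 x; case Ewx : (w x) => [Wx||] // _; last by rewrite leey.
apply/lee_addgt0Pr => del del0; rewrite leNgt; apply/negP => Vx.
have dk0 (k : nat) : 0 < del / 2 ^+ k by rewrite divr_gt0// exprn_gt0.
have dk1 (k : nat) : del / 2 ^+ k = del / 2 ^+ k.+1 + del / 2 ^+ k.+1.
  by rewrite exprS invfM; field; rewrite expf_neq0.
(* After k arcs, [Vm] still exceeds the current bound c of w by more than del / 2^k; the next arc
   spends half of this margin. On T this is impossible, since [Vm] vanishes there. *)
pose good k x (c : R) := (w x <= c%:E)%E /\ ((c + del / 2 ^+ k)%:E < Vm x)%E.
have /choice[F HF] : forall q : nat * ('rV[R]_n * R), exists al, good q.1 q.2.1 q.2.2 ->
    controls A al /\ (w (traj q.2.1 al 1) + (itg (running q.2.1 al) 0 1)%:E <=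
      (q.2.2 + del / 2 ^+ q.1.+1)%:E)%E.
  move=> [k [x' c]] /=; have [[g1 g2]|ng] := pselect (good k x' c); last first.
    by exists (fun=> 0) => /ng.
  have c0 : 0 <= c by rewrite -lee_fin; apply: le_trans g1.
  have nT : ~ T x'.
    move=> Tx; move: g2; rewrite /value_m mem_set// lte_fin ltNge.
    by rewrite addr_ge0// ltW.
  have [h|[al ca h]] := Hstep x' c (del / 2 ^+ k.+1) nT g1 (dk0 _); last by exists al.
  exfalso; move: (lt_le_trans g2 h); rewrite lte_fin ltrD2l dk1.
  by rewrite ltNge lerDl (ltW (dk0 _)).
pose step k (q : 'rV[R]_n * R) : 'rV[R]_n * R :=
  let al := F (k, q) in
  (traj q.1 al 1, q.2 + del / 2 ^+ k.+1 - itg (running q.1 al) 0 1).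
pose Q := fix Q k := if k is k'.+1 then step k' (Q k') else (x, Wx).
pose als k := F (k, Q k).
have HQ k : good k (Q k).1 (Q k).2.
  elim: k => [|k IH].
    by split; rewrite /= ?Ewx// expr0 divr1 EFinD.
  have [ca h] := HF (k, Q k) IH; have [g1 g2] := IH.
  split => /=; first by rewrite EFinB leeBrDr.
  have := value_m_le_running T dyn l_ge0 (Q k).1 ca ler01.
  move=> /(lt_le_trans g2); rewrite -lteBlDl// -EFinB dk1; apply: le_lt_trans.
  by rewrite lee_fin; rewrite /=; lra.
have cas k : controls A (als k) by have [] := HF (k, Q k) (HQ k).
have cp := controls_chain cas; set al := chain als in cp.
have dE k s : 0 <= s < 1 -> al (k%:R + s) = als k s by exact: chainE.
have yk k : traj x al k%:R = (Q k).1.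
  elim: k => [|k IH]; first by rewrite (trajectory0 (trajectoryP dyn x cp)).
  rewrite -natr1 (trajectory_shift dyn)// IH /=.
  apply: (@trajectory_eq_control _ _ _ A f l dyn _ _ (als k) 1) => //.
  - exact: control_shift.
  - exact: dE.
  - by rewrite ler01 lexx.
have Jk k : itg (running x al) 0 k%:R = Wx - (Q k).2 + (del - del / 2 ^+ k).
  elim: k => [|k IH]; first by rewrite itg_same /= expr0 divr1 !subrr addr0.
  have lr := lbm_running dyn x cp.
  have kk : k%:R <= k.+1%:R :> R by rewrite ler_nat.
  rewrite (itg_cat (b := k%:R))// IH.
  have -> : itg (running x al) k%:R k.+1%:R = itg (running (Q k).1 (als k)) 0 1.
    have := itg_shift (k := running x al) 1 lr (ler0n _ k) (lexx 0).
    rewrite addr0 natr1 => <-.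
    apply: (itg_ext (lbm_shift lr (ler0n _ k)) (lbm_running dyn _ (cas k)) (lexx 0)).
    move=> s /andP[/ltW s0 s1]; rewrite dE ?s0// (trajectory_shift dyn)// yk.
    rewrite (@trajectory_eq_control _ _ _ A f l dyn _ _ (als k) 1)//.
    - exact: control_shift.
    - exact: dE.
    - by rewrite s0 ltW.
  by rewrite /= -/(als k) (dk1 k); ring.
have := value_m_le f T l_ge0 x cp; apply/negP; rewrite -ltNge.
apply: le_lt_trans Vx; rewrite costE -EFinD.
apply: running_cost_le; [exact: (lbm_running dyn x cp)|
  by move=> s s0; apply: l_ge0; exact: cp.1|exact: entry_time_ge0|].
move=> s s0 _; rewrite lee_fin.
have [k sk] : exists k : nat, s <= k%:R.
  by exists (Num.bound s); apply: ltW; exact: archi_boundP.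
apply: (@le_trans _ _ (itg (running x al) 0 k%:R)).
  rewrite (itg_cat (lbm_running dyn x cp) (lexx 0) s0 sk) lerDl.
  exact: (itg_running_ge0 f l_ge0).
rewrite Jk; have [g1 _] := HQ k.
have : 0 <= (Q k).2 by rewrite -lee_fin; apply: le_trans g1.
by have := ltW (dk0 k); lra.
Qed.

End InfiniteConcatenation.

(** * Closure of trajectories under convexity *)

Section LipschitzDensity.
Context {R : realType}.
Local Notation mu := (@lebesgue_measure R).

Let lipschitz_cumulative (F : R -> R) : Prop :=
  nondecreasing F /\ forall s t, `|F s - F t| <= `|s - t|.

Let stieltjes_of (F : R -> R) : lipschitz_cumulative F ->
  exists G : cumulative R R, G = F :> (R -> R).
Proof.
move=> [ndF lF].
have cF : right_continuous F.
  move=> s; apply: cvg_within_filter.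
  apply/(@cvgrPdist_le _ _ _ (nbhs s)) => e e0.
  apply/nbhs_ballP; exists e => //= t; rewrite /ball/= => st.
  exact: le_trans (lF _ _) (ltW st).
pose C := isCumulative.Build _ _ _ F ndF cF.
by exists (HB.pack_for (cumulative R R) F C).
Qed.

Lemma stieltjes_itv (G : cumulative R R) a b : a <= b ->
  lebesgue_stieltjes_measure G `]a, b]%classic = (G b - G a)%:E.
Proof.
move=> ab; rewrite /lebesgue_stieltjes_measure /measure_extension/=.
by rewrite measurable_mu_extE/= ?wlength_itv_bnd//; exact: is_ocitv.
Qed.

(* The densities of t + F and t - F: their Stieltjes measures add up to twice the Lebesgue
   measure, whence absolute continuity. *)
Let density_half (F : R -> R) : lipschitz_cumulative F ->
  lipschitz_cumulative (fun t => t - F t) ->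
  exists g : R -> R, [/\ measurable_fun [set: R] g,
    mu.-integrable [set: R] (EFin \o g),
    forall t, 0 <= t <= 1 -> F t = F 0 + Rintegral mu `[0, t] g
  & {ae mu, forall t : R, 0 < t < 1 -> is_derive t 1 F (g t)}].
Proof.
move=> lF lF'.
have [G GF] := stieltjes_of lF; have [G' GF'] := stieltjes_of lF'.
pose nu := lebesgue_stieltjes_measure G.
have nu_le A : measurable A -> (nu A <= mu A)%E.
  move=> mA; have -> : mu A = measure_add (lebesgue_stieltjes_measure G)
      (lebesgue_stieltjes_measure G') A.
    apply: lebesgue_measure_unique => // X [[a b] _ <-].
    transitivity (lebesgue_stieltjes_measure G `]a, b]%classic +
      lebesgue_stieltjes_measure G' `]a, b]%classic)%E; last exact/esym/measure_addE.
    rewrite /=; have [ab|ba] := leP a b; last first.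
      by rewrite set_itv_ge ?bnd_simp -?ltNge ?ltW//= ?measure0 ?adde0 // -leNgt ltW.
    rewrite [LHS](stieltjes_itv _ ab) !stieltjes_itv// -EFinD GF GF' /=.
    by congr EFin; ring.
  by rewrite measure_addE leeDl.
have m01 : measurable (`]0, 1]%classic : set (measurableTypeR R)) by exact: measurable_itv.
have fin01 : (nu `]0%R, 1%R]%classic < +oo)%E.
  by rewrite [X in (X < _)%E](stieltjes_itv G ler01) ltry.
(* Restriction to ]0, 1] makes the measure finite. *)
pose nu' : {finite_measure set (measurableTypeR R) -> \bar R} := mfrestr m01 fin01.
have dom : nu' `<< mu.
  apply/null_content_dominatesP => B mB muB; apply/eqP.
  rewrite eq_le measure_ge0 andbT /nu' /= /mfrestr /mrestr -muB.
  apply: le_trans (nu_le _ mB).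
  by apply: le_measure => //; rewrite ?inE//; exact: measurableI.
have [d [d0 dfin intd dE]] := radon_nikodym_sigma_finite dom.
pose g := fine \o d.
have dg : d = EFin \o g by apply/funext => t; rewrite /g/= fineK.
rewrite dg in intd dE.
have mg : measurable_fun setT g by apply/measurable_EFinP; case/integrableP: intd.
have FE t : 0 <= t <= 1 -> F t = F 0 + Rintegral mu `]0, t] g.
  move=> /andP[t0 t1]; rewrite /Rintegral -dE// /nu' /= /mfrestr /mrestr.
  rewrite setIidl; last by apply: subset_itvl; rewrite bnd_simp.
  by rewrite (stieltjes_itv G t0)/= GF; ring.
exists g; split => //.
  move=> t /FE ->; rewrite /Rintegral; congr (_ + fine _).
  by apply: integral_itv_obnd_cbnd => //; apply/measurable_EFinP; exact: measurable_funTS.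
have i0 y : mu.-integrable [set` Interval (BRight 0) (BRight y)] (EFin \o g).
  by apply: integrableS intd.
have loc : locally_integrable setT g by apply: open_integrable_locally; [exact: openT|exact: intd].
have := FTC1 i0 loc; apply: filterS; first exact: (ae_filter_ringOfSetsType mu).
move=> t Ht /andP[t0 t1].
have [|dt dte] := Ht; first exact: t0.
pose I := fun y => Rintegral mu `]0, y] g.
have FI : \forall y \near t, (cst (F 0) + I) y = F y.
  near=> y; rewrite [RHS]FE//; apply/andP; split; apply: ltW.
    by near: y; exact: lt_nbhsr.
  by near: y; exact: lt_nbhsl.
have dI : is_derive t 1 I (g t) by split => //; rewrite -derive1E.
have dc : is_derive t 1 (cst (F 0) + I) (g t) by rewrite -[g t]add0r; exact: is_deriveD.
split; first by apply: (near_eq_derivable FI); exact: (@ex_derive _ _ _ _ _ _ _ dc).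
by rewrite -(near_eq_derive _ FI); exact: (@derive_val _ _ _ _ _ _ _ dc).
Unshelve. all: by end_near. Qed.

(** For h = (t + F / L) / 2 both h and t - h are nondecreasing and 1-Lipschitz, as [density_half]
    requires; F = L (2 h - t) inherits the density linearly. *)
Lemma lipschitz_density (F : R -> R) (L : R) : 0 < L ->
  (forall s t, `|F s - F t| <= L * `|s - t|) ->
  exists g : R -> R, [/\ measurable_fun [set: R] g,
    forall b, mu.-integrable `[0, b] (EFin \o g),
    forall t, 0 <= t <= 1 -> F t = F 0 + Rintegral mu `[0, t] g
  & {ae mu, forall t : R, 0 < t < 1 -> is_derive t 1 F (g t)}].
Proof.
move=> L0 lF; pose h t := (t + F t / L) / 2.
have hh t : t - h t = (t - F t / L) / 2 by rewrite /h; field; rewrite gt_eqF.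
have lF' s t : `|F s / L - F t / L| <= `|s - t|.
  by rewrite -mulrBl normrM normfV (gtr0_norm L0) ler_pdivrMr// mulrC.
have lh s t : `|h s - h t| <= `|s - t|.
  rewrite /h -mulrBl normrM (ger0_norm (x := 2^-1)) ?invr_ge0// ler_pdivrMr//.
  rewrite opprD addrACA (le_trans (ler_normD _ _))// mulr_natr mulr2n.
  by rewrite lerD2l.
have lh' s t : `|s - h s - (t - h t)| <= `|s - t|.
  rewrite !hh -mulrBl normrM (ger0_norm (x := 2^-1)) ?invr_ge0// ler_pdivrMr//.
  rewrite (_ : _ - _ = (s - t) - (F s / L - F t / L)); last ring.
  by rewrite (le_trans (ler_normB _ _))// mulr_natr mulr2n lerD2l.
have nd (s t : R) : s <= t -> h s <= h t.
  move=> st; have := lF' t s; rewrite (ger0_norm (x := t - s)) ?subr_ge0//.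
  by rewrite ler_norml /h => /andP[a b]; rewrite ler_pM2r ?invr_gt0//; lra.
have nd' (s t : R) : s <= t -> s - h s <= t - h t.
  move=> st; have := lF' t s; rewrite (ger0_norm (x := t - s)) ?subr_ge0//.
  by rewrite ler_norml !hh => /andP[a b]; rewrite ler_pM2r ?invr_gt0//; lra.
have [g [mg ig gE gd]] := @density_half h (conj nd lh) (conj nd' lh').
have FE t : F t = L * (2 * h t - t) by rewrite /h; field; rewrite gt_eqF.
have Li b : mu.-integrable `[0, b] (EFin \o g) by apply: integrableS ig.
have i1 b : mu.-integrable `[0, b] (EFin \o cst 1%R).
  exact: (lbm_integrable b (lbm_cst 1) (lexx 0)).
have i2 b : mu.-integrable `[0, b] (EFin \o (fun s => 2 * g s)).
  have -> : EFin \o (fun s => 2 * g s) = (fun s => 2%:E * (EFin \o g) s)%E by [].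
  exact: integrableZl.
have i3 b : mu.-integrable `[0, b] (EFin \o (fun s => 2 * g s - 1)).
  have -> : EFin \o (fun s => 2 * g s - 1) =
    (fun s => (EFin \o (fun s => (2 * g s)%R)) s - (EFin \o cst 1%R) s)%E by [].
  by apply: integrableB; [|exact: i2|exact: i1].
exists (fun t => L * (2 * g t - 1)); split.
- by apply: measurable_funM => //; apply: measurable_funB => //; exact: measurable_funM.
- move=> b.
  have -> : EFin \o (fun s => L * (2 * g s - 1)) =
    (fun s => L%:E * (EFin \o (fun s => (2 * g s - 1)%R)) s)%E by [].
  by apply: integrableZl; [|exact: i3].
- move=> t t01; have /andP[t0 t1] := t01.
  rewrite FE (gE t)// (FE 0) RintegralZl; [|exact: measurable_itv|exact: i3].
  rewrite RintegralB; [|exact: measurable_itv|exact: i2|exact: i1].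
  rewrite RintegralZl; [|exact: measurable_itv|exact: Li].
  by have := itg_cst 1 t0; rewrite /itg => ->; ring.
- move: gd; apply: filterS; first exact: (ae_filter_ringOfSetsType mu).
  move=> t Ht /Ht dh.
  have -> : F = L \*: (2 \*: h - id) by apply/funext => s; rewrite FE.
  have -> : L * (2 * g t - 1) = L *: (2 *: g t - 1) by [].
  by apply: is_deriveZ; apply: is_deriveB.
Qed.

End LipschitzDensity.

(** * Measurable selection of zeros *)

Section MeasurableSelection.
Context {R : realType} {m : nat}.
Variables (A : set 'rV[R]_m) (D : set R).
Hypotheses (A_compact : compact A) (D_measurable : measurable D).
Implicit Types (B : set 'rV[R]_m) (psi : R -> 'rV[R]_m -> R).

(** For every rational box that meets B, one point of B in that box is chosen; the boxes are
    countably many. *)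
Lemma dense_sequence B : B !=set0 ->
  exists b : nat -> 'rV[R]_m, (forall k, B (b k)) /\
    forall a (e : R), B a -> 0 < e -> exists k, `|a - b k| < e.
Proof.
move=> [b0 Bb0].
have /choice[F HF] : forall q : 'rV[rat]_m * nat, exists b, B b /\
    ((exists2 b', B b' & forall i, `|b' 0 i - ratr (q.1 0 i)| < q.2.+1%:R^-1) ->
     forall i, `|b 0 i - ratr (q.1 0 i)| < q.2.+1%:R^-1).
  move=> q; have [[b' Bb' Hb']|nb] := pselect (exists2 b', B b' &
      forall i, `|b' 0 i - ratr (q.1 0 i)| < q.2.+1%:R^-1); first by exists b'.
  by exists b0.
exists (fun k => if unpickle k is Some q then F q else b0); split.
  by move=> k; case: unpickle => [q|//]; exact: (HF q).1.
move=> a e Ba e0; have [j je] : exists j : nat, j.+1%:R^-1 < e / 2.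
  exists (Num.bound (e / 2)^-1).
  rewrite invf_plt ?posrE ?divr_gt0//.
  by rewrite (lt_trans (archi_boundP _))// ?invr_ge0 ?divr_ge0 ?ltW// ltr_nat.
have j0 : 0 < j.+1%:R^-1 :> R by [].
have [q aq] := rV_rat_approx a j0.
exists (pickle (q, j)); rewrite pickleK.
have Fq := (HF (q, j)).2 (ex_intro2 _ (fun b' : 'rV[R]_m => forall i, `|b' 0 i - ratr (q 0 i)| < j.+1%:R^-1) a Ba aq).
apply: (@le_lt_trans _ _ (2 * j.+1%:R^-1)); last first.
  by rewrite mulrC -ltr_pdivlMr.
apply: rV_norm_le => [|i]; first by rewrite mulr_ge0.
rewrite coordB -(subrK (ratr (q 0 i)) (a 0 i)) -addrA (le_trans (ler_normD _ _))//.
rewrite [X in _ + X]distrC mulr2n mulrDl mul1r.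
by apply: lerD; apply: ltW; [exact: aq|exact: Fq].
Qed.

Definition caratheodory psi : Prop :=
  (forall a, A a -> measurable_fun D (psi^~ a)) /\
  (forall t, D t -> {within A, continuous (psi t)}).

Lemma within_continuousP (g : 'rV[R]_m -> R) : {within A, continuous g} ->
  forall a (e : R), A a -> 0 < e ->
  exists2 d : R, 0 < d & forall b, A b -> `|a - b| < d -> `|g a - g b| < e.
Proof.
move=> /subspace_continuousP cg a e Aa e0.
have FF : Filter (within A (nbhs a)) by exact: within_filter.
have /(@cvgrPdist_lt _ _ _ (within A (nbhs a)) FF)/(_ e e0) := cg a Aa.
move=> /nbhs_ballP[d /= d0 Hd]; exists d => // b Ab ab.
by apply: Hd => //; rewrite mx_norm_ball.
Qed.

(** On a compact set a nonnegative continuous function has a zero if and only if it takes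
    arbitrarily small values on a dense sequence, which is a countable condition. *)
Lemma exists_zero_measurable psi B : caratheodory psi -> B `<=` A -> compact B ->
  (forall t a, D t -> A a -> 0 <= psi t a) ->
  measurable (D `&` [set t | exists2 a, B a & psi t a = 0]).
Proof.
move=> [mpsi cpsi] BA cB psi0.
have [B0|/set0P nB] := eqVneq B set0.
  rewrite (_ : _ `&` _ = set0); first exact: measurable0.
  by apply/seteqP; split => // t [_ [a]]; rewrite B0.
have [b [Bb db]] := dense_sequence nB.
have -> : D `&` [set t | exists2 a, B a & psi t a = 0] =
    \bigcap_j \bigcup_k (D `&` (psi^~ (b k)) @^-1` `]-oo, j.+1%:R^-1[).
  apply/seteqP; split => t /=.
    move=> [Dt [a Ba pa0]] j _.
    have j0 : 0 < j.+1%:R^-1 :> R by [].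
    have [d d0 Hd] := within_continuousP (cpsi t Dt) (BA a Ba) j0.
    have [k kd] := db a d Ba d0; exists k => //; split => //=.
    rewrite in_itv/= (le_lt_trans (ler_norm _))//.
    by have := Hd _ (BA _ (Bb k)) kd; rewrite pa0 add0r normrN.
  move=> H; have [k0 _ [Dt _]] := H 0%N I; split => //.
  have cB' : {within B, continuous (psi t)} by exact: continuous_subspaceW (cpsi t Dt).
  have [a /set_mem Ba amin] := compact_EVT_min nB cB cB'.
  exists a => //; apply/eqP; rewrite eq_le psi0// ?andbT; last exact: BA.
  apply/ler_addgt0Pr => e e0; rewrite add0r.
  have [j je] : exists j : nat, j.+1%:R^-1 < e.
    exists (Num.bound e^-1); rewrite invf_plt ?posrE//.
    by rewrite (lt_trans (archi_boundP _))// ?invr_ge0 ?ltW// ltr_nat.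
  have [k _ [_ /=]] := H j I; rewrite in_itv/= => kj.
  rewrite (le_trans (amin (b k) _)) ?inE//.
  by rewrite ltW// (lt_trans kj).
apply: bigcapT_measurable => j; apply: bigcupT_measurable => k.
by apply: mpsi => //; exact: BA.
Qed.

Lemma closed_in_compact (g : 'rV[R]_m -> R) : {within A, continuous g} ->
  compact (A `&` [set a | g a = 0]).
Proof.
move=> cg; have [V cV VA] : exists2 V, closed (V : set 'rV[R]_m) &
    V `&` A = (g @^-1` [set 0]) `&` A.
  apply/closed_subspaceP; apply: (closed_comp (f := g : subspace A -> R)).
    by move=> x _; exact: cg.
  exact: closed_eq.
have -> : A `&` [set a | g a = 0] = V `&` A by rewrite VA setIC.
apply: (subclosed_compact _ A_compact) => [|x []//].
by apply: closedI => //; apply: compact_closed => //; exact: norm_hausdorff.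
Qed.

(** The least i-th coordinate over the compact set of zeros is at most c exactly when psi t has a
    zero in the compact set of the a in A with a_i <= c, so its sublevel sets are measurable. *)
Lemma least_coordinate psi (i : 'I_m) : caratheodory psi ->
  (forall t a, D t -> A a -> 0 <= psi t a) ->
  (forall t, D t -> exists2 a, A a & psi t a = 0) ->
  exists2 al : R -> R, measurable_fun D al &
    forall t, D t -> exists2 a, A a & psi t a = 0 /\ a 0 i = al t.
Proof.
move=> car psi0 psiz; have [mpsi cpsi] := car.
have cc : continuous (fun a : 'rV[R]_m => a 0 i) by exact: coord_continuous.
have /choice[F HF] : forall t, exists a, D t -> [/\ A a, psi t a = 0 &
    forall b, A b -> psi t b = 0 -> a 0 i <= b 0 i].
  move=> t; have [Dt|nD] := pselect (D t); last by exists 0.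
  have cZ := closed_in_compact (cpsi t Dt).
  have nZ : (A `&` [set a | psi t a = 0]) !=set0.
    by have [a Aa pa] := psiz t Dt; exists a.
  have [a /set_mem[Aa pa] amin] := compact_EVT_min nZ cZ (continuous_subspaceT cc).
  by exists a => _; split => // b Ab pb; apply: amin; rewrite inE.
exists (fun t => F t 0 i); last first.
  by move=> t Dt; have [Aa pa _] := HF t Dt; exists (F t).
rewrite -[X in measurable_fun D X]opprK; apply/measurable_funN.
move=> _; apply: (measurability (@RGenCInfty.G R)); first exact: RGenCInfty.measurableE.
move=> _ [_ [r ->] <-].
have cB : compact (A `&` [set a | a 0 i <= - r]).
  apply: compact_closedI => //.
  apply: (preimage_closed (D := [set y : R | y <= - r])); last exact: closed_le.
  by move=> x _; exact: cc.
rewrite (_ : D `&` _ = D `&` [set t | exists2 a, (A `&` [set a | a 0 i <= - r]) a & psi t a = 0]).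
  by apply: exists_zero_measurable => // a [].
apply/seteqP; split => t /= [Dt]; rewrite in_itv/= andbT.
  move=> rF; have [Aa pa _] := HF t Dt; split => //; exists (F t) => //; split => //=.
  by rewrite lerNr.
move=> [a [Aa ar] pa]; split => //; have [_ _ amin] := HF t Dt.
by rewrite lerNr (le_trans (amin a Aa pa)).
exact: D_measurable.
Qed.

(* The lexicographically least zero: the i-th coordinate is minimized over the zeros found so
   far, and the penalty |a_i - al_i(t)| then discards the others. *)
Lemma measurable_zero_selection psi : caratheodory psi ->
  (forall t a, D t -> A a -> 0 <= psi t a) ->
  (forall t, D t -> exists2 a, A a & psi t a = 0) ->
  exists2 al : R -> 'rV[R]_m, (forall i, measurable_fun D (fun t => al t 0 i)) &
    forall t, D t -> A (al t) /\ psi t (al t) = 0.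
Proof.
move=> car psi0 psiz.
have : forall k, (k <= m)%N -> exists psi' (al : R -> 'rV[R]_m),
  [/\ caratheodory psi', (forall t a, D t -> A a -> 0 <= psi' t a),
      (forall t, D t -> exists2 a, A a & psi' t a = 0),
      (forall t a, D t -> A a -> psi' t a = 0 -> psi t a = 0) &
      (forall i : 'I_m, (i < k)%N -> measurable_fun D (fun t => al t 0 i) /\
        forall t a, D t -> A a -> psi' t a = 0 -> a 0 i = al t 0 i)].
  elim=> [_|k IH km]; first by exists psi, (fun=> 0); split.
  have [psi' [al [[m' c'] p'0 p'z p'psi p'al]]] := IH (ltnW km).
  pose j := Ordinal km.
  have [c mc Hc] := least_coordinate j (conj m' c') p'0 p'z.
  exists (fun t a => psi' t a + `|a 0 j - c t|),
    (fun t => \row_i (if i == j then c t else al t 0 i)).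
  have split0 t a : D t -> A a -> psi' t a + `|a 0 j - c t| = 0 ->
      psi' t a = 0 /\ a 0 j = c t.
    move=> Dt Aa /eqP; rewrite paddr_eq0// ?p'0// normr_eq0 subr_eq0.
    by move=> /andP[/eqP ? /eqP].
  split.
  - split => [a Aa|t Dt].
      apply: measurable_funD; first exact: m'.
      by apply: measurableT_comp => //; exact: measurable_funB.
    move=> x; apply: cvgD; first exact: c'.
    apply: (@continuous_subspaceT _ _ A (fun a : 'rV[R]_m => `|a 0 j - c t|)).
    move=> a; apply/(@cvgrPdist_le _ _ _ (nbhs a) (nbhs_filter a)) => e e0.
    apply/nbhs_ballP; exists e => //= b; rewrite mx_norm_ball /ball_/= => ab.
    rewrite (le_trans (ler_dist_dist _ _))// opprB addrA subrK -coordB.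
    exact: le_trans (ler_coord _ _) (ltW ab).
  - by move=> t a Dt Aa; rewrite addr_ge0// p'0.
  - move=> t Dt; have [a Aa [pa ac]] := Hc t Dt; exists a => //.
    by rewrite pa ac subrr normr0 addr0.
  - by move=> t a Dt Aa /(split0 _ _ Dt Aa)[/(p'psi _ _ Dt Aa)].
  - move=> i ik; have [ij|ij] := eqVneq i j.
      split; first by under eq_fun do rewrite mxE ij eqxx.
      by move=> t a Dt Aa /(split0 _ _ Dt Aa)[_]; rewrite mxE ij eqxx.
    have {}ik : (i < k)%N.
      by rewrite ltn_neqAle -ltnS ik andbT; apply: contra ij => /eqP ik'; apply/eqP/val_inj.
    have [mi Hi] := p'al i ik; split.
      by under eq_fun do rewrite mxE (negbTE ij).
    by move=> t a Dt Aa /(split0 _ _ Dt Aa)[pa _]; rewrite mxE (negbTE ij) (Hi t a).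
move=> /(_ m (leqnn m))[psi' [al [_ _ p'z p'psi p'al]]].
exists al => [i|t Dt]; first exact: (p'al i (ltn_ord i)).1.
have [a Aa pa] := p'z t Dt.
have <- : a = al t by apply/rowP => i; exact: (p'al i (ltn_ord i)).2.
by split => //; exact: p'psi.
Qed.

End MeasurableSelection.

(** * Continuity on subsets and limits along ultrafilters *)

Section WithinContinuity.
Context {R : realType}.

Lemma continuous_sum_seq {T : topologicalType} {I : Type} (r : seq I) (g : I -> T -> R) :
  (forall i, continuous (g i)) -> continuous (fun a => \sum_(i <- r) g i a).
Proof.
move=> cg; elim: r => [|i r IH].
  rewrite (_ : (fun _ => _) = cst 0); first exact: cst_continuous.
  by apply/funext => a; rewrite big_nil.
rewrite (_ : (fun _ => _) = (fun a => g i a + \sum_(j <- r) g j a)); last first.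
  by apply/funext => a; rewrite big_cons.
by move=> a; apply: cvgD; [exact: cg|exact: IH].
Qed.

Lemma continuous_sqr_dist {T : topologicalType} (g : T -> R) (c : R) :
  continuous g -> continuous (fun a => (g a - c) ^+ 2).
Proof.
move=> cg a; have h : g z - c @[z --> a] --> g a - c.
  by apply: cvgB; [exact: cg|exact: cvg_cst].
apply: (@continuous_comp _ _ _ (fun z => g z - c) (fun v : R => v ^+ 2)); first exact: h.
exact: exprn_continuous.
Qed.

Lemma continuous_dist_cst {T : topologicalType} (g : T -> R) (c : R) :
  continuous g -> continuous (fun a => `|g a - c|).
Proof.
move=> cg a; have h : g z - c @[z --> a] --> g a - c.
  by apply: cvgB; [exact: cg|exact: cvg_cst].
exact: cvg_norm h.
Qed.

Lemma continuous_excess {T : topologicalType} (g : T -> R) (c : R) :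
  continuous g -> continuous (fun a => Num.max 0 (g a - c)).
Proof.
move=> cg a; have h : g z - c @[z --> a] --> g a - c.
  by apply: cvgB; [exact: cg|exact: cvg_cst].
by apply: (@continuous_max _ _ (cst 0) (fun a => g a - c)); [exact: cvg_cst|exact: h].
Qed.

Lemma continuous_section {n m : nat} {W : topologicalType} (A : set 'rV[R]_m)
    (g : 'rV[R]_n -> 'rV[R]_m -> W) (x : 'rV[R]_n) :
  {within [set: 'rV[R]_n] `*` A, continuous (fun z => g z.1 z.2)} ->
  {within A, continuous (g x)}.
Proof.
move=> /subspace_continuousP cg; apply/subspace_continuousP => a Aa V nV.
have := cg (x, a) (conj I Aa) V nV; case=> -[Q1 Q2] /= [n1 n2] H.
apply: filterS n2 => b Q2b Ab; apply: (H (x, b)) => /=; split => //.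
exact: nbhs_singleton n1.
Qed.

(** This takes the place of extracting subsequences: a single ultrafilter makes all arcs and costs
    converge at all times simultaneously. *)
Lemma ultrafilter_limit {T : topologicalType} (U : set_system nat) (u : nat -> T) (K : set T) :
  UltraFilter U -> compact K -> (forall j, K (u j)) ->
  exists p : T, forall V, nbhs p V -> U [set j | V (u j)].
Proof.
move=> UU cK Ku.
have [|p [Kp cp]] := cK (u @ U) _.
  by apply: (@filterS _ U _ setT); [move=> j _; exact: Ku | exact: filterT].
exists p => V nV; have [//|H] := in_ultra_setVsetC [set j | V (u j)] UU.
have [v [/= nv vV]] : ~` V `&` V !=set0 by apply: cp.
by [].
Qed.

End WithinContinuity.

(** * Convex velocity sets: separation and selection of controls *)

Section Closure.
Context {R : realType} {n m : nat}.
Variables (A : set 'rV[R]_m) (f : 'rV[R]_n -> 'rV[R]_m -> 'rV[R]_n)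
  (l : 'rV[R]_n -> 'rV[R]_m -> R).
Hypotheses (dyn : standing_dynamics A f l) (l_ge0 : forall x a, A a -> 0 <= l x a).
Hypothesis velocities_convex : forall x : 'rV[R]_n,
  convex_set [set p : 'rV[R]_n * R^o | exists2 a, A a & p.1 = f x a /\ l x a <= p.2].
Implicit Types (x y z : 'rV[R]_n) (al : R -> 'rV[R]_m).

Local Notation mu := (@lebesgue_measure R).
Local Notation traj := (trajectory f).
Local Notation running x al := (fun s => l (traj x al s) (al s)).
Local Notation sq v := (dotp v v).

Lemma continuous_f_coord x i : {within A, continuous (fun a => f x a 0 i)}.
Proof.
have [_ cf _ _ _] := dyn; have cfx := continuous_section (x := x) cf.
move=> a; apply: (@continuous_comp (subspace A) _ _ (f x) (fun v : 'rV[R]_n => v 0 i)).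
  exact: cfx.
exact: coord_continuous.
Qed.

Lemma continuous_l x : {within A, continuous (l x)}.
Proof. by have [_ _ cl _ _] := dyn; exact: continuous_section cl. Qed.

(* Distance minimization: the nearest point of the closed convex set of (f x a, c') with
   l x a <= c' exists by compactness of A. *)
Lemma convex_separation x v (c : R) : A !=set0 ->
  (forall a, A a -> f x a = v -> c < l x a) ->
  exists p (q e : R), [/\ 0 <= q, 0 < e &
    forall a, A a -> dotp p v + q * c + e <= dotp p (f x a) + q * l x a].
Proof.
move=> A0 Hn; have [cA _ _ _ _] := dyn.
(* With this excess, [phi a] is the squared distance from (v, c) to the half-line of the (f x a, c')
   with c' >= l x a. *)
pose ex a := Num.max 0 (l x a - c).
pose phi a := (\sum_(i < n) (f x a 0 i - v 0 i) ^+ 2) + ex a ^+ 2.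
have phiE a : phi a = sq (f x a - v) + ex a ^+ 2.
  by rewrite /phi /dotp; congr (_ + _); apply: eq_bigr => i _; rewrite coordB.
have cphi : {within A, continuous phi}.
  have cs i : continuous ((fun a => (f x a 0 i - v 0 i) ^+ 2) : subspace A -> R).
    by refine (@continuous_sqr_dist _ (subspace A) _ _ (@continuous_f_coord x i)).
  have css : continuous ((fun a => \sum_(i < n) (f x a 0 i - v 0 i) ^+ 2) : subspace A -> R).
    by refine (@continuous_sum_seq _ (subspace A) _ (index_enum _) _ cs).
  move=> a; apply: cvgD; first exact: css.
  have ce : continuous (ex : subspace A -> R).
    by refine (@continuous_excess _ (subspace A) (l x) c (@continuous_l x)).
  apply: (@continuous_comp (subspace A) _ _ ex (fun v : R => v ^+ 2)); first exact: ce.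
  exact: exprn_continuous.
have [a0 /set_mem Aa0 amin] := compact_EVT_min A0 cA cphi.
have ex0 a : 0 <= ex a by rewrite le_max lexx.
set q := ex a0; have q0 : 0 <= q := ex0 a0.
have lq : l x a0 <= c + q.
  have : l x a0 - c <= q by rewrite le_max lexx orbT.
  lra.
set p := f x a0 - v.
have e0 : 0 < sq p + q ^+ 2.
  rewrite lt_neqAle eq_sym addr_ge0 ?dotp_ge0 ?sqr_ge0// andbT.
  rewrite paddr_eq0 ?dotp_ge0 ?sqr_ge0// sqrf_eq0; apply/negP => /andP[/eqP p0 /eqP qE].
  have : `|p| ^+ 2 <= 0 by rewrite -p0 sqr_norm_le_dotp.
  rewrite exprn_even_le0//= normr_eq0 subr_eq0 => /eqP fv.
  by have := Hn a0 Aa0 fv; rewrite ltNge; move: lq; rewrite qE addr0 => ->.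
exists p, q, (sq p + q ^+ 2); split => // a Aa.
pose d := f x a - f x a0; pose e := l x a - (c + q).
(* The nearest point is compared with its convex combination of weight th with (f x a, l x a); small
   th then yields the variational inequality [X0]. *)
have key th : 0 < th -> th < 1 -> 0 <= 2 * (dotp p d + q * e) + th * (sq d + e ^+ 2).
  move=> th0 th1.
  have inS b g : A b -> l x b <= g ->
      (f x b, g) \in [set p : 'rV[R]_n * R^o | exists2 a, A a & p.1 = f x a /\ l x a <= p.2].
    by move=> Ab lg; rewrite inE /=; exists b.
  have := @velocities_convex x _ _ (Itv01 (ltW th0) (ltW th1)) (inS a _ Aa (lexx _)) (inS a0 _ Aa0 lq).
  rewrite inE /= => -[b Ab [/esym fb lb]].
  have := amin b (mem_set Ab); rewrite !phiE -/p -/q.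
  have -> : f x b - v = p + th *: d.
    by rewrite fb; apply/rowP => i; rewrite /p /d !mxE /unstable.onem; ring.
  have eb : ex b ^+ 2 <= (q + th * e) ^+ 2.
    have lb' : l x b - c <= q + th * e.
      by move: lb; rewrite /e /= /unstable.onem /GRing.scale /=; lra.
    rewrite /ex; case: (leP 0 (l x b - c)) => h; last by rewrite expr0n sqr_ge0.
    by rewrite ler_sqr// nnegrE// (le_trans h).
  rewrite dotp_sqrD => h.
  rewrite -(pmulr_rge0 _ th0).
  have {h}h := le_trans h (lerD (lexx _) eb).
  move: h; rewrite !dotpZr ?dotpZl.
  set X := dotp p d; set Y := sq d; set Z := sq p => h.
  by move: h; clear; nra.
have X0 : 0 <= dotp p d + q * e.
  rewrite leNgt; apply/negP => X0.
  set X := dotp p d + q * e in X0 key; set K := sq d + e ^+ 2 in key.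
  have K0 : 0 <= K by rewrite addr_ge0 ?dotp_ge0 ?sqr_ge0.
  have K1 : 0 < K + 1 - X by lra.
  have th0 : 0 < - X / (K + 1 - X) by rewrite divr_gt0// oppr_gt0.
  have th1 : - X / (K + 1 - X) < 1 by rewrite ltr_pdivrMr// mul1r; lra.
  have := key _ th0 th1; rewrite leNgt => /negP; apply.
  have : - X / (K + 1 - X) * K <= - X.
    by rewrite mulrAC ler_pdivrMr// ler_wpM2l//; lra.
  lra.
have -> : dotp p (f x a) = dotp p d + sq p + dotp p v.
  rewrite (_ : f x a = d + p + v) ?dotpDr//.
  by rewrite /d /p addrA subrK subrK.
move: X0; rewrite /e; set X := dotp p d; set Y := sq p; set Z := dotp p v; set W := l x a.
by clear; rewrite expr2; lra.
Qed.

(** The wanted control values are the zeros of a nonnegative Caratheodory function. Multiplying it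
    by the indicator of the measurable set of times at which it has a zero makes all of A admissible
    at the other times, so that the selection applies on the whole half-line. *)
Lemma measurable_velocity_selection (y g : R -> 'rV[R]_n) (h : R -> R) : A !=set0 ->
  {within (`[0, +oo[ : set R), continuous y} ->
  (forall i, measurable_fun (`[0, +oo[ : set R) (fun t => g t 0 i)) ->
  measurable_fun (`[0, +oo[ : set R) h ->
  exists2 al, controls A al & forall t, 0 <= t ->
    (exists2 a, A a & f (y t) a = g t /\ l (y t) a <= h t) ->
    f (y t) (al t) = g t /\ l (y t) (al t) <= h t.
Proof.
move=> A0 cy mg mh; have [cA _ _ _ _] := dyn.
pose D : set R := `[0, +oo[%classic.
have mD : measurable D by exact: measurable_itv.
have Dt t : D t <-> 0 <= t by rewrite /D /= in_itv/= andbT.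
pose ex t a := Num.max 0 (l (y t) a - h t).
pose psi0 t a := \sum_(i < n) `|f (y t) a 0 i - g t 0 i| + ex t a.
have s0 t a : 0 <= \sum_(i < n) `|f (y t) a 0 i - g t 0 i| by apply: sumr_ge0.
have ex0 t a : 0 <= ex t a by rewrite le_max lexx.
have psi00 t a : 0 <= psi0 t a by exact: addr_ge0.
have psi0E t a : psi0 t a = 0 <-> f (y t) a = g t /\ l (y t) a <= h t.
  split.
    move=> /eqP; rewrite paddr_eq0// => /andP[/eqP e1 /eqP e2]; split.
      apply/rowP => i; apply/eqP; rewrite -subr_eq0 -normr_eq0; move: e1 => /eqP.
      by rewrite psumr_eq0// => /allP/(_ i (mem_index_enum _)).
    by rewrite -subr_le0 -e2 le_max lexx orbT.
  move=> [e1 e2]; rewrite /psi0 /ex e1 big1 ?add0r; last first.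
    by move=> i _; rewrite subrr normr0.
  by apply/max_idPl; rewrite subr_le0.
have car0 : caratheodory A D psi0.
  split=> [a Aa|t _].
    apply: measurable_funD.
      apply: measurable_sum => i; apply: measurableT_comp => //.
      by apply: measurable_funB => //; have [] := lbm_f dyn i cy (controls_cst Aa).
    apply: measurable_maxr; first exact: measurable_cst.
    by apply: measurable_funB => //; have [] := lbm_l dyn cy (controls_cst Aa).
  have cs i : continuous ((fun a => `|f (y t) a 0 i - g t 0 i|) : subspace A -> R).
    by refine (@continuous_dist_cst _ (subspace A) _ _ (@continuous_f_coord (y t) i)).
  have css : continuous ((fun a => \sum_(i < n) `|f (y t) a 0 i - g t 0 i|) : subspace A -> R).
    by refine (@continuous_sum_seq _ (subspace A) _ (index_enum _) _ cs).
  move=> a; apply: cvgD; first exact: css.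
  have ce : continuous (ex t : subspace A -> R).
    by refine (@continuous_excess _ (subspace A) (l (y t)) (h t) (@continuous_l (y t))).
  exact: ce.
pose E := D `&` [set t | exists2 a, A a & psi0 t a = 0].
have mE : measurable E by exact: (exists_zero_measurable mD car0 (@subset_refl _ A) cA).
have [|||al mal Hal] := @measurable_zero_selection R m A D cA mD
  (fun t a => \1_E t * psi0 t a).
- split=> [a Aa|t Dt' a].
    apply: measurable_funM; first exact: measurable_indic.
    exact: car0.1.
  by apply: cvgM; [exact: cvg_cst|exact: car0.2].
- by move=> t a _ _; rewrite mulr_ge0// indicE.
- move=> t Dt'; have [tE|tE] := pselect (E t).
    by have [_ [a Aa pa]] := tE; exists a => //; rewrite pa mulr0.
  by have [a Aa] := A0; exists a => //; rewrite indicE memNset// mul0r.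
exists al; first by split => // t t0; apply: (Hal t _).1; exact/Dt.
move=> t t0 [a Aa /psi0E pa]; apply/psi0E.
have [_] := Hal t ((Dt t).2 t0); rewrite indicE mem_set ?mul1r//.
  by split; [exact/Dt|exists a].
Qed.

End Closure.

(** * Limits of arcs and of their costs *)

Section TrajectoryClosure.
Context {R : realType} {n m : nat}.
Variables (A : set 'rV[R]_m) (f : 'rV[R]_n -> 'rV[R]_m -> 'rV[R]_n)
  (l : 'rV[R]_n -> 'rV[R]_m -> R).
Hypotheses (dyn : standing_dynamics A f l) (l_ge0 : forall x a, A a -> 0 <= l x a).
Implicit Types (x y z : 'rV[R]_n) (al : R -> 'rV[R]_m).

Local Notation mu := (@lebesgue_measure R).
Local Notation traj := (trajectory f).
Local Notation running x al := (fun s => l (traj x al s) (al s)).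

(** Composition with it extends functions on [0, 1] to the line without increasing their Lipschitz
    constant, so that [lipschitz_density] applies. *)
Definition clamp (t : R) : R := Num.max 0 (Num.min t 1).

Lemma clamp_itv t : 0 <= clamp t <= 1.
Proof. by rewrite /clamp le_max lexx ge_max ler01 ge_min lexx orbT. Qed.

Lemma clampE t : 0 <= t <= 1 -> clamp t = t.
Proof. by move=> /andP[t0 t1]; rewrite /clamp (min_idPl t1) (max_idPr t0). Qed.

Lemma clamp_cases u :
  [\/ u <= 0 /\ clamp u = 0, 0 <= u <= 1 /\ clamp u = u | 1 <= u /\ clamp u = 1].
Proof.
have [u0|u0] := leP u 0.
  by constructor 1; split => //; rewrite /clamp; apply/max_idPl; rewrite ge_min u0.
have [u1|u1] := leP u 1; last first.
  by constructor 3; rewrite /clamp (min_idPr (ltW u1)) (max_idPr ler01) ltW.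
by constructor 2; rewrite clampE ?(ltW u0).
Qed.

Lemma clamp_mono s t : s <= t -> clamp s <= clamp t /\ clamp t - clamp s <= t - s.
Proof.
move=> st.
have [[s1 ->]|[/andP[s1 s2] ->]|[s1 ->]] := clamp_cases s;
have [[t1 ->]|[/andP[t1 t2] ->]|[t1 ->]] := clamp_cases t; split; lra.
Qed.

(** On [0, 1] the arcs and their costs are bounded and Lipschitz uniformly in j; pointwise limits
    along an ultrafilter exist by compactness and keep the Lipschitz constant. *)
Lemma limit_arc x (als : nat -> R -> 'rV[R]_m) : (forall j, controls A (als j)) ->
  exists (U : set_system nat) (y : R -> 'rV[R]_n) (c : R -> R) (L : R),
  [/\ UltraFilter U /\ \oo `<=` U, 0 < L,
      forall s t, `|y s - y t| <= L * `|s - t| /\ `|c s - c t| <= L * `|s - t|,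
      forall j s t, `|traj x (als j) (clamp s) - traj x (als j) (clamp t)| <= L * `|s - t| &
      forall t e, 0 < e -> U [set j | `|traj x (als j) (clamp t) - y t| <= e /\
        `|itg (running x (als j)) 0 (clamp t) - c t| <= e]].
Proof.
move=> ca; have [rho r0 Hr] := trajectory_bounded dyn x 1.
have [L [F [L0 F0 HL HF]]] := bounds_on_ball_exist dyn r0.
have bb : bounds_on_ball A f l rho L F by [].
pose Y j t := traj x (als j) (clamp t).
pose C j t := itg (running x (als j)) 0 (clamp t).
have sym (V : normedModType R) (k : R -> V) :
    (forall s t, s <= t -> `|k t - k s| <= F * (clamp t - clamp s)) ->
    forall s t, `|k s - k t| <= F * `|s - t|.
  move=> H s t; wlog st : s t / s <= t => [W|].
    by have [/W//|/ltW/W] := leP s t; rewrite distrC (distrC t).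
  have [c1 c2] := clamp_mono st.
  by rewrite distrC (distrC s) (ger0_norm (x := t - s)) ?subr_ge0// (le_trans (H s t st))// ler_pM2l.
have yr j s : 0 <= s <= 1 -> `|traj x (als j) s| <= rho by exact: Hr.
have YL j s t : `|Y j s - Y j t| <= F * `|s - t|.
  apply: sym s t => s t st; have [c1 c2] := clamp_mono st.
  have /andP[s0 s1] := clamp_itv s; have /andP[t0 t1] := clamp_itv t.
  apply: (trajectory_incr_norm dyn bb) => // u /andP[su ut].
  by apply: yr; rewrite (le_trans s0)//= (le_trans ut).
have CL j s t : `|C j s - C j t| <= F * `|s - t|.
  apply: sym s t => s t st; have [c1 c2] := clamp_mono st.
  have /andP[s0 s1] := clamp_itv s; have /andP[t0 t1] := clamp_itv t.
  have lr := lbm_running dyn x (ca j).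
  rewrite /C (itg_cat lr (lexx 0) s0 c1) addrC addKr.
  apply: itg_norm_cst => // u /andP[/ltW su /ltW ut].
  have u0 := le_trans s0 su.
  have yu : `|traj x (als j) u| <= rho by apply: yr; rewrite u0/= (le_trans ut).
  by have [] := HF _ _ yu ((ca j).1 _ u0).
have C0 j : C j 0 = 0 by rewrite /C clampE ?lexx ?ler01// itg_same.
have Cb j t : `|C j t| <= F.
  have := CL j (clamp t) 0.
  have /andP[t0 t1] := clamp_itv t.
  rewrite C0 !subr0 /C clampE ?t0// => /le_trans; apply.
  by rewrite ger0_norm// ler_piMr// ltW.
have [U [UU UF]] := ultraFilterLemma eventually_filter.
have /choice[y Hy] : forall t, exists p : 'rV[R]_n, forall V, nbhs p V -> U [set j | V (Y j t)].
  move=> t; apply: (ultrafilter_limit UU (@closed_ball_compact R n rho)) => j.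
  by apply: yr; exact: clamp_itv.
have /choice[c Hc] : forall t, exists p : R, forall V, nbhs p V -> U [set j | V (C j t)].
  move=> t; apply: (ultrafilter_limit UU (@segment_compact R (- F) F)) => j.
  by rewrite /= in_itv/= -ler_norml.
have near t e : 0 < e -> U [set j | `|Y j t - y t| <= e /\ `|C j t - c t| <= e].
  move=> e0; have H1 := Hy t _ (nbhsx_ballx (y t) e e0).
  have H2 := Hc t _ (nbhsx_ballx (c t) e e0).
  apply: filterS2 H1 H2 => j; rewrite mx_norm_ball /ball_/= => h1 h2.
  by split; rewrite distrC ltW.
exists U, y, c, F; split => // s t.
have H e : 0 < e -> exists j, [/\ `|Y j s - y s| <= e, `|C j s - c s| <= e,
    `|Y j t - y t| <= e & `|C j t - c t| <= e].
  move=> e0; have [j [[? ?] [? ?]]] := filter_ex (filterI (near s e e0) (near t e e0)).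
  by exists j; split.
have tri (V : normedModType R) (a b a' b' : V) :
    `|a - b| <= `|a' - b'| + (`|a' - a| + `|b' - b|).
  rewrite (_ : a - b = (a - a') + (a' - b') + (b' - b)); last by rewrite !addrA !subrK.
  rewrite [leRHS]addrA (le_trans (ler_normD _ _))// lerD2r (le_trans (ler_normD _ _))//.
  by rewrite addrC distrC.
split; apply/ler_addgt0Pr => e e0; have e2 : 0 < e / 2 by exact: divr_gt0.
  have [j [h1 _ h3 _]] := H _ e2.
  by rewrite (le_trans (tri _ _ _ (Y j s) (Y j t)))// [e in leRHS]splitr lerD// lerD.
have [j [_ h1 _ h3]] := H _ e2.
by rewrite (le_trans (tri _ _ _ (C j s) (C j t)))// [e in leRHS]splitr lerD// lerD.
Qed.

Lemma Rintegral_oo (g : R -> R) (t : R) : measurable_fun [set: R] g ->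
  Rintegral mu `[0, t] g = Rintegral mu `]0, t[ g.
Proof.
move=> mg; rewrite /Rintegral; congr fine.
rewrite -integral_itv_obnd_cbnd; last by apply/measurable_EFinP; exact: measurable_funTS.
by rewrite -integral_itv_bndo_bndc//; apply/measurable_EFinP; exact: measurable_funTS.
Qed.

Let lbm_measurable_oo (k : R -> R) (t : R) : locally_bounded_measurable k ->
  measurable_fun (`]0, t[ : set R) k.
Proof.
by move=> [mk _]; apply: measurable_funS mk => //; apply: subset_itv => //; rewrite bnd_simp.
Qed.

Lemma itg_ae_eq (k g : R -> R) (t : R) : locally_bounded_measurable k ->
  measurable_fun [set: R] g -> {ae mu, forall s : R, 0 < s < 1 -> k s = g s} -> t <= 1 ->
  itg k 0 t = Rintegral mu `[0, t] g.
Proof.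
move=> hk mg Hae t1; rewrite itg_oo// Rintegral_oo// /Rintegral; congr fine.
apply: ae_eq_integral => //.
- by apply/measurable_EFinP; exact: lbm_measurable_oo.
- by apply/measurable_EFinP; exact: measurable_funTS.
move: Hae; apply: filterS; first exact: (ae_filter_ringOfSetsType mu).
move=> s Hs; rewrite /= in_itv/= => /andP[s0 st]; congr EFin.
by apply: Hs; rewrite s0 (lt_le_trans st).
Qed.

Lemma itg_ae_le (k g : R -> R) : locally_bounded_measurable k ->
  (forall s, 0 <= s -> 0 <= k s) -> measurable_fun [set: R] g ->
  mu.-integrable `[0, 1] (EFin \o g) ->
  {ae mu, forall s : R, 0 < s < 1 -> k s <= g s} ->
  itg k 0 1 <= Rintegral mu `[0, 1] g.
Proof.
move=> hk k0 mg ig Hae; rewrite itg_oo// Rintegral_oo// /Rintegral.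
have mk := lbm_measurable_oo (t := 1) hk.
have mg' : measurable_fun (`]0, 1[ : set R) g by exact: measurable_funTS.
have sub : (`]0, 1[%classic : set R) `<=` `[0, 1] by apply: subset_itv; rewrite bnd_simp.
have ik : mu.-integrable `]0, 1[ (EFin \o k).
  exact: integrableS (lbm_integrable 1 hk (lexx 0)).
have ig' : mu.-integrable `]0, 1[ (EFin \o g) by exact: integrableS ig.
apply: fine_le; [exact: integrable_fin_num|exact: integrable_fin_num|].
(* The maximum of g and k equals g almost everywhere and dominates k everywhere. *)
have -> : (\int[mu]_(x in `]0%R, 1%R[) (g x)%:E =
    \int[mu]_(x in `]0%R, 1%R[) (Num.max (g x) (k x))%:E)%E.
  apply: ae_eq_integral => //.
  - exact/measurable_EFinP.
  - by apply/measurable_EFinP; exact: measurable_maxr.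
  move: Hae; apply: filterS; first exact: (ae_filter_ringOfSetsType mu).
  by move=> s Hs; rewrite /= in_itv/= => /Hs/max_idPl ->.
have kp s : `]0%R, 1%R[%classic s -> 0 <= k s.
  by rewrite /= in_itv/= => /andP[/ltW s0 _]; exact: k0.
apply: ge0_le_integral => //.
- exact/measurable_EFinP.
- by apply/measurable_EFinP; exact: measurable_maxr.
- by move=> s _; rewrite lee_fin le_max lexx orbT.
Qed.
Hypothesis velocities_convex : forall x : 'rV[R]_n,
  convex_set [set p : 'rV[R]_n * R^o | exists2 a, A a & p.1 = f x a /\ l x a <= p.2].

(* Where the limit arc is differentiable, its velocity lies in the closed convex set of
   velocities: a separating (p, q) would contradict the difference quotients. *)
Lemma limit_velocity x (als : nat -> R -> 'rV[R]_m) (U : set_system nat)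
    (y : R -> 'rV[R]_n) (c : R -> R) (L t : R) (g : 'rV[R]_n) (h : R) :
  (forall j, controls A (als j)) -> ProperFilter U -> 0 < L ->
  (forall j s t, `|traj x (als j) (clamp s) - traj x (als j) (clamp t)| <= L * `|s - t|) ->
  (forall t e, 0 < e -> U [set j | `|traj x (als j) (clamp t) - y t| <= e /\
        `|itg (running x (als j)) 0 (clamp t) - c t| <= e]) ->
  0 < t < 1 -> (forall i, is_derive t 1 (fun s => y s 0 i) (g 0 i)) -> is_derive t 1 c h ->
  exists2 a, A a & f (y t) a = g /\ l (y t) a <= h.
Proof.
move=> ca UF L0 YL near /andP[t0 t1] dy dc.
have A0 : A !=set0 by exists (als 0%N 0); exact: (ca 0%N).1.
apply: contrapT => nex.
have [|p [q [e [q0 e0 Hsep]]]] := convex_separation dyn velocities_convex (x := y t) (v := g) (c := h) A0.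
  by move=> a Aa fg; rewrite ltNge; apply/negP => lh; apply: nex; exists a.
set D := dotp p g + q * h in Hsep.
pose Phi s := dotp p (y s) + q * c s.
have dPhi : is_derive t 1 Phi D.
  have -> : Phi = (\sum_(i < n) (p 0 i \*: (fun s => y s 0 i))) + (q \*: c).
    by apply/funext => s; change (Phi s = (\sum_(i < n) p 0 i \*: (fun s => y s 0 i)) s + q * c s);
      rewrite fct_sumE.
  by apply: is_deriveD.
have [rho r0 Hr] := trajectory_bounded dyn x 1.
have [|L1 [F [L10 F0 HL HF]]] := @bounds_on_ball_exist _ _ _ A f l dyn (rho + 1).
  exact: addr_gt0.
have np0 : 0 <= n%:R * `|p| by rewrite mulr_ge0.
set K := (n%:R * `|p| + q) * L1; have K0 : 0 <= K by rewrite mulr_ge0 ?addr_ge0// ltW.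
have yr : `|y t| <= rho + 1.
  have [j [h1 _]] := filter_ex (near t 1 ltr01).
  rewrite -(subrK (traj x (als j) (clamp t)) (y t)) (le_trans (ler_normD _ _))//.
  by rewrite addrC lerD// ?Hr ?clamp_itv// distrC.
have [eta0 eta00 Heta] : exists2 eta0 : R, 0 < eta0 &
    forall eta, 0 < eta -> eta < eta0 -> Phi (t + eta) - Phi t <= eta * (D + e / 4).
  have := @ex_derive _ _ _ _ _ _ _ dPhi; have := @derive_val _ _ _ _ _ _ _ dPhi.
  rewrite /derive => dv /cvg_ex[v cv]; move: dv; rewrite (cvg_lim _ cv)// => vD.
  move: cv => /cvgrPdist_le/(_ (e / 4))[|d /= d0 Hd]; first exact: divr_gt0.
  exists d => // eta eta0 etad.
  have := Hd eta; rewrite /= sub0r normrN gtr0_norm// => /(_ etad (lt0r_neq0 eta0)).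
  rewrite vD ler_distl [eta *: 1]mulr1 [eta + t]addrC => /andP[+ _].
  by rewrite lerBlDr /GRing.scale/= mulrC ler_pdivrMr// mulrC.
(* Short enough for the difference quotient of [Phi], for ending before time 1, and for the arcs to
   stay so close to y t that freezing f and l there costs at most e / 4. *)
pose eta := Num.min (eta0 / 2) (Num.min ((1 - t) / 2) (e / 4 / (K * (L + 1) + 1))).
have KL : 0 < K * (L + 1) + 1 by rewrite ltr_wpDl// mulr_ge0// addr_ge0// ltW.
have et0 : 0 < eta by rewrite !lt_min !divr_gt0//= subr_gt0.
have et1 : eta < eta0 by rewrite (le_lt_trans (y := eta0 / 2)) ?ge_min ?lexx//; lra.
have et2 : t + eta < 1.
  have : eta <= (1 - t) / 2 by rewrite !ge_min lexx orbT.
  lra.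
have et3 : K * ((L + 1) * eta) <= e / 4.
  have : eta <= e / 4 / (K * (L + 1) + 1) by rewrite !ge_min lexx !orbT.
  rewrite ler_pdivlMr// => /(le_trans _); apply.
  by rewrite mulrA mulrC ler_wpM2l ?(ltW et0)// lerDl.
pose G := n%:R * `|p| + q + 1.
have G0 : 0 < G by rewrite ltr_wpDl// addr_ge0.
(* The tolerance for the arc is chosen after eta, so as to change a quotient by eta by at most e /
   4. *)
pose z := Num.min eta (e / 8 * eta / G).
have z0 : 0 < z by rewrite lt_min et0 divr_gt0// mulr_gt0// divr_gt0.
have zeta : z <= eta by rewrite ge_min lexx.
have zG : (n%:R * `|p| + q) * (2 * z) <= e / 4 * eta.
  have : z <= e / 8 * eta / G by rewrite ge_min lexx orbT.
  rewrite ler_pdivlMr// /G => h1.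
  have : 0 <= z by exact: ltW.
  by move: h1; set a := n%:R * _; clear; lra.
have [j [[j1 j2] [j3 j4]]] := filter_ex (filterI (near t z z0) (near (t + eta) z z0)).
have te : t <= t + eta by rewrite lerDl ltW.
have ct : clamp t = t by rewrite clampE// !ltW.
have cte : clamp (t + eta) = t + eta by rewrite clampE// (le_trans (ltW t0))//= ltW.
rewrite ct in j1 j2; rewrite cte in j3 j4.
set Y := traj x (als j) in j1 j3; set al := als j in Y j1 j2 j3 j4.
have Yj s : t <= s <= t + eta -> `|Y s - y t| <= (L + 1) * eta /\ `|Y s| <= rho + 1.
  move=> /andP[ts st]; have s01 : 0 <= s <= 1.
    by rewrite (le_trans (ltW t0))//= (le_trans st)// ltW.
  split; last by rewrite (le_trans (Hr _ _ (ca j) s01))// lerDl.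
  rewrite -(subrK (Y t) (Y s)) -addrA (le_trans (ler_normD _ _))// mulrDl mul1r lerD//.
    have := YL j s t; rewrite (clampE s01) ct => /le_trans; apply.
    by rewrite ler_pM2l// ger0_norm ?subr_ge0// lerBlDl.
  exact: le_trans j1 zeta.
have lr := lbm_running dyn x (ca j).
have ld := lbm_dotp_f dyn x p (ca j).
(* Separation gives the rate D + e, of which freezing loses e / 4. From above, [Phi] allows the rate
   D + e / 4 and the tolerance z another e / 4, so the two bounds are incompatible. *)
have low : eta * (D + 3 / 4 * e) <=
    dotp p (Y (t + eta) - Y t) + q * itg (running x al) t (t + eta).
  have -> := trajectory_incr_dotp dyn x p (ca j) (ltW t0) te.
  have t0' := ltW t0; have lq := lbmZ q lr.
  rewrite -itgZ// -itgD//.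
  have -> : eta * (D + 3 / 4 * e) = itg (fun=> D + 3 / 4 * e) t (t + eta).
    by rewrite itg_cst// [t + eta]addrC addrK mulrC.
  apply: (itg_le (lbm_cst _) (lbmD ld lq) t0').
  move=> s /andP[/ltW ts /ltW st].
  have Aa : A (al s) by apply: (ca j).1; rewrite (le_trans (ltW t0)).
  have tse : t <= s <= t + eta by rewrite ts.
  have [y1 y2] := Yj s tse; rewrite -/al -/Y.
  have [f1 l1] := HL _ _ (al s) y2 yr Aa.
  have := Hsep _ Aa.
  have fd : `|dotp p (f (Y s) (al s)) - dotp p (f (y t) (al s))| <= n%:R * `|p| * (L1 * `|Y s - y t|).
    by rewrite -dotpNr -dotpDr (le_trans (dotp_norm _ _))// ler_wpM2l.
  have ql : q * (l (y t) (al s) - l (Y s) (al s)) <= q * (L1 * `|Y s - y t|).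
    by rewrite ler_wpM2l// (le_trans (ler_norm _))// distrC.
  have kk : K * `|Y s - y t| <= e / 4.
    by apply: le_trans et3; rewrite ler_wpM2l.
  move: fd; rewrite ler_norml => /andP[fd _].
  move: fd ql kk; rewrite /K.
  set a1 := dotp p (f (Y s) _); set a2 := dotp p (f (y t) _).
  set b1 := l (Y s) _; set b2 := l (y t) _; set N := `|Y s - y t|; set P := n%:R * `|p|.
  by clear; lra.
have := Heta eta et0 et1; apply/negP; rewrite -ltNge.
have h1 : dotp p (Y (t + eta) - Y t) <= dotp p (y (t + eta) - y t) + n%:R * `|p| * (2 * z).
  have -> : Y (t + eta) - Y t =
      (y (t + eta) - y t) + ((Y (t + eta) - y (t + eta)) - (Y t - y t)).
    by apply/rowP => i; rewrite !mxE; ring.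
  rewrite dotpDr lerD2l (le_trans (ler_norm _))// (le_trans (dotp_norm _ _))// ler_wpM2l//.
  by rewrite (le_trans (ler_normB _ _))// mulr2n mulrDl mul1r lerD.
have h2 : q * itg (running x al) t (t + eta) <= q * (c (t + eta) - c t) + q * (2 * z).
  rewrite -mulrDr ler_wpM2l//.
  have := itg_cat lr (lexx 0) (ltW t0) te.
  move: j2 j4; rewrite !ler_distl => /andP[j21 j22] /andP[j41 j42] jc.
  by move: jc j21 j22 j41 j42; clear; lra.
have Ed : Phi (t + eta) - Phi t = dotp p (y (t + eta) - y t) + q * (c (t + eta) - c t).
  by rewrite dotpDr dotpNr /Phi; ring.
rewrite Ed; have ee : 0 < e * eta by exact: mulr_gt0.
move: low h1 h2 zG ee.
set a1 := dotp p (Y _ - _); set a2 := dotp p (y _ - _); set b1 := q * itg _ _ _.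
set b2 := q * (c _ - _); set P := n%:R * `|p|.
by clear; lra.
Qed.

End TrajectoryClosure.

Section ClosureTheorem.
Context {R : realType} {n m : nat}.
Variables (A : set 'rV[R]_m) (f : 'rV[R]_n -> 'rV[R]_m -> 'rV[R]_n)
  (l : 'rV[R]_n -> 'rV[R]_m -> R).
Hypotheses (dyn : standing_dynamics A f l) (l_ge0 : forall x a, A a -> 0 <= l x a).
Hypothesis velocities_convex : forall x : 'rV[R]_n,
  convex_set [set p : 'rV[R]_n * R^o | exists2 a, A a & p.1 = f x a /\ l x a <= p.2].

Local Notation mu := (@lebesgue_measure R).
Local Notation traj := (trajectory f).
Local Notation running x al := (fun s => l (traj x al s) (al s)).

(** At almost every time the limit velocity and the density of the limit cost lie in the convex set,
    so a measurable control realizes the velocity at no greater running cost. The limit arc is the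
    trajectory of this control by uniqueness; the cost may drop in the limit, hence the one-sided
    estimate. *)
Lemma trajectory_closure x (als : nat -> R -> 'rV[R]_m) : (forall j, controls A (als j)) ->
  exists2 al, controls A al & forall (N : nat) (e : R), 0 < e ->
    exists j, [/\ (N <= j)%N, `|traj x al 1 - traj x (als j) 1| <= e &
      itg (running x al) 0 1 <= itg (running x (als j)) 0 1 + e].
Proof.
move=> ca; have [U [y [c [L [[UU UF] L0 lip YL near]]]]] := limit_arc dyn x ca.
have UP : ProperFilter U by exact: ultra_proper.
have A0 : A !=set0 by exists (als 0%N 0); exact: (ca 0%N).1.
have zero01 : 0 <= (0 : R) <= 1 by rewrite lexx ler01.
have one01 : 0 <= (1 : R) <= 1 by rewrite lexx ler01.
have y0 : y 0 = x.
  apply/eqP; rewrite -subr_eq0 -normr_le0; apply/ler_addgt0Pr => e e0; rewrite add0r.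
  have [j [h _]] := filter_ex (near 0 e e0).
  by move: h; rewrite clampE// (trajectory0 (trajectoryP dyn x (ca j))) distrC.
have c0 : c 0 = 0.
  apply/eqP; rewrite -normr_le0; apply/ler_addgt0Pr => e e0; rewrite add0r.
  have [j [_ h]] := filter_ex (near 0 e e0).
  by move: h; rewrite clampE// itg_same sub0r normrN.
have cy : {within (`[0, +oo[ : set R), continuous y}.
  apply: lipschitz_continuous => T _; exists L => s t _ st _.
  by rewrite -(ger0_norm (x := t - s)) ?subr_ge0//; have [] := lip t s.
have /choice[G HG] : forall i, exists g : R -> R, [/\ measurable_fun [set: R] g,
    forall t, 0 <= t <= 1 -> y t 0 i = x 0 i + Rintegral mu `[0, t] g
  & {ae mu, forall t : R, 0 < t < 1 -> is_derive t 1 (fun s => y s 0 i) (g t)}].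
  move=> i; have lipi s t : `|y s 0 i - y t 0 i| <= L * `|s - t|.
    by rewrite -coordB (le_trans (ler_coord _ _))//; have [] := lip s t.
  have [g [mg _ gE gd]] := lipschitz_density L0 lipi.
  by exists g; split => // t t01; rewrite gE// y0.
have [h [mh ih hE hd]] := lipschitz_density L0 (fun s t => (lip s t).2).
pose g t : 'rV[R]_n := \row_i G i t.
have gG i t : g t 0 i = G i t by rewrite mxE.
have mg i : measurable_fun (`[0, +oo[ : set R) (fun t => g t 0 i).
  rewrite (_ : (fun t => _) = G i); last by apply/funext => t; exact: gG.
  by apply: measurable_funTS; have [] := HG i.
have [al cal Hal] := measurable_velocity_selection dyn A0 cy mg (measurable_funTS mh).
have good : {ae mu, forall t : R, 0 < t < 1 ->
    f (y t) (al t) = g t /\ l (y t) (al t) <= h t}.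
  have aeF := ae_filter_ringOfSetsType mu.
  have Gd : {ae mu, forall t : R, forall i, 0 < t < 1 -> is_derive t 1 (fun s => y s 0 i) (G i t)}.
    by apply: filter_forall => i; have [] := HG i.
  apply: filterS2 Gd hd => t Gt ht t01; apply: Hal; first by case/andP: t01 => /ltW.
  apply: (limit_velocity dyn velocities_convex ca UP L0 YL near t01); last exact: ht.
  by move=> i; rewrite gG; exact: Gt.
have ly := lbm_l dyn cy cal.
have yU : trajectory_until f 1 x al y.
  split => // t i t01; have [mGi GE _] := HG i; rewrite GE//; congr (_ + _); apply/esym.
  apply: (itg_ae_eq (lbm_f dyn i cy cal) mGi); last by case/andP: t01.
  move: good.
  apply: filterS; first exact: (ae_filter_ringOfSetsType mu).
  by move=> s Hs /Hs[-> _]; rewrite gG.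
have trU : trajectory_until f 1 x al (traj x al).
  have H := trajectoryP dyn x cal.
  by split=> [|t i /andP[t0 _]]; [exact: H.1|exact: (trajectory_coordE H)].
have yE s : 0 <= s <= 1 -> traj x al s = y s.
  exact: (trajectory_until_causal dyn cal cal trU yU).
exists al => // N e e0.
have UN : U [set j | (N <= j)%N] by apply: UF; exact: nbhs_infty_ge.
have [j [Nj [h1 h2]]] := filter_ex (filterI UN (near 1 e e0)).
rewrite clampE// in h1 h2.
exists j; split => //; first by rewrite yE// distrC.
have -> : itg (running x al) 0 1 = itg (fun s => l (y s) (al s)) 0 1.
  apply: (itg_ext (lbm_running dyn x cal) ly (lexx 0)).
  by move=> s /andP[s0 s1]; rewrite yE// !ltW.
have : itg (fun s => l (y s) (al s)) 0 1 <= c 1.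
  rewrite hE// c0 add0r; apply: (itg_ae_le ly) => //.
    by move=> s s0; apply: l_ge0; exact: cal.1.
  move: good; apply: filterS; first exact: (ae_filter_ringOfSetsType mu).
  by move=> s Hs /Hs[].
by move: h2; rewrite ler_distl => /andP[h2 _] /le_trans; apply; lra.
Qed.

End ClosureTheorem.

(** * Comparison with the value functions *)

Section SupersolutionBound.
Context {R : realType} {n m : nat}.
Variables (A : set 'rV[R]_m) (f : 'rV[R]_n -> 'rV[R]_m -> 'rV[R]_n)
  (l : 'rV[R]_n -> 'rV[R]_m -> R) (T : set 'rV[R]_n).
Hypotheses (dyn : standing_dynamics A f l) (l_ge0 : forall x a, A a -> 0 <= l x a)
  (T_closed : closed T).
Implicit Types (x y z : 'rV[R]_n) (al : R -> 'rV[R]_m) (w : 'rV[R]_n -> \bar R).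

Local Notation traj := (trajectory f).
Local Notation running x al := (fun s => l (traj x al s) (al s)).
Local Notation H := (hamiltonian f l A).
Local Notation Vm := (value_m f l A T).

(** The value 0 on T keeps a nonnegative w lower semicontinuous on the whole space, so that
    penalized minimizers may be sought across T. *)
Definition zero_on_target w z : \bar R := if z \in T then 0%E else w z.

Lemma zero_on_targetE w z : ~ T z -> zero_on_target w z = w z.
Proof. by move=> nT; rewrite /zero_on_target memNset. Qed.

Lemma near_off_target z : ~ T z -> \forall z' \near z, ~ T z'.
Proof.
by move=> nT; apply: open_nbhs_nbhs; split => //; exact: closed_openC.
Qed.

Lemma zero_on_target_lsc w : (forall z, ~ T z -> (0 <= w z)%E) ->
  (forall z (c : R), ~ T z -> (c%:E < w z)%E -> \forall z' \near z, (c%:E < w z')%E) ->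
  lsc_everywhere (zero_on_target w).
Proof.
move=> w0 lw z c; have [Tz|nT] := pselect (T z).
  rewrite /zero_on_target mem_set// => c0; have FF : Filter (nbhs z) by exact: nbhs_filter.
  apply: filterS (@filterT _ _ FF) => z' _.
  by case: ifPn => // /negP nz'; apply: lt_le_trans c0 _; apply: w0 => Tz'; apply: nz'; rewrite inE.
rewrite zero_on_targetE// => /(lw z c nT) nc.
by apply: filterS2 nc (near_off_target nT) => z' h nz'; rewrite zero_on_targetE.
Qed.

Lemma zero_on_target_supersol w : visc_supersol H (~` T) w ->
  visc_supersol H (~` T) (zero_on_target w).
Proof.
move=> sw phi x C1 nT; rewrite zero_on_targetE// => fx Hx.
apply: sw => //; apply: filterS2 Hx (near_off_target nT) => z h nz.
by rewrite zero_on_targetE in h.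
Qed.

(** With A empty, H is -oo and no test function may touch w from below off T; a finite w x would
    yield such a contact, as a penalized minimum close to x. *)
Lemma supersol_without_controls w x : A = set0 -> lsc_everywhere w ->
  (forall z, (0 <= w z)%E) -> visc_supersol H (~` T) w -> ~ T x -> w x = +oo%E.
Proof.
move=> A0 lw w0 sw nT; have := w0 x; case Ew : (w x) => [W||] // _; exfalso.
have /nbhs_ballP[e /= e0 He] := near_off_target nT.
have W0 : 0 <= W by rewrite -lee_fin -Ew.
have e2 : 0 < e / 2 by exact: divr_gt0.
have e4 : 0 < (e / 2) ^+ 2 by exact: exprn_gt0.
pose k := (W + 1) / (e / 2) ^+ 2.
have k0 : 0 < k by rewrite divr_gt0// ltr_wpDl.
have Wk : W < k * (e / 2) ^+ 2 by rewrite divfK ?gt_eqF// ltrDl.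
have [|z [xz fz _ nz]] := @penalized_min R n w x x k W (e / 2) lw w0 k0 e2 Wk.
  by rewrite Ew /penalty subrr dotp0l mulr0 adde0.
have nTz : ~ T z.
  apply: He; rewrite mx_norm_ball /ball_/=; apply: le_lt_trans xz _; lra.
have [a] := visc_supersol_penalty sw nTz fz ltr01 nz.
by rewrite A0.
Qed.

(** Continuity of [Vm] on the boundary of T, in the uniform form that compactness of the boundary
    provides. *)
Definition small_near_target : Prop := forall e : R, 0 < e ->
  exists2 r : R, 0 < r & forall z z', T z' -> `|z - z'| < r -> (Vm z <= e%:E)%E.

(* In the first case the Euler arcs are exact enough by continuity; in the second one
   they are replaced by a genuine limit trajectory. *)
Lemma supersol_step w : A !=set0 -> lsc_everywhere w -> (forall z, (0 <= w z)%E) ->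
  visc_supersol H (~` T) w -> small_near_target ->
  (forall z (c : R), ~ T z -> (w z < c%:E)%E -> \forall z' \near z, (w z' < c%:E)%E) \/
  (forall x : 'rV[R]_n, convex_set [set p : 'rV[R]_n * R^o |
      exists2 a, A a & p.1 = f x a /\ l x a <= p.2]) ->
  forall x (Wx del : R), (w x <= Wx%:E)%E -> 0 < del ->
  (Vm x <= (Wx + del)%:E)%E \/ exists2 al, controls A al &
    (w (traj x al 1) + (itg (running x al) 0 1)%:E <= (Wx + del)%:E)%E.
Proof.
move=> A0 lw w0 sw small cases x Wx del wx del0.
have del2 : 0 < del / 2 by exact: divr_gt0.
have del4 : 0 < del / 4 by exact: divr_gt0.
have del8 : 0 < del / 8 by exact: divr_gt0.
have [r r0 Hr] := small _ del2.
have [|nV] := pselect (Vm x <= (Wx + del)%:E)%E; first by left.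
right.
(* Coming within r of T at this price would give the first alternative, which has just been
   excluded. *)
have reach al (t : R) z : controls A al -> 0 <= t -> T z -> `|traj x al t - z| < r ->
    itg (running x al) 0 t <= Wx + del / 2 -> False.
  move=> ca t0 Tz tz it; apply: nV.
  apply: le_trans (value_m_le_running T dyn l_ge0 x ca t0) _.
  apply: le_trans (leeD (lexx _) (Hr _ _ Tz tz)) _.
  by rewrite -EFinD lee_fin; lra.
pose eta (j : nat) : R := Num.min 1 (r / 2) / j.+1%:R.
have min0 : 0 < Num.min 1 (r / 2) by rewrite lt_min ltr01 divr_gt0.
have eta0 j : 0 < eta j by exact: divr_gt0.
have etar j : eta j < r.
  rewrite ltr_pdivrMr// (@le_lt_trans _ _ (r / 2)) ?ge_min ?lexx ?orbT//.
  by rewrite (@lt_le_trans _ _ (r * 1)) ?ler_pM2l ?ler1n//; lra.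
have /choice[q Hq] : forall j : nat, exists q : (R -> 'rV[R]_m) * 'rV[R]_n,
    [/\ controls A q.1, `|traj x q.1 1 - q.2| <= eta j &
     (w q.2 + (itg (running x q.1) 0 1)%:E <= (Wx + del / 2)%:E)%E].
  move=> j; have [[al [t [z [ca /andP[t0 _] Tz tz it]]]]|[al [z [ca tz it]]]] :=
    superoptimality_euler dyn l_ge0 A0 lw w0 sw wx (eta0 j) del2.
    by exfalso; apply: (reach al t z) => //; apply: le_lt_trans tz _.
  by exists (al, z).
pose als j := (q j).1; pose zs j := (q j).2.
have ca j : controls A (als j) by have [] := Hq j.
have tz j : `|traj x (als j) 1 - zs j| <= eta j by have [] := Hq j.
have wz j : (w (zs j) + (itg (running x (als j)) 0 1)%:E <= (Wx + del / 2)%:E)%E.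
  by have [] := Hq j.
have i0 al : controls A al -> 0 <= itg (running x al) 0 1.
  by move=> cal; exact: (itg_running_ge0 f l_ge0).
have wzr j : exists2 c : R, w (zs j) = c%:E & c + itg (running x (als j)) 0 1 <= Wx + del / 2.
  have := wz j; have := w0 (zs j); case: (w (zs j)) => [c||] //=.
  by rewrite -EFinD lee_fin => _ h; exists c.
have eta_small (e : R) : 0 < e -> exists N, forall j, (N <= j)%N -> eta j < e.
  move=> e0; exists (Num.bound (Num.min 1 (r / 2) / e)) => j Nj.
  rewrite ltr_pdivrMr// [ltRHS]mulrC -ltr_pdivrMr//.
  rewrite (lt_le_trans (archi_boundP _))//; first by rewrite divr_ge0 ?ltW.
  by rewrite ler_nat; exact: leq_trans (leqnSn _).
case: cases => [usc|conv]; last first.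
  (* Convex case: the minimizers zs j come arbitrarily close to the end of the limit trajectory, so
     that lower semicontinuity of w there is enough. *)
  have [al cal Hal] := trajectory_closure dyn l_ge0 conv x ca.
  exists al => //; rewrite leNgt; apply/negP => lt.
  have : ((Wx + del - itg (running x al) 0 1)%:E < w (traj x al 1))%E.
    by rewrite EFinB lteBlDr.
  move=> /lw/nbhs_ballP[e /= e0 He].
  have e3 : 0 < Num.min (e / 3) (del / 4) by rewrite lt_min del4 divr_gt0.
  have [N HN] := eta_small (e / 3) (divr_gt0 e0 (ltr0n _ 3)).
  have [j [Nj yj ij]] := Hal N _ e3.
  have [c wc cW] := wzr j.
  have : ((Wx + del - itg (running x al) 0 1)%:E < w (zs j))%E.
    apply: He; rewrite mx_norm_ball /ball_/=.
    rewrite -(subrK (traj x (als j) 1) (traj x al 1)) -addrA (le_lt_trans (ler_normD _ _))//.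
    have h1 : `|traj x al 1 - traj x (als j) 1| <= e / 3 by rewrite (le_trans yj)// ge_min lexx.
    have h2 := le_lt_trans (tz j) (HN j Nj).
    by move: h1 h2; clear - e0; lra.
  rewrite wc lte_fin.
  have : itg (running x al) 0 1 <= itg (running x (als j)) 0 1 + del / 4.
    by rewrite (le_trans ij)// lerD2l ge_min lexx orbT.
  by move: cW del0; clear; lra.
(* Continuous case: end points and minimizers share a limit p, and continuity at p turns the bound
   at a minimizer into one at the end of the same arc. *)
have [rho rho0 Hrho] := trajectory_bounded dyn x 1.
have [U [UU UF]] := ultraFilterLemma eventually_filter.
have UP : ProperFilter U by exact: ultra_proper.
have [j|p Hp] := ultrafilter_limit (u := fun j => traj x (als j) 1) UU (@closed_ball_compact R n rho).
  by apply: Hrho; rewrite ?ler01 ?lexx.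
have near e : 0 < e -> exists j, `|traj x (als j) 1 - p| < e /\ `|zs j - p| < e.
  move=> e0; have e2 : 0 < e / 2 by exact: divr_gt0.
  have [N HN] := eta_small _ e2.
  have UN : U [set j | (N <= j)%N] by apply: UF; exact: nbhs_infty_ge.
  have [j [Nj]] := filter_ex (filterI UN (Hp _ (nbhsx_ballx p _ e2))).
  rewrite mx_norm_ball /ball_/= distrC => pj; exists j.
  split; first by rewrite (lt_trans pj)// ltr_pdivrMr// ltr_pMr// ltr1n.
  rewrite -(subrK (traj x (als j) 1) (zs j)) -addrA (le_lt_trans (ler_normD _ _))//.
  by rewrite (splitr e) ltrD// distrC (le_lt_trans (tz j))//; exact: HN.
have [Tp|nTp] := pselect (T p).
  have [j [yj _]] := near _ r0; exfalso; apply: (reach (als j) 1 p) => //.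
  have [c wc cW] := wzr j; have : 0 <= c by rewrite -lee_fin -wc.
  by move: cW; clear; lra.
have := w0 p; case Ew : (w p) => [W||] // _.
  have lo : ((W - del / 8)%:E < w p)%E by rewrite Ew lte_fin ltrBlDr ltrDl.
  have hi : (w p < (W + del / 8)%:E)%E by rewrite Ew lte_fin ltrDl.
  have : nbhs p [set z | ((W - del / 8)%:E < w z)%E /\ (w z < (W + del / 8)%:E)%E].
    exact: (@filterI _ _ (nbhs_filter p) _ _ (lw _ _ lo) (usc _ _ nTp hi)).
  move=> /nbhs_ballP[e /= e0 He].
  have [j [yj zj]] := near _ e0; exists (als j) => //.
  have [_ h1] : ((W - del / 8)%:E < w (traj x (als j) 1))%E /\
      (w (traj x (als j) 1) < (W + del / 8)%:E)%E.
    by apply: He; rewrite mx_norm_ball /ball_/= distrC.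
  have [h2 _] : ((W - del / 8)%:E < w (zs j))%E /\ (w (zs j) < (W + del / 8)%:E)%E.
    by apply: He; rewrite mx_norm_ball /ball_/= distrC.
  have [c wc cW] := wzr j; rewrite wc lte_fin in h2.
  apply: le_trans (leeD (ltW h1) (lexx _)) _; rewrite -EFinD lee_fin.
  by move: h2 cW del0; clear; lra.
have : ((Wx + del / 2)%:E < w p)%E by rewrite Ew ltry.
move=> /lw/nbhs_ballP[e /= e0 He].
have [j [_ zj]] := near _ e0; have [c wc cW] := wzr j.
have : ((Wx + del / 2)%:E < w (zs j))%E by apply: He; rewrite mx_norm_ball /ball_/= distrC.
by rewrite wc lte_fin; have := i0 _ (ca j); move: cW; clear; lra.
Qed.

Lemma value_m_le_supersol w : (forall z, ~ T z -> (0 <= w z)%E) ->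
  (forall z (c : R), ~ T z -> (c%:E < w z)%E -> \forall z' \near z, (c%:E < w z')%E) ->
  visc_supersol H (~` T) w -> small_near_target ->
  (forall z (c : R), ~ T z -> (w z < c%:E)%E -> \forall z' \near z, (w z' < c%:E)%E) \/
  (forall x : 'rV[R]_n, convex_set [set p : 'rV[R]_n * R^o |
      exists2 a, A a & p.1 = f x a /\ l x a <= p.2]) ->
  forall x, ~ T x -> (Vm x <= w x)%E.
Proof.
move=> w0 lw sw small cases x nT; rewrite -(zero_on_targetE w nT).
have z0 z : (0 <= zero_on_target w z)%E.
  by rewrite /zero_on_target; case: ifPn => // /negP nz; apply: w0 => Tz; apply: nz; rewrite inE.
have zl := zero_on_target_lsc w0 lw; have zs := zero_on_target_supersol sw.
have [A0|/set0P A0] := eqVneq A set0.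
  by rewrite (supersol_without_controls A0 zl z0 zs nT) leey.
apply: (value_m_le_of_steps (A := A) (f := f) (l := l) (T := T)) => // y Wy del nTy wy d0.
apply: (supersol_step A0 zl z0 zs small) => //.
case: cases => [usc|]; [left=> z c nTz|by right].
rewrite zero_on_targetE// => /(usc z c nTz) h.
by apply: filterS2 h (near_off_target nTz) => z' h' nz'; rewrite zero_on_targetE.
Qed.

End SupersolutionBound.

(** * [value_m] solves the Hamilton-Jacobi equation *)

Section ValueEquation.
Context {R : realType} {n m : nat}.
Variables (A : set 'rV[R]_m) (f : 'rV[R]_n -> 'rV[R]_m -> 'rV[R]_n)
  (l : 'rV[R]_n -> 'rV[R]_m -> R) (T : set 'rV[R]_n).
Hypotheses (dyn : standing_dynamics A f l) (l_ge0 : forall x a, A a -> 0 <= l x a)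
  (T_closed : closed T).
Implicit Types (x y z p : 'rV[R]_n) (al : R -> 'rV[R]_m) (w : 'rV[R]_n -> \bar R).

Local Notation traj := (trajectory f).
Local Notation running x al := (fun s => l (traj x al s) (al s)).
Local Notation H := (hamiltonian f l A).
Local Notation Vm := (value_m f l A T).

Lemma near_ball_rV x (P : 'rV[R]_n -> Prop) : (\forall z \near x, P z) ->
  exists2 r : R, 0 < r & forall z, `|z - x| < r -> P z.
Proof.
move=> /nbhs_ballP[r /= r0 Hr]; exists r => // z zx; apply: Hr.
by rewrite mx_norm_ball /ball_/= distrC.
Qed.

Lemma trajectory_bounded_near x (t : R) : exists2 rho : R, 0 < rho &
  forall z al s, `|z - x| <= 1 -> controls A al -> 0 <= s <= t -> `|traj z al s| <= rho.
Proof.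
have [M M0 HM] := norm_growth dyn.
exists (2 * (1 + (`|x| + 1)) * expR (2 * M * t)).
  by rewrite !mulr_gt0 ?expR_gt0// ltr_wpDr// addr_ge0.
move=> z al s zx ca /andP[s0 st].
have := trajectory_growth dyn M0 HM ca (trajectoryP dyn z ca) s0.
move=> h; apply: (@le_trans _ _ (1 + `|traj z al s|)); first by rewrite lerDr.
apply: le_trans h _; apply: ler_pM; rewrite ?mulr_ge0 ?addr_ge0 ?expR_ge0//.
  rewrite ler_pM2l// lerD2l -(subrK x z) (le_trans (ler_normD _ _))// addrC.
  by rewrite lerD2l.
by rewrite ler_expR ler_pM2l ?mulr_gt0.
Qed.

Lemma short_time_bounds x : exists rho L F, bounds_on_ball A f l rho L F /\
  forall z al s, `|z - x| <= 1 -> controls A al -> 0 <= s <= 1 ->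
    `|traj z al s| <= rho /\ `|traj z al s - z| <= F * s.
Proof.
have [rho rho0 bound] := trajectory_bounded_near x 1.
have [L [F bb]] := bounds_on_ball_exist dyn rho0.
exists rho, L, F; split => // z al s zx ca s01; split; first exact: bound.
have /andP[s0 s1] := s01.
rewrite -[X in _ - X](trajectory0 (trajectoryP dyn z ca)) -{2}[s]subr0.
apply: (trajectory_incr_norm dyn bb) => // u /andP[u0 us].
by apply: bound => //; rewrite u0 (le_trans us).
Qed.

(** The first-order expansion behind both viscosity properties: freezing f and l at x along a short
    arc changes the rate by O(h), uniformly in the control. Arcs start at z because the envelopes
    are only approximated near x; d comes after h since z - x has to be negligible against h. *)
Lemma short_time_estimate x p : exists2 C : R, 0 < C & forall e : R, 0 < e ->
  exists2 h0 : R, 0 < h0 & forall h, 0 < h -> h <= h0 ->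
  exists2 d : R, 0 < d & forall z al, `|z - x| < d -> controls A al ->
    [/\ forall s, 0 <= s <= h -> `|traj z al s - x| <= C * h,
        forall k, (forall u, 0 < u < h -> k <= dotp p (f x (al u)) + l x (al u)) ->
          (k - e) * h <= itg (running z al) 0 h + dotp p (traj z al h - x) &
        forall k, (forall u, 0 < u < h -> dotp p (f x (al u)) + l x (al u) <= k) ->
          itg (running z al) 0 h + dotp p (traj z al h - x) <= (k + e) * h].
Proof.
have [rho [L [F [bb Hb]]]] := short_time_bounds x; have [L0 F0 HL HF] := bb.
have N0 : 0 < n%:R * `|p| + 1 by rewrite ltr_wpDl// mulr_ge0.
exists (F + 1); first exact: addr_gt0.
move=> e e0; pose K := (n%:R * `|p| + 1) * L * (F + 1).
have K0 : 0 < K by rewrite !mulr_gt0// addr_gt0.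
exists (Num.min 1 (e / 2 / K)); first by rewrite lt_min ltr01 !divr_gt0.
move=> h h0; rewrite le_min => /andP[h1 hK].
have Kh : K * h <= e / 2 by rewrite mulrC -ler_pdivlMr.
exists (Num.min h (e / 2 * h / (n%:R * `|p| + 1))).
  by rewrite lt_min h0 divr_gt0// mulr_gt0// divr_gt0.
move=> z al; rewrite lt_min => /andP[zh zp] ca.
have zx1 : `|z - x| <= 1 by rewrite (le_trans (ltW zh)).
have near s : 0 <= s <= h -> `|traj z al s - x| <= (F + 1) * h.
  move=> /andP[s0 sh]; have s01 : 0 <= s <= 1 by rewrite s0 (le_trans sh).
  rewrite -(subrK z (traj z al s)) -addrA (le_trans (ler_normD _ _))// mulrDl mul1r.
  rewrite lerD//; last exact: ltW.
  by rewrite (le_trans (Hb z al s zx1 ca s01).2)// ler_pM2l.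
have pz : `|dotp p (z - x)| <= e / 2 * h.
  rewrite (le_trans (dotp_norm _ _))//.
  have : `|z - x| <= e / 2 * h / (n%:R * `|p| + 1) by exact: ltW.
  rewrite ler_pdivlMr// mulrDr mulr1 mulrC; apply: le_trans.
  by rewrite lerDl.
have lr := lbm_running dyn z ca; have ld := lbm_dotp_f dyn z p ca.
have x01 : `|x| <= rho.
  have := (Hb x al 0 _ ca _).1; rewrite (trajectory0 (trajectoryP dyn x ca)); apply.
    by rewrite subrr normr0 ler01.
  by rewrite lexx ler01.
have dev u : 0 < u < h ->
    `|(dotp p (f (traj z al u) (al u)) + l (traj z al u) (al u)) -
      (dotp p (f x (al u)) + l x (al u))| <= e / 2.
  move=> /andP[/ltW u0 /ltW uh]; have Aa : A (al u) by exact: ca.1.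
  have u01 : 0 <= u <= 1 by rewrite u0 (le_trans uh).
  have [b1 _] := Hb z al u zx1 ca u01.
  have [f1 l1] := HL _ _ _ b1 x01 Aa.
  rewrite opprD addrACA -dotpNr -dotpDr (le_trans (ler_normD _ _))//.
  apply: le_trans Kh; apply: (@le_trans _ _ ((n%:R * `|p| + 1) * (L * `|traj z al u - x|))).
    by rewrite mulrDl mul1r lerD// (le_trans (dotp_norm _ _))// ler_wpM2l// mulr_ge0.
  by rewrite /K -!mulrA ler_pM2l// ler_pM2l// near// u0.
have E : itg (running z al) 0 h + dotp p (traj z al h - x) =
    itg (fun u => dotp p (f (traj z al u) (al u)) + l (traj z al u) (al u)) 0 h + dotp p (z - x).
  rewrite itgD// -(trajectory_incr_dotp dyn z p ca (lexx 0) (ltW h0)).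
  rewrite (trajectory0 (trajectoryP dyn z ca)) !dotpDr !dotpNr; ring.
move: pz; rewrite ler_norml => /andP[pz1 pz2].
split => // k Hk; rewrite E.
  have : itg (fun=> k - e / 2) 0 h <=
      itg (fun u => dotp p (f (traj z al u) (al u)) + l (traj z al u) (al u)) 0 h.
    apply: (itg_le (lbm_cst _) (lbmD ld lr) (lexx 0)) => u uh.
    by have := dev u uh; have := Hk u uh; rewrite ler_distl => ? /andP[? _]; lra.
  rewrite (itg_cst _ (ltW h0)) subr0; move: pz1; set a1 := itg _ _ _; set a2 := dotp _ _.
  by clear; lra.
have : itg (fun u => dotp p (f (traj z al u) (al u)) + l (traj z al u) (al u)) 0 h <=
    itg (fun=> k + e / 2) 0 h.
  apply: (itg_le (lbmD ld lr) (lbm_cst _) (lexx 0)) => u uh.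
  by have := dev u uh; have := Hk u uh; rewrite ler_distl => ? /andP[_ ?]; lra.
rewrite (itg_cst _ (ltW h0)) subr0; move: pz2; set a1 := itg _ _ _; set a2 := dotp _ _.
by clear; lra.
Qed.

Lemma outside_off_target z : ~ T z -> outside T z.
Proof. by move=> nT /interior_subset. Qed.

(** If H were negative, cost plus the first-order change of phi would grow at least at a rate eta >
    0 for every control. A nearly optimal control, from a point where [Vm] almost equals its
    envelope at x, violates this by dynamic programming. *)
Lemma value_m_supersol : visc_supersol H (~` T) (lsc_env (outside T) Vm).
Proof.
move=> phi x C1 nT fx Hx; set Vl := lsc_env (outside T) Vm in fx Hx *.
set p := grad phi x; rewrite leNgt; apply/negP => Hneg.
have [eta eta0 Heta] : exists2 eta : R, 0 < eta &
    forall a, A a -> eta <= dotp p (f x a) + l x a.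
  have ub a : A a -> ((- dotp p (f x a) - l x a)%:E <= H x p)%E.
    by move=> Aa; apply: ereal_sup_ubound; exists a.
  case: (H x p) Hneg ub => [r||] //= r0 ub; last by exists 1 => // a /ub.
  exists (- r); first by rewrite oppr_gt0.
  by move=> a /ub; rewrite lee_fin; lra.
have [C C0 HC] := short_time_estimate x p.
have [h0 h00 Hh0] := HC (eta / 4) (divr_gt0 eta0 (ltr0n _ 4)).
have [phid _] := C1 x nT.
have e0 : 0 < eta / 4 / C by rewrite !divr_gt0.
have [r1 r10 phiE] := differentiable_expansion phid e0.
have [r r0 Hr] : exists2 r : R, 0 < r & forall z, `|z - x| < r ->
    [/\ ~ T z, (Vl x - (phi x)%:E <= Vl z - (phi z)%:E)%E &
        `|phi z - phi x - dotp p (z - x)| <= eta / 4 / C * `|z - x|].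
  have [r2 r20 offT] := near_ball_rV (near_off_target T_closed nT).
  have [r3 r30 Hmin] := near_ball_rV Hx.
  exists (Num.min r1 (Num.min r2 r3)); first by rewrite !lt_min r10 r20.
  by move=> z; rewrite !lt_min => /and3P[z1 z2 z3]; split; [exact: offT|exact: Hmin|exact: phiE].
pose h := Num.min h0 (r / 2 / C).
have hpos : 0 < h by rewrite lt_min h00 !divr_gt0.
have hC : C * h < r.
  apply: (@le_lt_trans _ _ (r / 2)); last lra.
  by rewrite mulrC -ler_pdivlMr// ge_min lexx orbT.
have hh0 : h <= h0 by rewrite ge_min lexx.
have [d d0 Hd] := Hh0 h hpos hh0.
have [v vE] : exists v, Vl x = v%:E by exists (fine (Vl x)); rewrite fineK.
have [z zd [oz Vz]] : exists2 z, `|z - x| < Num.min d r & outside T z /\ (Vm z < (v + eta / 4 * h)%:E)%E.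
  apply: lsc_env_approx; first by rewrite lt_min d0.
  by rewrite -/Vl vE lte_fin ltrDl mulr_gt0// divr_gt0.
move: zd; rewrite lt_min => /andP[zd zr].
have [nTz _ _] := Hr z zr.
move: Vz; rewrite /value_m memNset// => /ereal_inf_lt[_ [al ca <-]] cost.
have [near low _] := Hd z al zd ca.
have off s : 0 <= s <= h -> ~ T (traj z al s).
  by move=> sh; have [] := Hr (traj z al s) (le_lt_trans (near s sh) hC).
have := running_value_m_le dyn l_ge0 ca (ltW hpos) off.
move=> /le_lt_trans/(_ cost).
have hh : 0 <= h <= h by rewrite lexx ltW.
have [nTy Hy py] := Hr (traj z al h) (le_lt_trans (near h hh) hC).
have Vy : (Vl (traj z al h) <= Vm (traj z al h))%E.
  by apply: lsc_env_le; exact: outside_off_target.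
have {}low : (eta - eta / 4) * h <= itg (running z al) 0 h + dotp p (traj z al h - x).
  by apply: low => u /andP[/ltW u0 _]; apply: Heta; exact: ca.1.
move: Hy Vy; rewrite vE -/Vl; case: (Vl (traj z al h)) => [b||]; rewrite -?EFinB ?lee_fin//; last first.
  by move=> _; rewrite leye_eq => /eqP ->; rewrite addey.
move=> hb Vy cost'; have {cost' Vy} : itg (running z al) 0 h + b < v + eta / 4 * h.
  rewrite -lte_fin EFinD; apply: le_lt_trans cost'.
  by rewrite leeD2l.
have {}near : eta / 4 / C * `|traj z al h - x| <= eta / 4 * h.
  by rewrite -mulrA ler_pM2l ?divr_gt0// mulrC ler_pdivrMr// mulrC near.
move: py low hb; rewrite ler_norml => /andP[py _].
have : 0 < eta * h by exact: mulr_gt0.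
move: near py; set J := itg _ _ _; set P := dotp _ _; set N := _ * `|_|.
by clear; lra.
Qed.

Lemma usc_env_approx (X : set 'rV[R]_n) w x c (e : R) : 0 < e -> (c < usc_env X w x)%E ->
  exists2 z, `|z - x| < e & X z /\ (c < w z)%E.
Proof.
move=> e0 cw; apply/not_exists2P => Hn.
suff : (usc_env X w x <= c)%E by rewrite leNgt cw.
apply: usc_env_le; apply/nbhs_ballP; exists e => //= z; rewrite mx_norm_ball /ball_/= => xz Xz.
have [|] := Hn z; first by rewrite distrC.
by move=> h; rewrite leNgt; apply/negP => cz; apply: h.
Qed.

(** If the constant control a violated the inequality, the envelope would fall along its arc by more
    than the cost paid, against [value_m_le_running]. *)
Lemma value_m_subsol (O : set 'rV[R]_n) : open O ->
  visc_subsol H (O `\` T) (usc_env (O `\` interior T) Vm).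
Proof.
move=> oO phi x C1 OTx fx Hx; have [Ox nT] := OTx.
set Vu := usc_env (O `\` interior T) Vm in fx Hx *.
set p := grad phi x; apply: ge_ereal_sup => _ [a Aa <-]; rewrite lee_fin leNgt; apply/negP => Hpos.
pose eta := - dotp p (f x a) - l x a; have eta0 : 0 < eta by [].
have [C C0 HC] := short_time_estimate x p.
have [h0 h00 Hh0] := HC (eta / 4) (divr_gt0 eta0 (ltr0n _ 4)).
have [phid _] := C1 x OTx.
have e0 : 0 < eta / 4 / C by rewrite !divr_gt0.
have [r1 r10 phiE] := differentiable_expansion phid e0.
have [r r0 Hr] : exists2 r : R, 0 < r & forall z, `|z - x| < r ->
    [/\ O z /\ ~ T z, (Vu z - (phi z)%:E <= Vu x - (phi x)%:E)%E &
        `|phi z - phi x - dotp p (z - x)| <= eta / 4 / C * `|z - x|].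
  have [r2 r20 offT] := near_ball_rV (near_off_target T_closed nT).
  have [r3 r30 Hmax] := near_ball_rV Hx.
  have [r4 r40 inO] : exists2 r : R, 0 < r & forall z, `|z - x| < r -> O z.
    by apply: near_ball_rV; exact: open_nbhs_nbhs.
  exists (Num.min (Num.min r1 r4) (Num.min r2 r3)); first by rewrite !lt_min r10 r20 r40.
  move=> z; rewrite !lt_min => /andP[/andP[z1 z4] /andP[z2 z3]].
  by split; [split; [exact: inO|exact: offT]|exact: Hmax|exact: phiE].
pose h := Num.min h0 (r / 2 / C).
have hpos : 0 < h by rewrite lt_min h00 !divr_gt0.
have hC : C * h < r.
  apply: (@le_lt_trans _ _ (r / 2)); last lra.
  by rewrite mulrC -ler_pdivlMr// ge_min lexx orbT.
have hh0 : h <= h0 by rewrite ge_min lexx.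
have [d d0 Hd] := Hh0 h hpos hh0.
have [v vE] : exists v, Vu x = v%:E by exists (fine (Vu x)); rewrite fineK.
have [z zd [Dz Vz]] : exists2 z, `|z - x| < d &
    (O `\` interior T) z /\ ((v - eta / 4 * h)%:E < Vm z)%E.
  apply: usc_env_approx => //.
  by rewrite -/Vu vE lte_fin ltrBlDr ltrDl mulr_gt0// divr_gt0.
have ca := controls_cst Aa; set al := (fun=> a) in ca.
have [near _ up] := Hd z al zd ca.
have {}up : itg (running z al) 0 h + dotp p (traj z al h - x) <= (- eta + eta / 4) * h.
  by apply: up => u _; rewrite /eta /al opprB addrC opprK.
have hh : 0 <= h <= h by rewrite lexx ltW.
have [[Oy nTy] Hy py] := Hr (traj z al h) (le_lt_trans (near h hh) hC).
have Vy : (Vm (traj z al h) <= Vu (traj z al h))%E.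
  by apply: usc_env_ge; split => // /interior_subset.
have := value_m_le_running T dyn l_ge0 z ca (ltW hpos).
move=> /(lt_le_trans Vz)/lt_le_trans/(_ (leeD2l _ Vy)).
move: Hy; rewrite vE -/Vu; case: (Vu (traj z al h)) => [b||] //; rewrite -?EFinB ?lee_fin ?lte_fin//.
have {}near : eta / 4 / C * `|traj z al h - x| <= eta / 4 * h.
  by rewrite -mulrA ler_pM2l ?divr_gt0// mulrC ler_pdivrMr// mulrC near.
move: py up; rewrite ler_norml => /andP[_ py].
have : 0 < eta * h by exact: mulr_gt0.
move: near py; set J := itg _ _ _; set P := dotp _ _; set N := _ * `|_|.
by clear; lra.
Qed.

End ValueEquation.

(** * Approach to the target and upper semicontinuity of [value_m] *)

Section ValueRegularity.
Context {R : realType} {n m : nat}.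
Variables (A : set 'rV[R]_m) (f : 'rV[R]_n -> 'rV[R]_m -> 'rV[R]_n)
  (l : 'rV[R]_n -> 'rV[R]_m -> R) (T : set 'rV[R]_n).
Hypotheses (dyn : standing_dynamics A f l) (l_ge0 : forall x a, A a -> 0 <= l x a)
  (T_closed : closed T) (bdT_compact : compact (boundary T)).
Implicit Types (x y z p : 'rV[R]_n) (al : R -> 'rV[R]_m) (w : 'rV[R]_n -> \bar R).

Local Notation traj := (trajectory f).
Local Notation running x al := (fun s => l (traj x al s) (al s)).
Local Notation H := (hamiltonian f l A).
Local Notation Vm := (value_m f l A T).
Local Notation V := (value f l A T).
Local Notation entry := (entry_time f T).

Lemma continuous_dependence x al (t e : R) : controls A al -> 0 <= t -> 0 < e ->
  exists2 d : R, 0 < d & forall z, `|z - x| < d ->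
    `|traj z al t - traj x al t| <= e /\
    itg (running z al) 0 t <= itg (running x al) 0 t + e.
Proof.
move=> ca t0 e0; have [rho rho0 Hr] := trajectory_bounded_near dyn x t.
have [L [F [L0 F0 HL HF]]] := bounds_on_ball_exist dyn rho0.
pose E := 2 * expR (2 * L * t); have E0 : 0 < E by rewrite mulr_gt0 ?expR_gt0.
have G0 : 0 < E * (1 + L * t) by rewrite mulr_gt0// ltr_pwDl// mulr_ge0// ltW.
exists (Num.min 1 (e / (E * (1 + L * t)))); first by rewrite lt_min ltr01 divr_gt0.
move=> z; rewrite lt_min ltr_pdivlMr// => /andP[/ltW z1 /ltW ze].
have x1 : `|x - x| <= 1 by rewrite subrr normr0.
have tr x' : trajectory_until f t x' al (traj x' al).
  have H := trajectoryP dyn x' ca.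
  by split=> [|s i /andP[s0 _]]; [exact: H.1|exact: (trajectory_coordE H)].
have st s : 0 <= s <= t -> `|traj z al s - traj x al s| <= E * `|z - x|.
  move=> /andP[s0 s1].
  have := trajectory_stability dyn L0 _ ca ca (tr z) (tr x) (fun _ _ => erefl) (r := rho).
  move=> /(_ _ _ s)h; apply: le_trans (h _ _ _) _.
  - by move=> ? ? a h1 h2 Aa; have [] := HL _ _ _ h1 h2 Aa.
  - by move=> u ut; split; exact: Hr.
  - by rewrite s0.
  rewrite /E mulrAC ler_wpM2r// ler_pM2l// ler_expR ler_pM2l// mulr_gt0//.
have Ee : E * `|z - x| <= e.
  apply: le_trans ze; rewrite mulrCA ler_pM2l//.
  by rewrite mulrDr mulr1 lerDl mulr_ge0// mulr_ge0// ltW.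
split; first by apply: le_trans (st t _) Ee; rewrite t0 lexx.
have l1 := lbm_running dyn z ca; have l2 := lbm_running dyn x ca.
have -> : itg (running z al) 0 t = itg (running x al) 0 t +
    itg (fun s => l (traj z al s) (al s) + -1 * l (traj x al s) (al s)) 0 t.
  by rewrite itgD ?itgZ//; [ring|exact: lbmZ].
rewrite lerD2l (le_trans (ler_norm _))//.
apply: (@le_trans _ _ (L * (E * `|z - x|) * (t - 0))); last first.
  apply: le_trans ze; rewrite subr0 (_ : _ * t = `|z - x| * (E * (L * t))); last by ring.
  by rewrite ler_wpM2l// ler_pM2l// lerDr.
apply: itg_norm_cst => //; first by apply: lbmD => //; exact: lbmZ.
move=> s /andP[/ltW s0 /ltW s1]; rewrite mulN1r.
have s01 : 0 <= s <= t by rewrite s0.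
have [_ h] := HL _ _ _ (Hr z al s z1 ca s01) (Hr x al s x1 ca s01) (ca.1 s s0).
by apply: le_trans h _; rewrite ler_pM2l// st.
Qed.

(** Speed is bounded and T is closed. A positive entry time puts the nonnegative times before entry
    into its left filter. *)
Lemma entry_time_pos x al : ~ T x -> controls A al ->
  exists2 d : R, 0 < d & (d%:E <= entry x al)%E.
Proof.
move=> nT ca; have [e e0 He] := near_ball_rV (near_off_target T_closed nT).
have [rho [L [F [[L0 F0 _ _] Hb]]]] := short_time_bounds dyn x.
exists (Num.min 1 (e / 2 / F)); first by rewrite lt_min ltr01 !divr_gt0.
apply: le_ereal_inf_tmp => _ [t [t0 Tt] <-]; rewrite lee_fin leNgt lt_min.
apply/negP => /andP[t1 te]; apply: (He _ _ Tt).
have x1 : `|x - x| <= 1 by rewrite subrr normr0.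
have t01 : 0 <= t <= 1 by rewrite t0 ltW.
have [_ h] := Hb x al t x1 ca t01.
apply: le_lt_trans h _; rewrite mulrC -ltr_pdivlMr// (lt_trans te)//.
by rewrite ltr_pM2r ?invr_gt0//; lra.
Qed.

(** A zero lower limit bounds by 0 the infimum of the distance over every member of the left filter,
    in particular over the times in [0, entry[. This covers an infinite entry time. *)
Lemma approaching_control_reaches x al (r : R) : ~ T x ->
  approaching_controls f A T x al -> 0 < r ->
  exists t z, [/\ 0 <= t, (t%:E < entry x al)%E, T z & `|traj x al t - z| < r].
Proof.
move=> nT [ca lim0] r0; have [d d0 de] := entry_time_pos nT ca.
pose B := [set t : R | 0 <= t /\ (t%:E < entry x al)%E].
have FV : left_filter (entry x al) B.
  rewrite /B.
  move: de; case: (entry x al) => [r1||] //=.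
    rewrite lee_fin => dr; have r10 : 0 < r1 by exact: lt_le_trans dr.
    near=> t; split; last by rewrite lte_fin; near: t; exact: nbhs_left_lt.
    by near: t; exact: nbhs_left_ge.
  move=> _; near=> t; split; last exact: ltry.
  by near: t; exact: nbhs_pinfty_ge.
move: lim0; rewrite limf_einfE => lim0.
have : (ereal_inf [set dist T (traj x al t) | t in B] < r%:E)%E.
  apply: (@le_lt_trans _ _ 0%E); last by rewrite lte_fin.
  by rewrite -lim0; apply: ereal_sup_ubound; exists B.
move=> /ereal_inf_lt[_ [t [t0 te] <-]] /ereal_inf_lt[_ [z Tz <-]]; rewrite lte_fin => zr.
by exists t, z; split => //; exact: le_lt_trans (norm_le_enorm _) zr.
Unshelve. all: by end_near. Qed.

Lemma before_entry x al (s t : R) : 0 <= s <= t -> (t%:E < entry x al)%E -> ~ T (traj x al s).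
Proof.
move=> /andP[s0 st] te Ts; have := entry_time_le s0 Ts.
by rewrite leNgt => /negP; apply; apply: le_lt_trans te; rewrite lee_fin.
Qed.

Lemma running_le_cost x al (t : R) : controls A al -> (t%:E <= entry x al)%E ->
  ((itg (running x al) 0 t)%:E <= cost f l (entry x al) x al)%E.
Proof.
move=> ca te; apply: itg_le_running_cost => //; first exact: (lbm_running dyn x ca).
by move=> s s0; apply: l_ge0; exact: ca.1.
Qed.

Lemma value_m_on_target x : T x -> Vm x = 0%E.
Proof. by move=> Tx; rewrite /value_m mem_set. Qed.

Lemma boundary_target x : boundary T x -> T x.
Proof. by move=> [cx _]; rewrite -(closure_id T).1 in cx. Qed.

Lemma not_outside x : ~ outside T x -> T x.
Proof. by move=> /contrapT /interior_subset. Qed.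

Lemma small_near_targetP : (forall b, boundary T b ->
    Vm z @[z --> within (outside T) (nbhs b)] --> Vm b) -> small_near_target A f l T.
Proof.
move=> cV e e0.
have [|r r0 Hr] := @near_target R n T (fun z => (Vm z <= e%:E)%E) T_closed bdT_compact.
  move=> b Bb; have FF : Filter (within (outside T) (nbhs b)) by exact: within_filter.
  have [_ /(_ e)] := (ereal_cvgP Vm (Vm b) FF).1 (cV b Bb).
  rewrite value_m_on_target ?lte_fin; last exact: boundary_target.
  move=> /(_ e0); rewrite near_withinE; apply: filterS => z Hz.
  have [oz|/not_outside Tz] := pselect (outside T z); first exact/ltW/Hz.
  by rewrite value_m_on_target// lee_fin ltW.
exists r => // z z' Tz' zz'; have [Tz|nT] := pselect (T z); last exact: Hr zz'.
by rewrite value_m_on_target// lee_fin ltW.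
Qed.

Definition usc_everywhere w : Prop :=
  forall x (c : R), (w x < c%:E)%E -> \forall z \near x, (w z < c%:E)%E.

(** By V = V^m a nearly optimal control may be taken among those that come close to T. From nearby
    starting points the same control also comes close to T, at almost the same cost, and there [Vm]
    is small. *)
Lemma value_m_usc : (forall x, V x = Vm x) -> small_near_target A f l T -> usc_everywhere Vm.
Proof.
move=> VE small x c xc; have FF : Filter (nbhs x) by exact: nbhs_filter.
have c0 : 0 < c.
  by rewrite -lte_fin; apply: le_lt_trans xc; exact: value_m_ge0.
have [Tx|nT] := pselect (T x).
  have c2 : 0 < c / 2 by exact: divr_gt0.
  have [r r0 Hr] := small _ c2; apply/nbhs_ballP; exists r => //= z.
  rewrite mx_norm_ball /ball_/= distrC => zx.
  by apply: le_lt_trans (Hr _ _ Tx zx) _; rewrite lte_fin; lra.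
move: xc; rewrite -VE /value memNset// => /ereal_inf_lt[_ [al apal <-]] cost_c.
have ca := apal.1.
have [k ck kc] : exists2 k : R, (cost f l (entry x al) x al <= k%:E)%E & k < c.
  have : (0 <= cost f l (entry x al) x al)%E.
    by apply: running_cost_ge0 => s s0; apply: l_ge0; exact: ca.1.
  by move: cost_c; case: cost => [k||] // kc _; exists k; rewrite ?lexx// -lte_fin.
(* One third for the change of the cost, one for [Vm] near T, and one to keep the inequality
   strict. *)
pose e := (c - k) / 3; have e0 : 0 < e by rewrite divr_gt0// subr_gt0.
have [r r0 Hr] := small _ e0.
have [t [z' [t0 te Tz' tz']]] := approaching_control_reaches nT apal r0.
have rr : 0 < Num.min e ((r - `|traj x al t - z'|) / 2) by rewrite lt_min e0 divr_gt0// subr_gt0.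
have [d d0 Hd] := continuous_dependence x ca t0 rr.
apply/nbhs_ballP; exists d => //= z; rewrite mx_norm_ball /ball_/= distrC => zx.
have [h1 h2] := Hd z zx.
apply: le_lt_trans (value_m_le_running T dyn l_ge0 z ca t0) _.
have near : (Vm (traj z al t) <= e%:E)%E.
  apply: (Hr _ z' Tz').
  rewrite -(subrK (traj x al t) (traj z al t)) -addrA (le_lt_trans (ler_normD _ _))//.
  have : `|traj z al t - traj x al t| <= (r - `|traj x al t - z'|) / 2.
    by rewrite (le_trans h1)// ge_min lexx orbT.
  by move: tz'; clear; lra.
apply: le_lt_trans (leeD2l _ near) _; rewrite -EFinD lte_fin.
have h3 : itg (running z al) 0 t <= itg (running x al) 0 t + e.
  by rewrite (le_trans h2)// lerD2l ge_min lexx.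
have h4 : itg (running x al) 0 t <= k.
  by rewrite -lee_fin; apply: le_trans ck; apply: running_le_cost => //; exact: ltW.
by move: h3 h4; rewrite /e; have := kc; clear; lra.
Qed.

Lemma open_dom w : usc_everywhere w -> (forall x, T x -> (w x < +oo)%E) ->
  open (Dom T w `|` T).
Proof.
move=> uw wT; rewrite openE => x Dx.
have [c xc] : exists c : R, (w x < c%:E)%E.
  have : (w x < +oo)%E by case: Dx => [[]|/wT].
  case: (w x) => [k||] // _; last by exists 0; exact: ltNyr.
  by exists (k + 1); rewrite lte_fin ltrDl.
apply: filterS (uw x c xc) => z zc.
have [oz|/not_outside Tz] := pselect (outside T z); last by right.
by left; split => //; exact: lt_trans zc (ltry c).
Qed.

End ValueRegularity.

(** * Subsolutions lie below the cost of approaching controls *)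

Section SubsolutionBound.
Context {R : realType} {n m : nat}.
Variables (A : set 'rV[R]_m) (f : 'rV[R]_n -> 'rV[R]_m -> 'rV[R]_n)
  (l : 'rV[R]_n -> 'rV[R]_m -> R) (T : set 'rV[R]_n).
Hypotheses (dyn : standing_dynamics A f l) (l_ge0 : forall x a, A a -> 0 <= l x a)
  (T_closed : closed T) (bdT_compact : compact (boundary T)).
Implicit Types (x y z p : 'rV[R]_n) (al : R -> 'rV[R]_m) (v w : 'rV[R]_n -> \bar R).

Local Notation traj := (trajectory f).
Local Notation running x al := (fun s => l (traj x al s) (al s)).
Local Notation H := (hamiltonian f l A).
Local Notation Vm := (value_m f l A T).
Local Notation V := (value f l A T).
Local Notation entry := (entry_time f T).

(* The local suboptimality inequality is propagated backwards from a time at which the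
   trajectory is close to T; blow-up prevents it from leaving the domain meanwhile. *)
Lemma subsolution_le_cost v x al : nonneg_bvp_solution H T v -> blows_up T v -> ~ T x ->
  approaching_controls f A T x al -> (v x <= cost f l (entry x al) x al)%E.
Proof.
move=> [v0 [_ [[oO TO] vfin vlb vbd vsub]]] blow nTx apal; have ca := apal.1.
set O := Dom T v `|` T in oO TO vfin vlb vbd vsub.
set D := O `\` interior T in vfin vlb vbd vsub.
set W := usc_env D v in vbd vsub.
have oOT : open (O `\` T) by rewrite setDE; apply: openI => //; exact: closed_openC.
have DO z : O z -> ~ T z -> D z by move=> Oz nT; split => // /interior_subset.
have vW z : O z -> ~ T z -> (v z <= W z)%E.
  by move=> Oz nT; apply: usc_env_ge; exact: DO.
have W0 z : (O `\` T) z -> (0 <= W z)%E.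
  by move=> [Oz nT]; apply: le_trans (vW z Oz nT); apply: v0; exact: outside_off_target.
have Wfin z : (O `\` T) z -> W z \is a fin_num.
  move=> OTz; rewrite ge0_fin_numE; last exact: W0.
  have [M HM] := vlb z (DO z OTz.1 OTz.2).
  apply: (@le_lt_trans _ _ M%:E); last exact: ltry.
  apply: usc_env_le; move: HM; rewrite near_withinE; apply: filterS => z' h Dz'.
  exact: le_trans (lee_abs _) (h Dz').
apply/lee_addgt0Pr => e e0.
have [|r r0 Hr] := @near_target R n T (fun z => O z /\ (W z < e%:E)%E) T_closed bdT_compact.
  move=> b Bb; have FF : Filter (nbhs b) by exact: nbhs_filter.
  apply: filterI; first by apply: open_nbhs_nbhs; split => //; apply: TO; exact: boundary_target.
  apply: usc_env_usc; apply: le_lt_trans (vbd b Bb) _.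
  by rewrite lte_fin.
have [t [z' [t0 te Tz' tz']]] := approaching_control_reaches dyn T_closed nTx apal r0.
pose y s := traj x al s.
have nTy s : 0 <= s <= t -> ~ T (y s) by move=> st; exact: before_entry st te.
have tt : 0 <= t <= t by rewrite t0 lexx.
have [Oyt Wyt] := Hr _ _ (nTy t tt) Tz' tz'.
have OTt : (O `\` T) (y t) by split => //; exact: nTy.
pose P s := O (y s) /\ (W (y s) <= (itg (running x al) s t)%:E + W (y t))%E.
have lr := lbm_running dyn x ca.
have Pt : P t by split => //; rewrite itg_same add0e.
pose S := [set s : R | 0 <= s <= t /\ forall u, s <= u <= t -> P u].
have St : S t by split => // u /andP[tu ut]; have -> : u = t by apply/eqP; rewrite eq_le ut.
have hS : has_inf S by split; [exists t|exists 0 => s [/andP[]]].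
pose sg := inf S.
have sg0 : 0 <= sg by apply: lb_le_inf; [exists t|move=> s [/andP[]]].
have sgt : sg <= t by apply: ge_inf => //; exact: hS.2.
have Pgt u : sg < u -> u <= t -> P u.
  move=> su ut; have us : 0 < u - sg by rewrite subr_gt0.
  have [s [_ Hs] su'] := inf_adherent us hS; apply: Hs.
  by rewrite ut andbT; move: su'; rewrite -/sg => /ltW; rewrite subrKC.
have [rho [F [F0 Hrho]]] : exists rho F : R, 0 < F /\ forall s1 s2, 0 <= s1 -> s1 <= s2 ->
    s2 <= t -> `|y s2 - y s1| <= F * (s2 - s1).
  have [rho rho0 Hrho] := trajectory_bounded dyn x t.
  have [L [F bb]] := bounds_on_ball_exist dyn rho0; have [_ F0 _ _] := bb.
  exists rho, F; split => // s1 s2 s10 s12 s2t.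
  apply: (trajectory_incr_norm dyn bb) => // u /andP[u1 u2].
  by apply: Hrho => //; rewrite (le_trans s10)//= (le_trans u2).
have sg01 : 0 <= sg <= t by rewrite sg0.
(* Just after sg, v is at most the remaining cost plus W (y t), so it cannot blow up at y sg. *)
have Osg : O (y sg).
  have [->//|sgt'] := eqVneq sg t; have {}sgt' : sg < t by rewrite lt_neqAle sgt'.
  apply: contrapT => nO.
  have approach (d : R) : 0 < d -> exists2 u, sg < u /\ u <= t & `|y u - y sg| < d.
    move=> d0; pose u := Num.min t (sg + d / F / 2).
    have su : sg < u by rewrite lt_min sgt' ltrDl !divr_gt0.
    exists u; first by split => //; rewrite ge_min lexx.
    apply: le_lt_trans (Hrho sg u sg0 (ltW su) _) _; first by rewrite ge_min lexx.
    have : u - sg <= d / F / 2 by rewrite lerBlDl ge_min lexx orbT.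
    rewrite -(ler_pM2l F0) => /le_lt_trans; apply.
    by rewrite [d / F]mulrC !mulrA divff ?gt_eqF// mul1r ltr_pdivrMr// ltr_pMr// ltr1n.
  have osg : outside T (y sg) by apply: outside_off_target; exact: nTy.
  have nD : ~ Dom T v (y sg) by move=> Dz; apply: nO; left.
  have bsg : boundary_in (outside T) (Dom T v) (y sg).
    split; last by apply: subset_closure.
    split => // B /nbhs_ballP[d /= d0 Bd].
    have [u [u1 u2] ud] := approach d d0; exists (y u); split; last first.
      by apply: Bd; rewrite mx_norm_ball /ball_/= distrC.
    have [[//|Tu] _] := Pgt u u1 u2.
    by exfalso; apply: (nTy u) => //; rewrite u2 (le_trans sg0)// ltW.
  have FF : Filter (within (outside T) (nbhs (y sg))) by exact: within_filter.
  have [c Wc] : exists c, W (y t) = c%:E by exists (fine (W (y t))); rewrite fineK// Wfin.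
  have [/(_ (itg (running x al) 0 t + c)) + _] := (ereal_cvgP v +oo%E FF).1 (blow _ bsg).
  move=> /(_ (ltry _)); rewrite near_withinE => /near_ball_rV[d d0 Hd].
  have [u [u1 u2] ud] := approach d d0; have u0 : 0 <= u by rewrite (le_trans sg0)// ltW.
  have uT : ~ T (y u) by apply: nTy; rewrite u0.
  have [Ou Wu] := Pgt u u1 u2.
  have := lt_le_trans (Hd _ ud (outside_off_target uT)) (le_trans (vW _ Ou uT) Wu).
  rewrite Wc -EFinD lte_fin ltNge lerD2r (itg_cat lr (lexx 0) u0 u2) lerDr => /negP; apply.
  exact: (itg_running_ge0 f l_ge0).
have OTsg : (O `\` T) (y sg) by split => //; exact: nTy.
have [r1 r10 Hsub] := suboptimality_local dyn l_ge0 oOT Wfin W0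
  (fun z Oz c => @usc_env_usc _ _ _ v z c%:E) vsub OTsg.
have [r2 r20 HO] : exists2 r2 : R, 0 < r2 & forall z, `|z - y sg| < r2 -> (O `\` T) z.
  by apply: near_ball_rV; exact: open_nbhs_nbhs.
(* At speed at most F, the arc stays within time d of sg in the region where it remains in O \ T and
   the local inequality applies. *)
pose d := Num.min r1 r2 / F / 2.
have d0 : 0 < d by rewrite !divr_gt0// lt_min r10.
have dF : F * d < Num.min r1 r2.
  rewrite /d [_ / F]mulrC !mulrA divff ?gt_eqF// mul1r ltr_pdivrMr// ltr_pMr ?ltr1n//.
  by rewrite lt_min r10.
have close s : 0 <= s <= t -> `|s - sg| <= d -> `|y s - y sg| < Num.min r1 r2.
  move=> /andP[s0 st] sd; apply: le_lt_trans dF.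
  apply: (@le_trans _ _ (F * `|s - sg|)); last by rewrite ler_pM2l.
  have [ssg|/ltW ssg] := leP s sg.
    by rewrite distrC (distrC s) [`|sg - s|]ger0_norm ?subr_ge0// Hrho.
  by rewrite [`|s - sg|]ger0_norm ?subr_ge0// Hrho.
have local s1 s2 : 0 <= s1 -> s1 <= s2 -> s2 <= t -> `|s1 - sg| <= d -> `|s2 - sg| <= d ->
    (W (y s1) <= (itg (running x al) s1 s2)%:E + W (y s2))%E.
  move=> s10 s12 s2t d1 d2.
  have cs := control_shift ca s10.
  have sh s : 0 <= s -> traj (y s1) (fun s => al (s1 + s)) s = y (s1 + s).
    by move=> s0; rewrite /y (trajectory_shift dyn).
  have := Hsub (y s1) (fun s => al (s1 + s)) (s2 - s1) cs.
  rewrite subr_ge0 sh ?subr_ge0// subrKC => /(_ s12).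
  have -> : itg (fun s => l (traj (y s1) (fun s => al (s1 + s)) s) (al (s1 + s))) 0 (s2 - s1) =
      itg (running x al) s1 s2.
    have := itg_shift (k := running x al) (s2 - s1) lr s10 (lexx 0).
    rewrite addr0 subrKC => <-.
    apply: (itg_ext (lbm_running dyn _ cs) (lbm_shift lr s10) (lexx 0)).
    by move=> s /andP[/ltW s0 _]; rewrite sh.
  apply=> s /andP[s0 ss]; rewrite sh//.
  have ss2 : s1 + s <= s2 by rewrite -lerBrDl.
  suff : `|y (s1 + s) - y sg| < Num.min r1 r2 by rewrite lt_min => /andP[].
  apply: close; first by rewrite addr_ge0//= (le_trans ss2).
  move: d1 d2; rewrite !ler_distl => /andP[a1 a2] /andP[a3 a4]; apply/andP; split; lra.
(* Continuation: s' also belongs to S, and it lies below the infimum sg unless sg = 0. *)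
pose s' := Num.max 0 (sg - d).
have Ss' : S s'.
  split.
    by rewrite le_max lexx/= ge_max t0/= lerBlDr (le_trans sgt)// lerDl ltW.
  move=> u /andP[]; rewrite ge_max => /andP[u0 ud] ut.
  have [usg|sgu] := leP u sg; last exact: Pgt.
  have udd : `|u - sg| <= d by rewrite ler_distl ud (le_trans usg)// lerDl ltW.
  have u01 : 0 <= u <= t by rewrite u0.
  split.
    have [] := HO (y u); last by [].
    by have := close u u01 udd; rewrite lt_min => /andP[].
  (* The local inequality is applied up to s2 rather than sg, since the propagated one is known only
     after sg, or at t. *)
  pose s2 := Num.min t (sg + d).
  have s2t : s2 <= t by rewrite ge_min lexx.
  have ss2 : sg <= s2 by rewrite le_min sgt lerDl ltW.
  have d2 : `|s2 - sg| <= d.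
    by rewrite ger0_norm ?subr_ge0// lerBlDl ge_min lexx orbT.
  have [_ Ps2] : P s2.
    have [h|h] := ltP sg s2; first exact: Pgt.
    have -> : s2 = t; last by [].
    apply/eqP; rewrite eq_le s2t leNgt; apply/negP => s2t'.
    have s2E : s2 = sg + d.
      by move: s2t'; rewrite /s2; case: (leP t (sg + d)) => //; rewrite ltxx.
    by move: h; rewrite s2E leNgt ltrDl d0.
  apply: le_trans (local u s2 u0 (le_trans usg ss2) s2t udd d2) _.
  apply: le_trans (leeD2l _ Ps2) _.
  by rewrite addeA -EFinD (itg_cat lr u0 (le_trans usg ss2) s2t).
have sg'0 : sg = 0.
  have : sg <= s' by apply: ge_inf => //; exact: hS.2.
  rewrite le_max => /orP[h|]; first by apply/eqP; rewrite eq_le sg0 h.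
  by rewrite lerBrDr leNgt ltrDl d0.
have s'0 : s' = 0.
  by rewrite /s' sg'0 sub0r; apply/max_idPl; rewrite oppr_le0 ltW.
have [Ox Wx] : P 0 by have [_] := Ss'; apply; rewrite s'0 lexx.
have y0 : y 0 = x by rewrite /y (trajectory0 (trajectoryP dyn x ca)).
rewrite y0 in Ox Wx.
apply: le_trans (vW x Ox nTx) _; apply: le_trans Wx _.
apply: leeD; last exact: ltW.
by apply: (running_le_cost dyn l_ge0 ca); exact: ltW.
Qed.

End SubsolutionBound.

(** * Existence and uniqueness for the boundary value problem *)

Section Characterization.
Context {R : realType} {n m : nat}.
Variables (A : set 'rV[R]_m) (f : 'rV[R]_n -> 'rV[R]_m -> 'rV[R]_n)
  (l : 'rV[R]_n -> 'rV[R]_m -> R) (T : set 'rV[R]_n).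
Hypotheses (dyn : standing_dynamics A f l) (l_ge0 : forall x a, A a -> 0 <= l x a)
  (T_closed : closed T) (bdT_compact : compact (boundary T)).
Implicit Types (x y z : 'rV[R]_n) (u v w : 'rV[R]_n -> \bar R).

Local Notation H := (hamiltonian f l A).
Local Notation Vm := (value_m f l A T).
Local Notation V := (value f l A T).
Hypothesis valueE : forall x, V x = Vm x.

Definition continuous_outside u : Prop := forall x, outside T x ->
  u z @[z --> within (outside T) (nbhs x)] --> u x.

Lemma continuous_outside_subspace u :
  continuous_outside u -> {within outside T, continuous u}.
Proof. by move=> cu; apply/subspace_continuousP. Qed.

(** Blow-up forces u = +oo on the relative boundary of its domain. A point of finite value is
    therefore relatively interior to the domain, and a point of value +oo is on this boundary or has
    a neighbourhood on which u is +oo. *)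
Lemma blows_up_continuous_outside u :
  {within Dom T u, continuous u} -> blows_up T u -> continuous_outside u.
Proof.
move=> /subspace_continuousP cu blow x ox.
have FF : Filter (within (outside T) (nbhs x)) by exact: within_filter.
have Fx : Filter (nbhs x) by exact: nbhs_filter.
have at_top : boundary_in (outside T) (Dom T u) x -> u x = +oo%E.
  move=> /blow/(ereal_cvgP u +oo%E FF)[+ _] => H1.
  case Ex : (u x) => [r||] //.
    have := H1 r (ltry r); rewrite near_withinE => /nbhs_singleton/(_ ox).
    by rewrite Ex ltxx.
  have := H1 0 (ltry 0); rewrite near_withinE => /nbhs_singleton/(_ ox).
  by rewrite Ex.
have [xfin|] := boolP (u x < +oo)%E; last first.
  rewrite -leNgt leye_eq => /eqP xoo.
  have [cx|ncx] := pselect (closure (Dom T u) x).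
    rewrite xoo; apply: blow; split => //.
    by apply: subset_closure; split => // -[_]; rewrite xoo ltxx.
  have far : \forall z \near x, ~ closure (Dom T u) z.
    by apply: open_nbhs_nbhs; split => //; apply: closed_openC; exact: closed_closure.
  rewrite xoo => P /nbhs_singleton Poo; apply: filterS far => z nz oz /=.
  suff -> : u z = +oo%E by [].
  apply/eqP; rewrite -leye_eq leNgt; apply/negP => zfin.
  by apply: nz; apply: subset_closure.
have Dx : Dom T u x by [].
have inD : \forall z \near x, outside T z -> Dom T u z.
  apply: contrapT => nin; have : u x = +oo%E.
    apply: at_top; split; first by split => //; exact: subset_closure.
    move=> B nB; apply: contrapT => nBB; apply: nin; apply: filterS nB => z Bz oz.
    by apply: contrapT => nD; apply: nBB; exists z.
  by move=> E; rewrite E ltxx in xfin.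
move=> P nP; have h : \forall z \near x, Dom T u z -> P (u z) by exact: cu x Dx P nP.
suff : \forall z \near x, outside T z -> P (u z) by [].
by apply: filterS2 h inD => z h1 h2 oz; exact: h1 (h2 oz).
Qed.

Lemma continuous_outside_gt u z (c : R) : continuous_outside u -> ~ T z ->
  (c%:E < u z)%E -> \forall z' \near z, (c%:E < u z')%E.
Proof.
move=> cu nT cz; have FF : Filter (within (outside T) (nbhs z)) by exact: within_filter.
have Fz : Filter (nbhs z) by exact: nbhs_filter.
have [H1 _] := (ereal_cvgP u (u z) FF).1 (cu z (outside_off_target nT)).
have := H1 c cz; rewrite near_withinE => h.
apply: filterS2 h (near_off_target T_closed nT) => z' h1 nT'.
exact/h1/outside_off_target.
Qed.

Lemma continuous_outside_lt u z (c : R) : continuous_outside u -> ~ T z ->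
  (u z < c%:E)%E -> \forall z' \near z, (u z' < c%:E)%E.
Proof.
move=> cu nT cz; have FF : Filter (within (outside T) (nbhs z)) by exact: within_filter.
have Fz : Filter (nbhs z) by exact: nbhs_filter.
have [_ H1] := (ereal_cvgP u (u z) FF).1 (cu z (outside_off_target nT)).
have := H1 c cz; rewrite near_withinE => h.
apply: filterS2 h (near_off_target T_closed nT) => z' h1 nT'.
exact/h1/outside_off_target.
Qed.

Lemma nonneg_boundary_zero v x : nonneg_bvp_solution H T v -> boundary T x -> v x = 0%E.
Proof.
move=> [v0 [_ [[_ TO] _ _ vbd _]]] Bx; have ox : outside T x by case: Bx.
apply/eqP; rewrite eq_le v0// andbT; apply: le_trans (vbd x Bx).
by apply: usc_env_ge; split; [apply: TO; exact: boundary_target|].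
Qed.

Lemma bvp_solution_unique v : small_near_target A f l T ->
  nonneg_bvp_solution H T v -> blows_up T v ->
  continuous_outside v \/ (forall x : 'rV[R]_n, convex_set [set p : 'rV[R]_n * R^o |
      exists2 a, A a & p.1 = f x a /\ l x a <= p.2]) ->
  forall x, outside T x -> v x = Vm x.
Proof.
move=> small sv blow cases x ox; have [v0 [[_ _ sup] _]] := sv.
have [Tx|nT] := pselect (T x).
  by rewrite (nonneg_boundary_zero sv) ?value_m_on_target//; split => //; exact: subset_closure.
set w := lsc_env (outside T) v in sup.
have wv z : ~ T z -> (w z <= v z)%E.
  by move=> nz; apply: lsc_env_le; exact: outside_off_target.
apply/eqP; rewrite eq_le; apply/andP; split.
  rewrite -valueE /value memNset//; apply: le_ereal_inf_tmp => _ [al apal <-].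
  exact: (subsolution_le_cost dyn l_ge0 T_closed bdT_compact sv blow nT apal).
apply: le_trans (wv x nT).
apply: (value_m_le_supersol dyn l_ge0 T_closed) => //.
- move=> z _; apply: le_lsc_env; have Fz : Filter (nbhs z) by exact: nbhs_filter.
  by apply: filterS (@filterT _ _ Fz) => z' _ oz'; exact: v0.
- by move=> z c _; exact: lsc_env_lsc.
case: cases => [cv|]; [left=> z c nTz wz|by right].
(* Off T a continuous v agrees with its lower envelope w, so upper semicontinuity passes from v to
   w. *)
have vz : (v z < c%:E)%E.
  apply: le_lt_trans wz; rewrite leNgt; apply/negP => lt.
  have : exists2 r : R, (w z < r%:E)%E & (r%:E < v z)%E.
    have := lt; rewrite /w; case: (lsc_env _ _ _) => [a||]; case: (v z) => [b||] //=.
    - by rewrite lte_fin => ab; exists ((a + b) / 2); rewrite lte_fin; lra.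
    - by move=> _; exists (a + 1); rewrite ?ltry// lte_fin ltrDl.
    - by move=> _; exists (b - 1); rewrite ?ltNyr// lte_fin ltrBlDr ltrDl.
    - by move=> _; exists 0; rewrite ?ltry ?ltNyr.
  move=> [r wr rv]; move: wr; rewrite ltNge => /negP; apply; apply: le_lsc_env.
  by apply: filterS (continuous_outside_gt cv nTz rv) => z' h _; exact: ltW.
have Fz : Filter (nbhs z) by exact: nbhs_filter.
apply: filterS2 (continuous_outside_lt cv nTz vz) (near_off_target T_closed nTz) => z' h nz'.
exact: le_lt_trans (wv z' nz') h.
Qed.

(** Upper semicontinuity makes the domain open and [Vm] locally bounded there, and gives the
    boundary condition from above; the one from below is nonnegativity. *)
Lemma value_m_bvp_solution : usc_everywhere Vm -> nonneg_bvp_solution H T Vm.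
Proof.
move=> usc; have V0 x : (0 <= Vm x)%E by exact: value_m_ge0.
have VT x : T x -> (Vm x < +oo)%E by move=> Tx; rewrite value_m_on_target// ltry.
split=> [x _|]; first exact: V0.
have real x : (Vm x < +oo)%E -> exists c : R, (Vm x < c%:E)%E.
  case: (Vm x) => [r||] // _; last by exists 0; exact: ltNyr.
  by exists (r + 1); rewrite lte_fin ltrDl.
have fin x : (Dom T Vm `|` T) x -> (Vm x < +oo)%E by case=> [[]|/VT].
split.
  split; last exact: value_m_supersol.
  - by move=> x _; apply/eqP => E; have := V0 x; rewrite E.
  - move=> x _; apply: le_lsc_env; have Fx : Filter (nbhs x) by exact: nbhs_filter.
    by apply: filterS (@filterT _ _ Fx) => z _ _; exact: V0.
split.
- by split; [exact: open_dom|move=> x Tx; right].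
- by move=> x [/fin xf _]; rewrite ge0_fin_numE.
- move=> x [/fin/real[c xc] _]; exists c; rewrite near_withinE.
  by apply: filterS (usc x c xc) => z zc _; rewrite gee0_abs// ltW.
- move=> x Bx; apply/lee_addgt0Pr => e e0; rewrite add0e; apply: usc_env_le.
  apply: filterS (usc x e _) => [z zc _|]; first exact: ltW.
  by rewrite value_m_on_target ?lte_fin//; exact: boundary_target.
by apply: value_m_subsol => //; exact: open_dom.
Qed.

Lemma continuous_outside_usc : continuous_outside Vm -> usc_everywhere Vm.
Proof.
move=> cV x c xc.
have c0 : 0 < c by rewrite -lte_fin; apply: le_lt_trans xc; exact: value_m_ge0.
have Tc z : T z -> (Vm z < c%:E)%E by move=> Tz; rewrite value_m_on_target// lte_fin.
have Fx : Filter (nbhs x) by exact: nbhs_filter.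
have [ox|nox] := pselect (outside T x); last first.
  have : nbhs x (interior T) by move: nox => /contrapT xT; apply: open_nbhs_nbhs; split => //; exact: open_interior.
  by apply: filterS => z /interior_subset; exact: Tc.
have FF : Filter (within (outside T) (nbhs x)) by exact: within_filter.
have [_ /(_ c xc)] := (ereal_cvgP Vm (Vm x) FF).1 (cV x ox).
rewrite near_withinE; apply: filterS => z Hz.
by have [/Hz//|/not_outside/Tc] := pselect (outside T z).
Qed.

(** The lower envelope of [Vm] is itself a supersolution, so comparison under convexity bounds [Vm]
    by its own envelope. *)
Lemma convex_value_continuous : small_near_target A f l T ->
  (forall x : 'rV[R]_n, convex_set [set p : 'rV[R]_n * R^o |
      exists2 a, A a & p.1 = f x a /\ l x a <= p.2]) ->
  (forall b, boundary T b -> Vm z @[z --> within (outside T) (nbhs b)] --> Vm b) ->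
  continuous_outside Vm.
Proof.
move=> small conv cb x ox; have [Tx|nT] := pselect (T x).
  by apply: cb; split => //; exact: subset_closure.
have usc := value_m_usc dyn l_ge0 T_closed valueE small.
have FF : Filter (within (outside T) (nbhs x)) by exact: within_filter.
apply/ereal_cvgP; split=> r; last first.
  by move=> /usc; rewrite near_withinE; apply: filterS => z h _.
move=> rx; have : (r%:E < lsc_env (outside T) Vm x)%E.
  apply: lt_le_trans rx _; apply: (value_m_le_supersol dyn l_ge0 T_closed) => //.
  - move=> z _; apply: le_lsc_env; have Fz : Filter (nbhs z) by exact: nbhs_filter.
    by apply: filterS (@filterT _ _ Fz) => z' _ _; exact: value_m_ge0.
  - by move=> z c _; exact: lsc_env_lsc.
  - exact: value_m_supersol.
  - by right.
by move=> /lsc_env_gt; rewrite near_withinE.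
Qed.

(** In the convex case this derives the blow-up of V from its continuity as a map into the extended
    reals. *)
Lemma continuous_outside_blows_up u : continuous_outside u -> blows_up T u.
Proof.
move=> cu x [[ox cx] cnx].
suff <- : u x = +oo%E by exact: cu.
apply/eqP; rewrite -leye_eq leNgt; apply/negP => xfin.
have FF : Filter (within (outside T) (nbhs x)) by exact: within_filter.
have [c xc] : exists c : R, (u x < c%:E)%E.
  case: (u x) xfin => [r||] // _; last by exists 0; exact: ltNyr.
  by exists (r + 1); rewrite lte_fin ltrDl.
have [_ /(_ c xc)] := (ereal_cvgP u (u x) FF).1 (cu x ox).
rewrite near_withinE => nc; have [z [[oz nD] zc]] := cnx _ nc.
by apply: nD; split => //; exact: lt_trans (zc oz) (ltry c).
Qed.

End Characterization.

Theorem theorem2p1 (R : realType) (n m : nat)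
  (A : set 'rV[R]_m) (T : set 'rV[R]_n)
  (f : 'rV[R]_n -> 'rV[R]_m -> 'rV[R]_n) (l : 'rV[R]_n -> 'rV[R]_m -> R)
  (A_compact : compact A)
  (T_closed : closed T)
  (bdT_compact : compact (boundary T))
  (f_cont : {within [set: 'rV[R]_n] `*` A, continuous (fun z => f z.1 z.2)})
  (l_cont : {within [set: 'rV[R]_n] `*` A, continuous (fun z => l z.1 z.2)})
  (l_ge0 : forall x a, A a -> 0 <= l x a)
  (f_growth : exists2 M : R, 0 < M &
     forall x a, A a -> enorm (f x a) <= M * (1 + enorm x))
  (fl_lipschitz : forall r : R, 0 < r -> exists2 L : R, 0 < L &
     forall x1 x2 a, enorm x1 <= r -> enorm x2 <= r -> A a ->
       enorm (f x1 a - f x2 a) <= L * enorm (x1 - x2) /\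
       `|l x1 a - l x2 a| <= L * enorm (x1 - x2)) :
  let V := value f l A T in
  let H := hamiltonian f l A in
  (forall x, outside T x -> V x = value_m f l A T x) ->
  ({within Dom T V, continuous V} -> blows_up T V ->
   unique_in T (fun u => [/\ nonneg_bvp_solution H T u,
                             {within Dom T u, continuous u}
                           & blows_up T u]) V)
  /\
  ((forall x : 'rV[R]_n,
      convex_set [set p : 'rV[R]_n * R^o |
                   exists2 a, A a & p.1 = f x a /\ l x a <= p.2]) ->
   (forall x, boundary T x ->
      V z @[z --> within (outside T) (nbhs x)] --> V x) ->
   unique_in T (fun u => nonneg_bvp_solution H T u /\ blows_up T u) V
   /\ {within outside T, continuous V}).
Proof.
move=> V H VVm.
have dyn : standing_dynamics A f l by split.
(* The assumption concerns points outside the interior of T; on T both functions are 0 by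
   definition. *)
have valueE x : value f l A T x = value_m f l A T x.
  have [ox|/not_outside Tx] := pselect (outside T x); first exact: VVm.
  by rewrite /value mem_set// value_m_on_target.
have VE : V = value_m f l A T by apply/funext.
rewrite VE; split=> [cV blow|conv cb].
  have coV := blows_up_continuous_outside cV blow.
  have small : small_near_target A f l T.
    by apply: (small_near_targetP T_closed bdT_compact) => b [_ ob]; exact: coV.
  split.
    split => //; apply: (value_m_bvp_solution dyn l_ge0 T_closed).
    exact: continuous_outside_usc.
  move=> v [sv cv bv]; apply: (bvp_solution_unique dyn l_ge0 T_closed bdT_compact valueE) => //.
  by left; exact: blows_up_continuous_outside.
have small := small_near_targetP T_closed bdT_compact cb.
have usc := value_m_usc dyn l_ge0 T_closed valueE small.
have coV := convex_value_continuous dyn l_ge0 T_closed valueE small conv cb.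
split; last exact: continuous_outside_subspace.
split.
  by split; [exact: (value_m_bvp_solution dyn l_ge0 T_closed)|exact: continuous_outside_blows_up].
move=> v [sv bv]; apply: (bvp_solution_unique dyn l_ge0 T_closed bdT_compact valueE) => //.
by right.
Qed.
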